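(* Let $\Omega\subset\mathbb{R}^2$ be a bounded domain, let $F=\ln\frac1f$ be any structured geometry, and let $\mathcal{L}u=\nabla^{\mathrm{tr}}\mathcal{A}(x,y,u(x,y))\nabla u$, where $\mathcal{A}$ has bounded measurable coefficients and $\mathcal{A}\approx D_f$. Then every weak solution $u\in W_f^{1,2}(\Omega)$ of the homogeneous special quasilinear equation $\mathcal{L}u=0$ in $\Omega$ is locally bounded in $\Omega$ (i.e. $u\in L^\infty(\Omega')$ for every $\Omega'\Subset\Omega$).
   Context: **Structured geometry.** $f:\mathbb{R}\to[0,\infty)$ is even and continuous, $f(0)=0$, $f(t)>0$ for $t\ne0$, and for some $R>0$, $f=e^{-F}$ on $(0,R)$ with $F:(0,R)\to\mathbb{R}$ twice continuously differentiable. $F$ is a structured geometry if for some constants $C\ge1$, $\varepsilon>0$: (1) $\lim_{x\to0^+}F(x)=+\infty$; (2) $F'<0$ and $F''>0$ on $(0,R)$; (3) $\frac1C|F'(r)|\le|F'(x)|\le C|F'(r)|$ whenever $\frac12r<x<2r<R$; (4) $\frac{1}{-xF'(x)}$ is increasing on $(0,R)$ and $\le\frac1\varepsilon$ there; (5) $\frac1{Cx}\le\frac{F''(x)}{-F'(x)}\le\frac Cx$ on $(0,R)$. **Matrices.** $D_f(x)=\begin{pmatrix}1&0\\0&f(x)^2\end{pmatrix}$. $\mathcal{A}(x,y,z)$ is a real symmetric nonnegative $2\times2$ matrix with bounded measurable entries (with $(x,y)\mapsto\mathcal{A}(x,y,u(x,y))$ measurable); $\mathcal{A}\approx D_f$ means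 that there are constants $0<c\le C<\infty$ with $c\,\xi^{\mathrm{tr}}D_f(x)\xi\le\xi^{\mathrm{tr}}\mathcal{A}(x,y,z)\xi\le C\,\xi^{\mathrm{tr}}D_f(x)\xi$ for a.e. $(x,y)\in\Omega$ and all $z\in\mathbb{R}$, $\xi\in\mathbb{R}^2$. **Spaces and weak solutions.** $\nabla_fv=(\partial_xv,f(x)\partial_yv)$; $W_f^{1,2}(\Omega)$ is the space of $v\in L^2(\Omega)$ with $\nabla_fv\in L^2(\Omega)$ (weakly), with norm $\left(\int_\Omega(|v|^2+|\nabla_fv|^2)\right)^{1/2}$; $(W_f^{1,2})_0(\Omega)$ is the closure in it of the Lipschitz functions with compact support in $\Omega$. $u\in W_f^{1,2}(\Omega)$ is a weak solution to $\mathcal{L}u=\phi$ if $-\int_\Omega(\nabla w)^{\mathrm{tr}}\mathcal{A}(x,y,u)\nabla u=\int_\Omega\phi w$ for all $w\in(W_f^{1,2})_0(\Omega)$. *)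

(* Defs.v *)
From HB Require Import structures.
From mathcomp Require Export all_boot all_order all_algebra.
From mathcomp Require Export all_classical all_reals all_analysis.

Set Implicit Arguments.
Unset Strict Implicit.
Unset Printing Implicit Defensive.

Export Order.TTheory GRing.Theory Num.Theory.
Export numFieldNormedType.Exports.

Local Open Scope classical_set_scope.
Local Open Scope ring_scope.

(* Only the restriction of [F] to ]0, r0[ is constrained (derivatives at points
   of this open interval do not see the other values), so [F : R -> R] encodes
   a function on ]0, r0[.  "Increasing" in the fourth condition is
   nondecreasing: this also admits the finite type geometries
   F = m ln(1/x), for which 1/(-x F'(x)) is constant. *)
Definition structured_conditions (R : realType) (r0 : R) (F : R -> R) : Prop :=
  let F1 := derive1 F in let F2 := derive1n 2 F in
  exists C eps : R, 1 <= C /\ 0 < eps /\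
  F x @[x --> 0^'+] --> +oo /\
  (forall x : R, 0 < x < r0 -> F1 x < 0 /\ 0 < F2 x) /\
  (forall r x : R, r / 2 < x -> x < 2 * r -> 2 * r < r0 ->
     C^-1 * `|F1 r| <= `|F1 x| <= C * `|F1 r|) /\
  (forall x y : R, 0 < x -> x <= y -> y < r0 ->
     (- (x * F1 x))^-1 <= (- (y * F1 y))^-1) /\
  (forall x : R, 0 < x < r0 -> (- (x * F1 x))^-1 <= eps^-1) /\
  (forall x : R, 0 < x < r0 ->
     (C * x)^-1 <= F2 x / - F1 x <= C / x).

Definition twice_continuously_differentiable (R : realType) (r0 : R)
    (F : R -> R) : Prop :=
  forall x : R, 0 < x < r0 ->
    [/\ derivable F x 1, derivable (derive1 F) x 1 &
        {for x, continuous (derive1n 2 F)}].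

Definition structured_geometry (R : realType) (f : R -> R) : Prop :=
  [/\ forall t, f (- t) = f t,
      continuous f,
      f 0 = 0,
      forall t, t != 0 -> 0 < f t &
      exists (r0 : R) (F : R -> R),
        [/\ 0 < r0,
            forall x : R, 0 < x < r0 -> f x = expR (- F x),
            twice_continuously_differentiable r0 F &
            structured_conditions r0 F]].

(* [R] with the Borel sigma-algebra carried by [lebesgue_measure]; the points
   of [plane R] are those of [R * R]. *)
Definition plane (R : realType) := (measurableTypeR R * measurableTypeR R)%type.

(* Lebesgue measure on the Borel sets of the plane. *)
Definition leb2 (R : realType) : {measure set (plane R) -> \bar R} :=
  (@lebesgue_measure R \x @lebesgue_measure R)%E.
Arguments leb2 R : clear implicits.

Definition leb3 (R : realType) :
    {measure set (plane R * measurableTypeR R) -> \bar R} :=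
  (leb2 R \x @lebesgue_measure R)%E.
Arguments leb3 R : clear implicits.

(* Lebesgue measurability on D (measurability for the completion of [mu]):
   agreement almost everywhere with a Borel function. *)
Definition completed_measurable_fun d (T : measurableType d) (R : realType)
    (mu : {measure set T -> \bar R}) (D : set T) (h : T -> R) : Prop :=
  exists2 g : T -> R, measurable_fun D g & ae_eq mu D h g.

(* v is in L^p(D).  Elements of L^p are classes modulo null sets; [Lfun]
   consists of their Borel representatives, and every class has one. *)
Definition in_Lp (R : realType) (D : set (R * R)) (p : \bar R)
    (v : R * R -> R) : Prop :=
  v \_ D \in Lfun (leb2 R) p.

Definition bounded_domain (R : realType) (Omega : set (R * R)) : Prop :=
  [/\ open Omega, connected Omega, Omega !=set0 & bounded_set Omega].

Definition compactly_supported_in (R : realType) (Omega : set (R * R))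
    (h : R * R -> R) : Prop :=
  compact (closure [set p | h p != 0]) /\
  closure [set p | h p != 0] `<=` Omega.

Definition dx (R : realType) (h : R * R -> R) (p : R * R) : R := 'D_(1, 0) h p.
Definition dy (R : realType) (h : R * R -> R) (p : R * R) : R := 'D_(0, 1) h p.

Fixpoint Ck (R : realType) (k : nat) (h : R * R -> R) : Prop :=
  continuous h /\
  if k is k'.+1 then
    [/\ forall p, derivable h p (1, 0), forall p, derivable h p (0, 1),
        Ck k' (dx h) & Ck k' (dy h)]
  else True.

Definition test_function (R : realType) (Omega : set (R * R))
    (h : R * R -> R) : Prop :=
  (forall k, Ck k h) /\ compactly_supported_in Omega h.

(* v is in W_f^{1,2}(Omega) and its weak gradient nabla_f v = (v_x, f v_y) is
   (gx, gy).  As f does not depend on y, the weak form of gy = f(x) v_y moves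
   the y-derivative to the test function without differentiating f. *)
Definition Wf12 (R : realType) (f : R -> R) (Omega : set (R * R))
    (v gx gy : R * R -> R) : Prop :=
  [/\ in_Lp Omega 2%:E v, in_Lp Omega 2%:E gx, in_Lp Omega 2%:E gy &
      forall h, test_function Omega h ->
        (\int[leb2 R]_(p in Omega) (v p * dx h p) =
          - (\int[leb2 R]_(p in Omega) (gx p * h p))) /\
        (\int[leb2 R]_(p in Omega) (v p * (f p.1 * dy h p)) =
          - (\int[leb2 R]_(p in Omega) (gy p * h p)))].

Definition Wf12_norm (R : realType) (Omega : set (R * R))
    (v gx gy : R * R -> R) : R :=
  Num.sqrt (\int[leb2 R]_(p in Omega) (v p ^+ 2 + (gx p ^+ 2 + gy p ^+ 2))).

(* w is in the closure (W_f^{1,2})_0(Omega), with nabla_f w = (gx, gy). *)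
Definition Wf12_0 (R : realType) (f : R -> R) (Omega : set (R * R))
    (w gx gy : R * R -> R) : Prop :=
  Wf12 f Omega w gx gy /\
  forall e : R, 0 < e -> exists h hx hy : R * R -> R,
    [/\ lipschitz h, compactly_supported_in Omega h, Wf12 f Omega h hx hy &
        Wf12_norm Omega (w \- h) (gx \- hx) (gy \- hy) < e].

Definition Dmx (R : realType) (f : R -> R) (x : R) : 'M[R]_2 :=
  \matrix_(i, j) (if i == j then (if i == 0 then 1 else f x ^+ 2) else 0).

Definition qform (R : realType) (M : 'M[R]_2) (xi : 'cV[R]_2) : R :=
  (xi^T *m M *m xi) 0 0.

Definition bounded_measurable_coefficients (R : realType)
    (Omega : set (R * R)) (A : R -> R -> R -> 'M[R]_2) : Prop :=
  [/\ forall x y z, Omega (x, y) -> (A x y z)^T = A x y z,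
      forall x y z xi, Omega (x, y) -> 0 <= qform (A x y z) xi,
      exists K : R, forall x y z i j, Omega (x, y) -> `|A x y z i j| <= K &
      forall i j, completed_measurable_fun (leb3 R) (Omega `*` setT)
        (fun q : R * R * R => A q.1.1 q.1.2 q.2 i j)].

Definition equiv_Dmx (R : realType) (f : R -> R) (Omega : set (R * R))
    (A : R -> R -> R -> 'M[R]_2) : Prop :=
  exists c C : R, [/\ 0 < c, c <= C &
    {ae leb2 R, forall p, Omega p -> forall z xi,
       c * qform (Dmx f p.1) xi <= qform (A p.1 p.2 z) xi
         <= C * qform (Dmx f p.1) xi}].

(* The gradient (v_x, v_y) recovered from nabla_f v = (gx, gy); it is defined
   off the null line x = 0, the only zero of f. *)
Definition grad_of (R : realType) (f : R -> R) (gx gy : R * R -> R)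
    (p : R * R) : 'cV[R]_2 :=
  \col_i (if i == 0 then gx p else gy p / f p.1).

(* The integrand on the left is integrable when A is equivalent to D_f, by
   Cauchy-Schwarz, so the real-valued integral is not a default value. *)
Definition weak_solution (R : realType) (f : R -> R) (Omega : set (R * R))
    (A : R -> R -> R -> 'M[R]_2) (phi u : R * R -> R) : Prop :=
  exists ux uy : R * R -> R, Wf12 f Omega u ux uy /\
  forall w wx wy : R * R -> R, Wf12_0 f Omega w wx wy ->
    - (\int[leb2 R]_(p in Omega)
         ((grad_of f wx wy p)^T *m A p.1 p.2 (u p) *m grad_of f ux uy p) 0 0) =
    \int[leb2 R]_(p in Omega) (phi p * w p).

Definition locally_bounded_in (R : realType) (Omega : set (R * R))
    (u : R * R -> R) : Prop :=
  forall Omega' : set (R * R), measurable (Omega' : set (plane R)) ->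
    compact (closure Omega') -> closure Omega' `<=` Omega ->
    in_Lp Omega' +oo%E u.

(* Main.v *)
Require Import Defs.
From mathcomp Require Import ring lra measurable_realfun ess_sup_inf.

(** The theorem is a maximum principle on small rectangles, and it rests on the
dimension being two: almost every line carries a one-dimensional Sobolev
bound, and four lines enclose a point.

Near a point of the domain, [u] is mollified into C^1 functions [v_n] with
[sum_n int (|v_n - u|^2 + |nabla_f (v_n - u)|^2) < oo] over a box
([smooth_approximation]).  The sum of these errors and of the energy density
of [u] is one integrable function [S], which dominates all the energy densities
and forces convergence at every point where it is finite
([approximating_sequence]).  By Fubini, [S] is integrable along almost every
horizontal and vertical line; on such a line, taken off [x = 0] if it is
vertical, all the [v_n] have a common bound in the one-dimensional space H^1,
hence a common supremum bound ([line_bound]).  Two horizontal and two vertical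
good lines enclose the point in a rectangle [Q], and [|v_n| <= M] on its
boundary for every [n].

Let [cut M] be a bounded smooth nondecreasing function that vanishes exactly
on [[-M, M]].  The function [cut M (v_n)] on [Q], extended by zero, is Lipschitz
with compact support, hence an admissible test function ([cutoff_Wf12_0]).
Testing the equation with it and letting [n] tend to infinity, with [S] as a
dominating function, yields
[int_Q (cut M)'(u) (nabla u)^T A nabla u = 0]; the integrand is nonnegative, so
by ellipticity [(cut M)'(u) u_x = 0] almost everywhere on [Q]
([energy_limit]).  On the other hand [cut M (v_n)] vanishes on the left edge of
[Q], so that integration along horizontal segments bounds the integral of
[|cut M (v_n)|] by that of [|(cut M)'(v_n) d_x v_n|], which tends to zero.  Thus
[cut M (u) = 0], that is [|u| <= M], almost everywhere on [Q]
([cut_vanish]).  Since [cut M] is odd, both signs are treated at once.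

Compactness of the closure of the subdomain turns these local bounds into a
global one. *)

Set Implicit Arguments.
Unset Strict Implicit.
Unset Printing Implicit Defensive.

Local Open Scope classical_set_scope.
Local Open Scope ring_scope.

(** * Partial derivatives as derivatives of one variable *)

(** Both difference quotients are the same function, so that the theory of
derivatives of one variable applies to the directional derivatives in the plane. *)
Lemma dirx_quotient (R : realType) (g : R * R -> R) (p : R * R) :
  (fun h : R => h^-1 *: ((g \o shift p) (h *: (1, 0)) - g p)) =
  (fun h : R => h^-1 *: (((fun x => g (x, p.2)) \o shift p.1) (h *: 1) - g (p.1, p.2))).
Proof.
apply/funext => h; case: p => x y /=.
congr (_ *: (g _ - _)).
by apply/pair_equal_spec; split => //=; rewrite scaler0 add0r.
Qed.

Lemma diry_quotient (R : realType) (g : R * R -> R) (p : R * R) :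
  (fun h : R => h^-1 *: ((g \o shift p) (h *: (0, 1)) - g p)) =
  (fun h : R => h^-1 *: (((fun y => g (p.1, y)) \o shift p.2) (h *: 1) - g (p.1, p.2))).
Proof.
apply/funext => h; case: p => x y /=.
congr (_ *: (g _ - _)).
by apply/pair_equal_spec; split => //=; rewrite scaler0 add0r.
Qed.

Lemma derivable_dirx (R : realType) (g : R * R -> R) (p : R * R) :
  derivable g p (1, 0) <-> derivable (fun x => g (x, p.2)) p.1 1.
Proof. by rewrite /derivable dirx_quotient. Qed.

Lemma derivable_diry (R : realType) (g : R * R -> R) (p : R * R) :
  derivable g p (0, 1) <-> derivable (fun y => g (p.1, y)) p.2 1.
Proof. by rewrite /derivable diry_quotient. Qed.

Lemma dxE (R : realType) (g : R * R -> R) (p : R * R) :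
  dx g p = derive1 (fun x => g (x, p.2)) p.1.
Proof. by rewrite derive1E /dx /derive dirx_quotient. Qed.

Lemma dyE (R : realType) (g : R * R -> R) (p : R * R) :
  dy g p = derive1 (fun y => g (p.1, y)) p.2.
Proof. by rewrite derive1E /dy /derive diry_quotient. Qed.

Lemma is_derive_mulr (R : realType) (f g : R -> R) (x df dg : R) :
  is_derive x 1 f df -> is_derive x 1 g dg ->
  is_derive x 1 (fun y => f y * g y) (f x * dg + df * g x).
Proof.
move=> hf hg; apply: (is_derive_eq (is_deriveM hf hg)).
by rewrite /GRing.scale /= (mulrC df).
Qed.

(** * Smooth functions of one variable *)

(** The one-variable counterpart of [Ck]: products of two such functions,
one in each variable, are test functions. *)
Fixpoint smooth (R : realType) (k : nat) (h : R -> R) : Prop :=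
  continuous h /\
  if k is k'.+1 then (forall x, derivable h x 1) /\ smooth k' (derive1 h) else True.

Lemma smooth_continuous (R : realType) k (h : R -> R) : smooth k h -> continuous h.
Proof. by case: k => [|k] []. Qed.

Lemma smoothS (R : realType) k (h : R -> R) : smooth k.+1 h -> smooth k h.
Proof.
elim: k h => [h [? _]//|k IH h [ch [dh sh]]].
by split=> //; split=> //; exact: IH.
Qed.

Lemma smoothI (R : realType) (k : nat) (h h' : R -> R) :
  (forall x : R, is_derive x 1 h (h' x)) -> smooth k h' -> smooth k.+1 h.
Proof.
move=> dh sh'; have dr x : derivable h x 1 by have [] := dh x.
split; first by move=> x; apply: differentiable_continuous; exact/derivable1_diffP.
split=> //; suff -> : (derive1 h) = h' by [].
by apply/funext => x; rewrite derive1E; apply: derive_val.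
Qed.

Lemma smoothD (R : realType) k (h g : R -> R) :
  smooth k h -> smooth k g -> smooth k (h \+ g).
Proof.
elim: k h g => [h g [ch _] [cg _]|k IH h g [ch [dh sh]] [cg [dg sg]]].
  by split=> // x; apply: continuousD; [exact: ch|exact: cg].
apply: (@smoothI _ _ _ ((derive1 h) \+ (derive1 g))); last exact: IH.
move=> x /=; rewrite !derive1E; apply: is_deriveD; exact/derivableP.
Qed.

Lemma smoothM (R : realType) k (h g : R -> R) :
  smooth k h -> smooth k g -> smooth k (h \* g).
Proof.
elim: k h g => [h g [ch _] [cg _]|k IH h g sh0 sg0].
  by split=> // x; apply: continuousM; [exact: ch|exact: cg].
have := sh0 => -[ch [dh sh]]; have := sg0 => -[cg [dg sg]].
apply: (@smoothI _ _ _ ((h \* (derive1 g)) \+ (g \* (derive1 h)))).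
  move=> x /=; rewrite !derive1E.
  by apply: is_deriveM; exact/derivableP.
by apply: smoothD; apply: IH => //; exact: smoothS.
Qed.

Lemma smooth_cst (R : realType) k (c : R) : smooth k (fun=> c).
Proof.
elim: k c => [|k IH] c; first by split=> // x; exact: cst_continuous.
by apply: (smoothI (h' := fun=> 0)).
Qed.

Lemma smooth_affine (R : realType) k (a b : R) (h : R -> R) :
  smooth k h -> smooth k (fun x => h (a * x + b)).
Proof.
elim: k h => [h [ch _]|k IH h [ch [dh sh]]].
  split=> // x; apply: (@continuous_comp _ _ _ (fun x => a * x + b) h); last exact: ch.
  by apply: continuousD; [apply: continuousM => //; exact: cst_continuous|exact: cst_continuous].
apply: (@smoothI _ _ _ ((fun=> a) \* (fun x => (derive1 h) (a * x + b)))).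
  move=> x /=.
  have da : is_derive x 1 (fun x => a * x + b) a.
    by apply: is_derive_eq; rewrite addr0 /GRing.scale /= mulr1.
  rewrite mulrC derive1E.
  apply: (@is_derive1_comp _ h (fun x => a * x + b) x); exact/derivableP.
by apply: smoothM; [exact: smooth_cst|exact: IH].
Qed.

(** The partial derivatives of a product of this form are again of this form,
which makes the induction on [k] close. *)
Lemma Ck_tensor (R : realType) k (a b : R -> R) :
  smooth k a -> smooth k b -> Ck k (fun q : R * R => a q.1 * b q.2).
Proof.
have c2 (a' b' : R -> R) : continuous a' -> continuous b' ->
    continuous (fun q : R * R => a' q.1 * b' q.2).
  move=> ca cb q; apply: continuousM.
    by apply: continuous_comp; [exact: cvg_fst|exact: ca].
  by apply: continuous_comp; [exact: cvg_snd|exact: cb].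
elim: k a b => [a b [ca _] [cb _]|k IH a b sa0 sb0].
  by split=> //; exact: c2.
have := sa0 => -[ca [da sa]]; have := sb0 => -[cb [db sb]].
split; first exact: c2.
have Ha (p : R * R) : is_derive p.1 1 (fun x => a x * b p.2) ((derive1 a) p.1 * b p.2).
  rewrite derive1E.
  apply: is_derive_eq; first by apply: is_deriveM; exact/derivableP.
  by rewrite scaler0 add0r /GRing.scale /= mulrC.
have Hb (p : R * R) : is_derive p.2 1 (fun y => a p.1 * b y) (a p.1 * (derive1 b) p.2).
  rewrite derive1E.
  apply: is_derive_eq; first by apply: is_deriveM; exact/derivableP.
  by rewrite scaler0 addr0.
split.
- by move=> p; apply/derivable_dirx => /=; case: (Ha p).
- by move=> p; apply/derivable_diry => /=; case: (Hb p).
- rewrite (_ : dx _ = fun q => (derive1 a) q.1 * b q.2); first by apply: IH => //; exact: smoothS.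
  by apply/funext => q; rewrite dxE /= derive1E; have := Ha q; move/(@derive_val _ _ _ _ _ _ _).
- rewrite (_ : dy _ = fun q => a q.1 * (derive1 b) q.2); first by apply: IH => //; exact: smoothS.
  by apply/funext => q; rewrite dyE /= derive1E; have := Hb q; move/(@derive_val _ _ _ _ _ _ _).
Qed.

(** The family [P(1/t) exp(-1/t)], extended by zero to [t <= 0], is closed under
differentiation; with [P = 1] it is the classical flat function. *)
Definition expinv (R : realType) (P : {poly R}) (t : R) : R :=
  if 0 < t then P.[t^-1] * expR (- t^-1) else 0.

Lemma expinvD (R : realType) (P Q : {poly R}) (t : R) :
  expinv (P + Q) t = expinv P t + expinv Q t.
Proof. by rewrite /expinv; case: ifP => _; rewrite ?addr0// hornerD mulrDl. Qed.

(** From the Taylor bound [exp(1/t) >= (1/t)^(k+1) / (k+1)!]. *)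
Lemma expinvX_le (R : realType) (k : nat) (t : R) : 0 < t ->
  expinv 'X^k t <= k.+1`!%:R * t.
Proof.
move=> t0; rewrite /expinv t0 hornerXn expRN ler_pdivrMr ?expR_gt0//.
have t1 : 0 <= t^-1 by rewrite invr_ge0 ltW.
have := expR_ge1Dxn k t1.
have : 0 < k.+1`!%:R * t :> R by rewrite mulr_gt0// ltr0n fact_gt0.
move=> kt /(ler_wpM2l (ltW kt)); apply: le_trans.
rewrite mulrDr mulr1 exprS.
have -> : k.+1`!%:R * t * (t^-1 * t^-1 ^+ k / k.+1`!%:R) = t^-1 ^+ k.
  have tn : t != 0 by rewrite gt_eqF.
  have fn : k.+1`!%:R != 0 :> R by rewrite pnatr_eq0 -lt0n fact_gt0.
  by field; rewrite ?tn ?fn.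
by rewrite lerDr ltW.
Qed.

Lemma expinv_le (R : realType) (P : {poly R}) :
  exists2 C, 0 <= C & forall t, `|expinv P t| <= C * `|t|.
Proof.
suff [C C0 HC] : exists2 C, 0 <= C & forall t, 0 < t -> `|expinv P t| <= C * t.
  exists C => // t; have [t0|t0] := ltP 0 t; first by rewrite (gtr0_norm t0) HC.
  by rewrite /expinv ltNge t0 /= normr0 mulr_ge0.
rewrite -[P]coefK poly_def.
elim/big_rec: _ => [|i Q _ [C C0 HC]].
  by exists 0 => // t t0; rewrite /expinv t0 horner0 mul0r normr0 mul0r.
(* The coefficients add up, each with the constant of [expinvX_le]. *)
exists (`|P`_i| * i.+1`!%:R + C) => [|t t0]; first by rewrite addr_ge0// mulr_ge0.
rewrite expinvD (le_trans (ler_normD _ _))// mulrDl lerD ?HC//.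
have -> : expinv (P`_i *: 'X^i) t = P`_i * expinv 'X^i t.
  by rewrite /expinv t0 hornerZ mulrA.
rewrite normrM -mulrA ler_wpM2l// ger0_norm ?expinvX_le//.
rewrite /expinv t0 hornerXn mulr_ge0 ?expR_ge0// exprn_ge0// invr_ge0 ltW//.
Qed.

(** At the origin the difference quotient of [expinv P] is [expinv (P * X)], which
tends to zero by [expinv_le]; elsewhere the formula is the chain rule. *)
Lemma is_derive_expinv (R : realType) (P : {poly R}) (t : R) :
  is_derive t 1 (expinv P) (expinv ('X^2 * (P - P^`()%R)) t).
Proof.
have [t0|t0|<-] := ltgtP 0 t.
- have H : is_derive t 1 (fun t => P.[t^-1] * expR (- t^-1))
    (expinv ('X^2 * (P - P^`()%R)) t).
    have tn0 : t != 0 by rewrite gt_eqF.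
    have dV : is_derive t 1 (fun t : R => t^-1) (- t ^- 2).
      rewrite -[X in is_derive _ _ _ X]mulr1.
      exact: (@is_deriveV R id t 1 1 tn0 (is_derive_id _ _)).
    have dP : is_derive t^-1 1 (horner P) (P^`()%R).[t^-1].
      apply: DeriveDef; first exact: derivable_horner.
      by rewrite derivE derive1E.
    have dPV : is_derive t 1 (fun t : R => P.[t^-1]) (- t ^- 2 * (P^`()%R).[t^-1]).
      by rewrite mulrC; exact: (is_derive1_comp dP dV).
    have dE : is_derive t 1 (fun t : R => expR (- t^-1)) (t ^- 2 * expR (- t^-1)).
      have dN : is_derive t 1 (fun t : R => - t^-1) (t ^- 2).
        by rewrite -[t ^- 2]opprK; exact: is_deriveN.
      by rewrite mulrC; exact: (is_derive1_comp (is_derive_expR _) dN).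
    rewrite /expinv t0 !hornerE.
    apply: (is_derive_eq (is_derive_mulr dPV dE)).
    by rewrite -exprVn; ring.
  apply: near_eq_is_derive H.
  near=> s; rewrite /expinv ifT//; near: s; exact: lt_nbhsr.
- rewrite {2}/expinv (lt_gtF t0).
  apply: (@near_eq_is_derive _ _ _ (fun=> 0)) => //.
  near=> s; rewrite /expinv ifF//; apply/negbTE; rewrite -leNgt ltW//.
  near: s; exact: lt_nbhsl.
- rewrite {2}/expinv ltxx.
  have [C C0 HC] := expinv_le (P * 'X).
  have H : h^-1 *: ((expinv P \o shift 0) (h *: 1) - expinv P 0) @[h --> 0^'] --> (0 : R).
    rewrite {2}/expinv ltxx.
    apply/cvgr0Pnorm_le => e e0.
    near=> h.
    have h0 : h != 0 by near: h; exact: nbhs_dnbhs_neq.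
    have -> : h^-1 *: ((expinv P \o shift 0) (h *: 1) - 0) = expinv (P * 'X) h.
      rewrite /= subr0 addr0 /expinv /GRing.scale /= mulr1.
      by case: ifP => _; rewrite ?mulr0// hornerMX; ring.
    rewrite (le_trans (HC h))// (@le_trans _ _ ((C + 1) * `|h|))//.
      by rewrite ler_wpM2r// lerDl.
    rewrite mulrC -ler_pdivlMr; last by rewrite ltr_wpDl.
    by near: h; apply: dnbhs0_le; rewrite divr_gt0// ltr_wpDl.
  by split; [apply/cvg_ex; exists 0|apply/cvg_lim].
Unshelve. all: by end_near. Qed.

Lemma smooth_expinv (R : realType) (k : nat) (P : {poly R}) : smooth k (expinv P).
Proof.
elim: k P => [|k IH] P; last exact: smoothI (is_derive_expinv P) (IH _).
split=> // x; apply: differentiable_continuous; apply/derivable1_diffP.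
by have [] := is_derive_expinv P x.
Qed.

(** * Integrability of real-valued functions *)

Lemma normr_le_sqr1 (R : realType) (t : R) : `|t| <= t ^+ 2 + 1.
Proof.
rewrite -[t ^+ 2]real_normK ?num_real//.
have := sqr_ge0 (`|t| - 1); have := normr_ge0 t; nra.
Qed.

Lemma le_integrable_EFin d (T : measurableType d) (R : realType)
    (mu : {measure set T -> \bar R}) (D : set T) (f g : T -> R) :
  measurable D -> measurable_fun D f -> (forall x, D x -> `|f x| <= g x) ->
  mu.-integrable D (EFin \o g) -> mu.-integrable D (EFin \o f).
Proof.
move=> mD mf fg; apply: le_integrable => //; first exact/measurable_EFinP.
by move=> x Dx /=; rewrite lee_fin (le_trans (fg x Dx))// ler_norm.
Qed.

Lemma ge0_integrable_EFin d (T : measurableType d) (R : realType)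
    (mu : {measure set T -> \bar R}) (D : set T) (f : T -> R) :
  measurable D -> measurable_fun D f -> (forall x, D x -> 0 <= f x) ->
  (\int[mu]_(x in D) (f x)%:E < +oo)%E -> mu.-integrable D (EFin \o f).
Proof.
move=> mD mf f0 fi; apply/integrableP; split; first exact/measurable_EFinP.
rewrite (_ : (\int[mu]_(x in D) `|_|)%E = (\int[mu]_(x in D) (f x)%:E)%E)//.
by apply: eq_integral => x /set_mem Dx /=; rewrite ger0_norm// f0.
Qed.

Lemma integrable_EFin_lty d (T : measurableType d) (R : realType)
    (mu : {measure set T -> \bar R}) (D : set T) (f : T -> R) :
  measurable D ->
  mu.-integrable D (EFin \o f) -> (\int[mu]_(x in D) (f x)%:E < +oo)%E.
Proof.
move=> mD /(integrable_fin_num mD) H; by rewrite ltey_eq H.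
Qed.

Lemma EFin_Rintegral d (T : measurableType d) (R : realType)
    (mu : {measure set T -> \bar R}) (D : set T) (f : T -> R) :
  measurable D -> mu.-integrable D (EFin \o f) ->
  (\int[mu]_(x in D) f x)%:E = (\int[mu]_(x in D) (f x)%:E)%E.
Proof. by move=> mD If; rewrite fineK//; exact: integrable_fin_num. Qed.

Lemma integrableZ_EFin d (T : measurableType d) (R : realType)
    (mu : {measure set T -> \bar R}) (D : set T) (c : R) (f : T -> R) :
  measurable D -> mu.-integrable D (EFin \o f) ->
  mu.-integrable D (EFin \o (fun x => c * f x)).
Proof. by move=> mD If; exact: (integrableZl mD c If). Qed.

Lemma integrableD_EFin d (T : measurableType d) (R : realType)
    (mu : {measure set T -> \bar R}) (D : set T) (f g : T -> R) :
  measurable D -> mu.-integrable D (EFin \o f) -> mu.-integrable D (EFin \o g) ->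
  mu.-integrable D (EFin \o (fun x => f x + g x)).
Proof. by move=> mD If Ig; exact: (integrableD mD If Ig). Qed.

Lemma integrableB_EFin d (T : measurableType d) (R : realType)
    (mu : {measure set T -> \bar R}) (D : set T) (f g : T -> R) :
  measurable D -> mu.-integrable D (EFin \o f) -> mu.-integrable D (EFin \o g) ->
  mu.-integrable D (EFin \o (fun x => f x - g x)).
Proof. by move=> mD If Ig; exact: (integrableB mD If Ig). Qed.

(** Tonelli for the positive and the negative part; this covers sections on which [F] is
not integrable. *)
Lemma measurable_Rintegral_r d1 d2 (T1 : measurableType d1) (T2 : measurableType d2)
    (R : realType) (m2 : {sigma_finite_measure set T2 -> \bar R}) (F : T1 * T2 -> R) :
  measurable_fun setT F ->
  measurable_fun setT (fun x => \int[m2]_y F (x, y)).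
Proof.
move=> mF.
apply: (measurableT_comp (@fine_measurable R setT measurableT)).
rewrite (_ : (fun x => _) = fun x =>
  (fubini_F m2 (EFin \o F)^\+%E x - fubini_F m2 (EFin \o F)^\-%E x)%E).
  apply: emeasurable_funB.
    by apply: measurable_fun_fubini_tonelli_F => //; apply: measurable_funepos; exact/measurable_EFinP.
  by apply: measurable_fun_fubini_tonelli_F => //; apply: measurable_funeneg; exact/measurable_EFinP.
apply/funext => x; rewrite [LHS]integralE /fubini_F.
by congr (_ - _)%E; apply: eq_integral => y _; rewrite !(funeposE, funenegE).
Qed.

(** * Convolution with a mollifier on the line *)

Section reflection.
Context {R : realType}.
Notation mu := (@lebesgue_measure R).

Lemma measurable_subl (x : R) : measurable_fun [set: measurableTypeR R] (fun s => x - s).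
Proof. exact: measurable_funB. Qed.

Lemma lebesgue_measure_subl (x : R) (A : set (measurableTypeR R)) : measurable A ->
  pushforward mu (fun s => x - s : measurableTypeR R) A = mu A.
Proof.
move=> mA; apply/esym/lebesgue_measure_unique => //=.
  exact: measurable_subl.
move=> _ _ [[a b]] _ <-.
rewrite /pushforward.
rewrite (_ : _ @^-1` _ = `[x - b, x - a[%classic); last first.
  by apply/seteqP; split => s /=; rewrite !in_itv/= => /andP[? ?]; apply/andP; split; lra.
rewrite !lebesgue_measure_itv/= !lte_fin ltrD2l ltrN2; case: ifP => // _.
by rewrite -!EFinB; congr (_%:E); ring.
Qed.

(** Lebesgue measure is invariant under [s |-> x - s]. *)
Lemma ge0_integral_subl (x : R) (k : R -> R) :
  measurable_fun [set: R] k -> (forall s, 0 <= k s) ->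
  (\int[mu]_s (k (x - s))%:E = \int[mu]_s (k s)%:E)%E.
Proof.
move=> mk k0.
have := @ge0_integral_pushforward _ _ (measurableTypeR R) (measurableTypeR R) R _ (measurable_subl x)
  mu setT (fun s => (k s)%:E) measurableT.
rewrite preimage_setT => <-; last 2 first.
- by apply/measurable_EFinP.
- by move=> s _; rewrite lee_fin.
apply: eq_measure_integral => [|? A mA _]; first exact: measurable_subl.
exact: lebesgue_measure_subl.
Qed.
End reflection.

Section convolution.
Context {R : realType}.
Notation mu := (@lebesgue_measure R).
Implicit Types (k h : R -> R).

Definition mollifier (k : R -> R) : Prop :=
  [/\ measurable_fun [set: R] k, forall s, 0 <= k s, forall s, k (- s) = k s,
      exists B : R, forall s, k s <= B &
      (\int[mu]_s (k s)%:E = 1)%E].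

Definition conv k h (x : R) : R := \int[mu]_s (h s * k (x - s)).

Lemma measurable_conv_integrand k h :
  measurable_fun [set: R] k -> measurable_fun [set: R] h ->
  measurable_fun [set: plane R] (fun p => h p.2 * k (p.1 - p.2)).
Proof.
move=> mk mh; apply: measurable_funM.
  by apply: (measurableT_comp mh); exact: measurable_snd.
by apply: (measurableT_comp mk); apply: measurable_funB; [exact: measurable_fst|exact: measurable_snd].
Qed.

Lemma measurable_conv k h :
  measurable_fun [set: R] k -> measurable_fun [set: R] h ->
  measurable_fun [set: R] (conv k h).
Proof.
move=> mk mh.
exact: (@measurable_Rintegral_r _ _ (measurableTypeR R) (measurableTypeR R) R mu _ (measurable_conv_integrand mk mh)).
Qed.

Lemma mollifier_integrable k (x : R) : mollifier k ->
  mu.-integrable setT (EFin \o (fun s => k (x - s))).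
Proof.
move=> [mk k0 _ _ ik]; apply: ge0_integrable_EFin => //.
  by apply: (measurableT_comp mk); exact: measurable_subl.
by rewrite ge0_integral_subl// ik ltry.
Qed.

Lemma mollifier_integral k (x : R) : mollifier k -> \int[mu]_s k (x - s) = 1.
Proof. by move=> [mk k0 _ _ ik]; rewrite /Rintegral ge0_integral_subl// ik. Qed.

Section weighted.
Variables (k h : R -> R) (x : R).
Hypothesis Mk : mollifier k.
Hypothesis mh : measurable_fun [set: R] h.
Hypothesis ih : (\int[mu]_s (h s ^+ 2)%:E < +oo)%E.

Lemma sq_mollifier_integrable :
  mu.-integrable setT (EFin \o (fun s => h s ^+ 2 * k (x - s))).
Proof.
have [mk k0 _ [B kB] _] := Mk.
have mkx : measurable_fun [set: measurableTypeR R] (fun s => k (x - s)).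
  by apply: (measurableT_comp mk); exact: measurable_subl.
apply: (@le_integrable_EFin _ (measurableTypeR R) R mu setT _ (fun s => B * h s ^+ 2)) => //.
- by apply: measurable_funM => //; exact: measurable_funX.
- move=> s _; rewrite ger0_norm; last by rewrite mulr_ge0// sqr_ge0.
  by rewrite mulrC ler_wpM2r// sqr_ge0.
- apply: (@integrableZ_EFin _ (measurableTypeR R)) => //.
  apply: ge0_integrable_EFin => //; first exact: measurable_funX.
  by move=> s _; exact: sqr_ge0.
Qed.

Lemma mul_mollifier_integrable :
  mu.-integrable setT (EFin \o (fun s => h s * k (x - s))).
Proof.
have [mk k0 _ [B kB] _] := Mk.
have mkx : measurable_fun [set: measurableTypeR R] (fun s => k (x - s)).
  by apply: (measurableT_comp mk); exact: measurable_subl.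
apply: (@le_integrable_EFin _ (measurableTypeR R) R mu setT _ (fun s => h s ^+ 2 * k (x - s) + k (x - s))) => //.
- exact: measurable_funM.
- move=> s _; rewrite normrM (ger0_norm (k0 _)).
  rewrite (_ : h s ^+ 2 * k (x - s) + k (x - s) = (h s ^+ 2 + 1) * k (x - s)); last first.
    by rewrite mulrDl mul1r.
  by rewrite ler_wpM2r// normr_le_sqr1.
- apply: (@integrableD_EFin _ (measurableTypeR R)) => //.
    exact: sq_mollifier_integrable.
  exact: mollifier_integrable.
Qed.

(** Expand [0 <= int (h s - m)^2 k(x - s) ds] with [m = conv k h x] the mean of [h]
for the probability density [k(x - s)]. *)
Lemma conv_jensen :
  conv k h x ^+ 2 <= \int[mu]_s (h s ^+ 2 * k (x - s)).
Proof.
have [mk k0 _ [B kB] _] := Mk.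
set m := conv k h x.
have I1 := sq_mollifier_integrable.
have I2 := mul_mollifier_integrable.
have I3 := mollifier_integrable x Mk.
have I2' : mu.-integrable setT (EFin \o (fun s => (2 * m) * (h s * k (x - s)))).
  exact: (@integrableZ_EFin _ (measurableTypeR R)).
have I3' : mu.-integrable setT (EFin \o (fun s => m ^+ 2 * k (x - s))).
  exact: (@integrableZ_EFin _ (measurableTypeR R)).
have I12 : mu.-integrable setT (EFin \o (fun s => h s ^+ 2 * k (x - s) - (2 * m) * (h s * k (x - s)))).
  exact: (@integrableB_EFin _ (measurableTypeR R)).
have : 0 <= \int[mu]_s (h s ^+ 2 * k (x - s) - (2 * m) * (h s * k (x - s)) + m ^+ 2 * k (x - s)).
  apply: Rintegral_ge0 => s _.
  have -> : h s ^+ 2 * k (x - s) - (2 * m) * (h s * k (x - s)) + m ^+ 2 * k (x - s) =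
    (h s - m) ^+ 2 * k (x - s) by ring.
  by rewrite mulr_ge0// sqr_ge0.
rewrite RintegralD// RintegralB// !RintegralZl// mollifier_integral//.
rewrite -/(conv k h x) -/m => H; rewrite -subr_ge0; apply: le_trans H _.
by rewrite le_eqVlt; apply/orP; left; apply/eqP; ring.
Qed.

End weighted.

(** Integrate [conv_jensen] in [x] and exchange the integrals: every translate of
[k] has integral one. *)
Lemma conv_young k h : mollifier k -> measurable_fun [set: R] h ->
  (\int[mu]_x (conv k h x ^+ 2)%:E <= \int[mu]_s (h s ^+ 2)%:E)%E.
Proof.
move=> Mk mh; have [mk k0 sk _ ik] := Mk.
have [ih|] := ltP (\int[mu]_s (h s ^+ 2)%:E)%E +oo%E; last first.
  by rewrite leye_eq => /eqP ->; rewrite leey.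
have mF : measurable_fun [set: plane R] (fun p => (h p.2 ^+ 2 * k (p.1 - p.2))%:E).
  apply/measurable_EFinP.
  exact: (measurable_conv_integrand mk (measurable_funX 2%N mh)).
have F0 (p : plane R) : (0 <= (h p.2 ^+ 2 * k (p.1 - p.2))%:E)%E.
  by rewrite lee_fin mulr_ge0// sqr_ge0.
apply: (@le_trans _ _ (\int[mu]_x \int[mu]_s (h s ^+ 2 * k (x - s))%:E)%E).
  apply: ge0_le_integral => //.
  - by move=> x _; rewrite lee_fin sqr_ge0.
  - by apply/measurable_EFinP/measurable_funX; exact: measurable_conv.
  - exact: (@measurable_fun_fubini_tonelli_F _ _ _ _ _ mu _ mF F0).
  - move=> x _; rewrite -EFin_Rintegral//; last exact: sq_mollifier_integrable.
    by rewrite lee_fin conv_jensen.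
have -> := @fubini_tonelli _ _ _ _ _ mu mu _ mF F0.
rewrite le_eqVlt; apply/orP; left; apply/eqP; apply: eq_integral => s _ /=.
under eq_integral do rewrite EFinM.
rewrite ge0_integralZl//=.
- under eq_integral do rewrite -sk opprB.
  by rewrite ge0_integral_subl// ik mule1.
- apply/measurable_EFinP; apply: (measurableT_comp mk).
  by apply: measurable_funB.
- by move=> x _; rewrite lee_fin.
- by rewrite lee_fin sqr_ge0.
Qed.

End convolution.

(** * Convergence of mollifications in L^2 *)

Lemma ae_sub d (T : measurableType d) (R : realType)
    (mu : {measure set T -> \bar R}) (P Q : T -> Prop) :
  (forall x, P x -> Q x) -> {ae mu, forall x, P x} -> {ae mu, forall x, Q x}.
Proof. by move=> PQ; apply: filterS. Qed.

Lemma le_limn_einf (R : realType) (u v : (\bar R)^nat) :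
  (forall n, (u n <= v n)%E) -> (limn_einf u <= limn_einf v)%E.
Proof.
move=> uv; rewrite !limn_einf_lim; apply: lee_lim; [exact: is_cvg_einfs..|].
apply: nearW => n; apply: le_ereal_inf_tmp => _ [k /= nk <-].
by apply: le_trans (uv k); apply: ereal_inf_lbound; exists k.
Qed.

Lemma sq_integralZ d (T : measurableType d) (R : realType)
    (mu : {measure set T -> \bar R}) (c : R) (f : T -> R) :
  0 <= c -> measurable_fun setT f ->
  (\int[mu]_x (c%:E * (f x ^+ 2)%:E) = c%:E * \int[mu]_x (f x ^+ 2)%:E)%E.
Proof.
move=> c0 mf; apply: ge0_integralZl => //; first by apply/measurable_EFinP; exact: measurable_funX.
by move=> x _; rewrite lee_fin sqr_ge0.
Qed.

(** By the parallelogram identity the integrals of [(g_n - g)^2] and [(g_n + g)^2]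
add up to at most four times that of [g^2], while Fatou bounds the limit inferior
of the second from below by the same number.  No dominating function is
available here: the norm bound replaces it. *)
Lemma L2_cvg_of_ae d (T : measurableType d) (R : realType)
    (mu : {measure set T -> \bar R}) (g_ : nat -> T -> R) (g : T -> R) :
  (forall n, measurable_fun setT (g_ n)) -> measurable_fun setT g ->
  (\int[mu]_x (g x ^+ 2)%:E < +oo)%E ->
  (forall n, (\int[mu]_x (g_ n x ^+ 2)%:E <= \int[mu]_x (g x ^+ 2)%:E)%E) ->
  {ae mu, forall x, g_ n x @[n --> \oo] --> g x} ->
  (\int[mu]_x ((g_ n x - g x) ^+ 2)%:E)%E @[n --> \oo] --> 0%E.
Proof.
move=> mg_ mg ig ig_ [Z [mZ Z0 subZ]].
set N := (\int[mu]_x (g x ^+ 2)%:E)%E in ig ig_.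
have N0 : (0 <= N)%E by apply: integral_ge0 => x _; rewrite lee_fin sqr_ge0.
have Nfin : N \is a fin_num by rewrite ge0_fin_numE.
have I2 : mu.-integrable setT (EFin \o (fun x => g x ^+ 2)).
  by apply: ge0_integrable_EFin => //; [exact: measurable_funX|move=> x _; exact: sqr_ge0].
have I2n n : mu.-integrable setT (EFin \o (fun x => g_ n x ^+ 2)).
  apply: ge0_integrable_EFin => //; [exact: measurable_funX|move=> x _; exact: sqr_ge0|].
  exact: le_lt_trans (ig_ n) ig.
have mB n : measurable_fun setT (fun x => (g_ n x - g x) ^+ 2).
  by apply: measurable_funX; exact: measurable_funB.
have mD n : measurable_fun setT (fun x => (g_ n x + g x) ^+ 2).
  by apply: measurable_funX; exact: measurable_funD.
pose a n := (\int[mu]_x ((g_ n x - g x) ^+ 2)%:E)%E.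
pose b n := (\int[mu]_x ((g_ n x + g x) ^+ 2)%:E)%E.
have a0 n : (0 <= a n)%E by apply: integral_ge0 => x _; rewrite lee_fin sqr_ge0.
have b0 n : (0 <= b n)%E by apply: integral_ge0 => x _; rewrite lee_fin sqr_ge0.
have ab n : (a n + b n <= 4%:E * N)%E.
  rewrite /a /b -ge0_integralD//; last 4 first.
  - by move=> x _; rewrite lee_fin sqr_ge0.
  - exact/measurable_EFinP.
  - by move=> x _; rewrite lee_fin sqr_ge0.
  - exact/measurable_EFinP.
  rewrite (_ : (fun x => _) = (fun x => 2%:E * (g_ n x ^+ 2)%:E + 2%:E * (g x ^+ 2)%:E)%E); last first.
    by apply/funext => x; rewrite -!EFinM -!EFinD; congr (_%:E); ring.
  rewrite ge0_integralD//; last 4 first.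
  - by move=> x _; rewrite -EFinM lee_fin mulr_ge0// sqr_ge0.
  - by apply/measurable_EFinP; apply: measurable_funM => //; exact: measurable_funX.
  - by move=> x _; rewrite -EFinM lee_fin mulr_ge0// sqr_ge0.
  - by apply/measurable_EFinP; apply: measurable_funM => //; exact: measurable_funX.
  rewrite !sq_integralZ// -/N.
  have -> : (4%:E * N = 2%:E * N + 2%:E * N)%E.
    by rewrite -(fineK Nfin) -!EFinM -EFinD; congr (_%:E); ring.
  by rewrite leeD2r// lee_pmul2l.
have afin n : a n \is a fin_num.
  rewrite ge0_fin_numE//; apply: (@le_lt_trans _ _ (4%:E * N)%E).
    by apply: le_trans (ab n); rewrite leeDl.
  by rewrite -(fineK Nfin) -EFinM ltry.
have Fat : (4%:E * N <= limn_einf b)%E.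
  have -> : (4%:E * N = \int[mu]_(x in ~` Z) limn_einf (fun n => ((g_ n x + g x) ^+ 2)%:E))%E.
    rewrite /N (@ge0_negligible_integral _ _ _ mu setT Z)//; last 2 first.
      by apply/measurable_EFinP; exact: measurable_funX.
      by move=> x _; rewrite lee_fin sqr_ge0.
    rewrite setTD -ge0_integralZl//; last 3 first.
      exact: measurableC.
      by apply/measurable_EFinP; apply: measurable_funTS; exact: measurable_funX.
      by move=> x _; rewrite lee_fin sqr_ge0.
    apply: eq_integral => x; rewrite inE /= => Zx.
    have cx : g_ n x @[n --> \oo] --> g x.
      by apply: contrapT => nc; apply: Zx; apply: subZ.
    have : ((g_ n x + g x) ^+ 2)%:E @[n --> \oo] --> ((g x + g x) ^+ 2)%:E.
      apply: cvg_EFin; first exact: nearW.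
      have cD : g_ n x + g x @[n --> \oo] --> g x + g x by apply: cvgD => //; exact: cvg_cst.
      exact: (cvgM cD cD).
    move/cvg_limn_einf_sup => [-> _].
    by rewrite -EFinM; congr (_%:E); ring.
  apply: le_trans.
    apply: fatou => //.
    - exact: measurableC.
    - by move=> n; apply: measurable_funTS; exact/measurable_EFinP.
    - by move=> n x _; rewrite lee_fin sqr_ge0.
  apply: le_limn_einf => n.
  apply: ge0_subset_integral => //.
  - exact: measurableC.
  - exact/measurable_EFinP.
  - by move=> x _; rewrite lee_fin sqr_ge0.
(* Now [4 N <= liminf b <= 4 N - limsup a], so [limsup a <= 0]. *)
apply: limn_esup_le_cvg => //.
have M4 : (4%:E * N)%E \is a fin_num by rewrite fin_numM.
have : (limn_einf b <= limn_einf (fun n => 4%:E * N + (-%E \o a) n))%E.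
  apply: le_limn_einf => n /=.
  by rewrite leeBrDr// addeC; exact: ab.
rewrite limn_einf_shift// limn_einfN => H.
have {H Fat} := le_trans Fat H.
by rewrite -[X in (X <= _)%E]adde0 leeD2lE// leeNr oppe0.
Qed.

(** The bound [C / r] on a kernel supported in [[-r, r]] is what makes the
convolution error an average over the interval of radius [r], to which Lebesgue
differentiation applies. *)
Definition approx_identity (R : realType) (k : nat -> R -> R) : Prop :=
  exists (r : nat -> R) (C : R),
  [/\ forall n, mollifier (k n), forall n, 0 < r n, r n @[n --> \oo] --> 0,
      forall n s, r n <= `|s| -> k n s = 0 & forall n s, k n s <= C / r n].

Section approximation.
Context {R : realType}.
Notation mu := (@lebesgue_measure R).
Implicit Types (k h : R -> R).

Lemma sq_locally_integrable h : measurable_fun [set: R] h ->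
  (\int[mu]_s (h s ^+ 2)%:E < +oo)%E -> locally_integrable setT h.
Proof.
move=> mh ih; split => //; first exact: openT.
move=> K _ cK.
have mK : measurable (K : set (measurableTypeR R)) by exact: compact_measurable.
have mh2 : measurable_fun [set: R] (fun x => h x ^+ 2) by exact: measurable_funX.
apply: (@le_lt_trans _ _ (\int[mu]_(x in K) ((h x ^+ 2)%:E + 1))%E).
  apply: ge0_le_integral => //.
  - by apply/measurable_EFinP; apply: measurableT_comp => //; exact: measurable_funTS.
  - by apply: emeasurable_funD => //; apply/measurable_EFinP; exact: measurable_funTS.
  - by move=> x _; rewrite -EFinD lee_fin normr_le_sqr1.
rewrite ge0_integralD//.
- apply: lte_add_pinfty.
    apply: le_lt_trans ih; apply: ge0_subset_integral => //.
      exact/measurable_EFinP.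
    by move=> x _; rewrite lee_fin sqr_ge0.
  by rewrite integral_cst// mul1e; exact: compact_finite_measure.
- by move=> x _; rewrite lee_fin sqr_ge0.
- by apply/measurable_EFinP; exact: measurable_funTS.
Qed.

(** [|conv (k n) h x - h x|] is at most [2 * C] times the mean oscillation of [h]
over the ball of radius [r n], which vanishes in the limit at a Lebesgue point. *)
Lemma conv_lebesgue_pt (k : nat -> R -> R) h (x : R) : approx_identity k ->
  measurable_fun [set: R] h -> (\int[mu]_s (h s ^+ 2)%:E < +oo)%E ->
  lebesgue_pt h x -> conv (k n) h x @[n --> \oo] --> h x.
Proof.
move=> [r [C [Mk r0 rc k0 kC]]] mh ih hx.
have C0 : 0 <= C.
  have [_ kp _ _ _] := Mk 0%N.
  have := le_trans (kp 0) (kC 0%N 0).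
  by rewrite pmulr_lge0// invr_gt0.
have bound n : (`|conv (k n) h x - h x|%:E <= (2 * C)%:E * davg h x (r n))%E.
  have [mk kp _ _ _] := Mk n.
  have mkx : measurable_fun [set: measurableTypeR R] (fun s => k n (x - s)).
    by apply: (measurableT_comp mk); exact: measurable_subl.
  have I2 := mul_mollifier_integrable x (Mk n) mh ih.
  have I3 := mollifier_integrable x (Mk n).
  have I4 : mu.-integrable setT (EFin \o (fun s => h x * k n (x - s))).
    exact: (@integrableZ_EFin _ (measurableTypeR R)).
  have I5 : mu.-integrable setT (EFin \o (fun s => h s * k n (x - s) - h x * k n (x - s))).
    exact: (@integrableB_EFin _ (measurableTypeR R)).
  have I6 : mu.-integrable setT (EFin \o (fun s => `|h s * k n (x - s) - h x * k n (x - s)|)).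
    exact: (integrable_norm I5).
  have -> : conv (k n) h x - h x = \int[mu]_s (h s * k n (x - s) - h x * k n (x - s)).
    by rewrite RintegralB// RintegralZl// (mollifier_integral x (Mk n)) mulr1.
  apply: (@le_trans _ _ (\int[mu]_s `|h s * k n (x - s) - h x * k n (x - s)|%:E)%E).
    by rewrite -EFin_Rintegral// lee_fin; apply: le_normr_Rintegral.
  have mb : measurable (ball x (r n) : set (measurableTypeR R)) by exact: measurable_ball.
  have mhx : measurable_fun [set: R] (fun s => `|h s - h x|).
    by apply: measurableT_comp => //; exact: measurable_funB.
  rewrite /davg /iavg lebesgue_measure_ball; last exact: ltW.
  have rn : r n *+ 2 != 0 by rewrite mulrn_eq0 /= gt_eqF.
  rewrite inver (negbTE rn) muleA -EFinM.
  have mhxE : measurable_fun [set: measurableTypeR R] (fun s => `|((center (h x) \o h) s)%:E|%E).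
    exact/measurable_EFinP.
  rewrite -ge0_integralZl//; last 2 first.
  - exact: measurable_funTS.
  - by rewrite lee_fin divr_ge0// ?mulr_ge0// mulrn_wge0// ltW.
  rewrite [leRHS]integral_mkcond.
  apply: ge0_le_integral => //.
  - exact: (measurable_int mu I6).
  - apply/(measurable_restrictT _ mb); apply: measurable_funTS.
    exact: emeasurable_funM.
  - move=> s _; rewrite /patch; case: ifP => xs.
      rewrite /= -EFinM lee_fin -mulrBl normrM mulrC ler_wpM2r//.
      have -> : `|k n (x - s)| = k n (x - s) by exact: ger0_norm.
      have -> : 2 * C / (r n *+ 2) = C / r n.
        by rewrite -mulr_natl; field; rewrite gt_eqF.
      exact: kC.
    rewrite k0; first by rewrite !mulr0 subrr normr0; exact: lexx.
    by move: xs; rewrite leNgt; apply: contraFN => ?; rewrite inE.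
have C20 : ((2 * C)%:E * davg h x (r n))%E @[n --> \oo] --> 0%E.
  rewrite -[0%E](mule0 (2 * C)%:E); apply: cvgeZl => //.
  by move/cvge_at_rightP : hx; apply.
apply/subr_cvg0; apply: norm_cvg0.
suff H : (`|conv (k n) h x - h x|%:E @[n --> \oo] --> (0 : R)%:E) by exact: (fine_cvg H).
apply: (squeeze_cvge _ (cvg_cst 0%E) C20).
by apply: nearW => n; rewrite bound andbT lee_fin.
Qed.
Lemma conv_L2_cvg (k : nat -> R -> R) h : approx_identity k ->
  measurable_fun [set: R] h -> (\int[mu]_s (h s ^+ 2)%:E < +oo)%E ->
  (\int[mu]_x ((conv (k n) h x - h x) ^+ 2)%:E)%E @[n --> \oo] --> 0%E.
Proof.
move=> ak mh ih; have [r [C [Mk _ _ _ _]]] := ak.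
apply: (@L2_cvg_of_ae _ (measurableTypeR R)) => //.
- by move=> n; apply: measurable_conv => //; have [] := Mk n.
- by move=> n; exact: conv_young.
- apply: ae_sub (lebesgue_differentiation (sq_locally_integrable mh ih)) => x.
  exact: conv_lebesgue_pt.
Qed.

End approximation.

(** * Mollification of functions on the plane in one variable *)

Section plane_convolution.
Context {R : realType}.
Notation mu := (@lebesgue_measure R).
Implicit Types (k : R -> R) (g : plane R -> R).

Definition convx k g (p : plane R) : R := conv k (fun s => g (s, p.2)) p.1.
(** Exchanging the variables reduces statements on vertical convolution to
statements on horizontal convolution. *)
Definition swap g (p : plane R) : R := g (p.2, p.1).
Definition convy k g (p : plane R) : R := conv k (fun t => g (p.1, t)) p.2.

Lemma measurable_swap g : measurable_fun [set: plane R] g ->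
  measurable_fun [set: plane R] (swap g).
Proof.
move=> mg; apply: (measurableT_comp mg).
by apply: measurable_fun_pair; [exact: measurable_snd|exact: measurable_fst].
Qed.

Lemma measurable_section_x g (y : R) : measurable_fun [set: plane R] g ->
  measurable_fun [set: R] (fun x => g (x, y)).
Proof. by move=> mg; exact: (measurableT_comp mg (measurable_pair2 y)). Qed.

Lemma measurable_section_y g (x : R) : measurable_fun [set: plane R] g ->
  measurable_fun [set: R] (fun y => g (x, y)).
Proof. by move=> mg; exact: (measurableT_comp mg (measurable_pair1 x)). Qed.

Lemma measurable_convx k g : measurable_fun [set: R] k ->
  measurable_fun [set: plane R] g -> measurable_fun [set: plane R] (convx k g).
Proof.
move=> mk mg.
apply: (@measurable_Rintegral_r _ _ (plane R) (measurableTypeR R) R mu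
  (fun q => g (q.2, q.1.2) * k (q.1.1 - q.2))).
apply: measurable_funM.
  apply: (measurableT_comp mg); apply: measurable_fun_pair; first exact: measurable_snd.
  by apply: (measurableT_comp measurable_snd); exact: measurable_fst.
apply: (measurableT_comp mk); apply: measurable_funB; last exact: measurable_snd.
by apply: (measurableT_comp measurable_fst); exact: measurable_fst.
Qed.

Lemma convyE k g : convy k g = swap (convx k (swap g)).
Proof. by []. Qed.

Lemma measurable_convy k g : measurable_fun [set: R] k ->
  measurable_fun [set: plane R] g -> measurable_fun [set: plane R] (convy k g).
Proof.
move=> mk mg; rewrite convyE; apply: measurable_swap.
by apply: measurable_convx => //; exact: measurable_swap.
Qed.

Lemma ge0_integral_swap (F : plane R -> R) : measurable_fun [set: plane R] F ->
  (forall p, 0 <= F p) ->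
  (\int[leb2 R]_p (swap F p)%:E = \int[leb2 R]_p (F p)%:E)%E.
Proof.
move=> mF F0.
have mFE : measurable_fun [set: plane R] (EFin \o F) by exact/measurable_EFinP.
have mSE : measurable_fun [set: plane R] (EFin \o swap F).
  by apply/measurable_EFinP; exact: measurable_swap.
rewrite (@fubini_tonelli1 _ _ _ _ _ mu mu _ mSE); last by move=> p; rewrite lee_fin F0.
by rewrite (@fubini_tonelli2 _ _ _ _ _ mu mu _ mFE); last by move=> p; rewrite lee_fin F0.
Qed.

Lemma sq_tonelli2 g : measurable_fun [set: plane R] g ->
  (\int[leb2 R]_p (g p ^+ 2)%:E = \int[mu]_y \int[mu]_x (g (x, y) ^+ 2)%:E)%E.
Proof.
move=> mg; have mFE : measurable_fun [set: plane R] (fun p => (g p ^+ 2)%:E).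
  by apply/measurable_EFinP; exact: measurable_funX.
by rewrite (@fubini_tonelli2 _ _ _ _ _ mu mu _ mFE)// => p; rewrite lee_fin sqr_ge0.
Qed.

Lemma measurable_sq_section g : measurable_fun [set: plane R] g ->
  measurable_fun [set: R] (fun y => \int[mu]_x (g (x, y) ^+ 2)%:E)%E.
Proof.
move=> mg; have mFE : measurable_fun [set: plane R] (fun p => (g p ^+ 2)%:E).
  by apply/measurable_EFinP; exact: measurable_funX.
apply: (@measurable_fun_fubini_tonelli_G _ _ _ _ _ mu _ mFE).
by move=> p; rewrite lee_fin sqr_ge0.
Qed.

Lemma convx_L2_le k g : mollifier k -> measurable_fun [set: plane R] g ->
  (\int[leb2 R]_p (convx k g p ^+ 2)%:E <= \int[leb2 R]_p (g p ^+ 2)%:E)%E.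
Proof.
move=> Mk mg; have [mk _ _ _ _] := Mk.
have mc := measurable_convx mk mg.
rewrite !sq_tonelli2//; apply: ge0_le_integral => //.
- by move=> y _; apply: integral_ge0 => x _; rewrite lee_fin sqr_ge0.
- exact: measurable_sq_section.
- exact: measurable_sq_section.
- move=> y _; exact: (@conv_young R k (fun s => g (s, y)) Mk (measurable_section_x y mg)).
Qed.

(** On almost every horizontal line the one-variable result applies; the sections of
the error are dominated by four times the square norm of the section of [g]. *)
Lemma convx_L2_cvg (k : nat -> R -> R) g : approx_identity k ->
  measurable_fun [set: plane R] g -> (\int[leb2 R]_p (g p ^+ 2)%:E < +oo)%E ->
  (\int[leb2 R]_p ((convx (k n) g p - g p) ^+ 2)%:E)%E @[n --> \oo] --> 0%E.
Proof.
move=> ak mg ig; have [r [C [Mk _ _ _ _]]] := ak.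
have mc n : measurable_fun [set: plane R] (convx (k n) g).
  by apply: measurable_convx => //; have [] := Mk n.
have md n : measurable_fun [set: plane R] (fun p => convx (k n) g p - g p).
  exact: measurable_funB.
pose G y := (\int[mu]_x (g (x, y) ^+ 2)%:E)%E.
have mG : measurable_fun [set: R] G by exact: measurable_sq_section.
have G0 y : (0 <= G y)%E by apply: integral_ge0 => x _; rewrite lee_fin sqr_ge0.
have iG : mu.-integrable setT G.
  apply/integrableP; split => //.
  rewrite (_ : (\int[mu]_x `|G x|)%E = (\int[leb2 R]_p (g p ^+ 2)%:E)%E)//.
  by rewrite sq_tonelli2//; apply: eq_integral => y _; rewrite gee0_abs.
have := @dominated_convergence _ (measurableTypeR R) R mu setT measurableT
  (fun n y => \int[mu]_x ((convx (k n) g (x, y) - g (x, y)) ^+ 2)%:E)%E (fun=> 0%E)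
  (fun y => 4%:E * G y)%E.
case.
- by move=> n; exact: (measurable_sq_section (md n)).
- exact: measurable_cst.
- apply: ae_sub (integrable_ae measurableT iG) => y Gy _.
  apply: (@conv_L2_cvg R k (fun s => g (s, y)) ak (measurable_section_x y mg)).
  by rewrite -ge0_fin_numE; [exact: Gy|exact: G0].
- exact: integrableZl.
- apply: aeW => y n _; rewrite gee0_abs; last first.
    by apply: integral_ge0 => x _; rewrite lee_fin sqr_ge0.
  apply: (@le_trans _ _ (\int[mu]_x (2%:E * (convx (k n) g (x, y) ^+ 2)%:E + 2%:E * (g (x, y) ^+ 2)%:E))%E).
    apply: ge0_le_integral => //.
    + by move=> x _; rewrite lee_fin sqr_ge0.
    + by apply/measurable_EFinP; apply: measurable_funX; exact: measurable_section_x (md n).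
    + apply: emeasurable_funD; apply: emeasurable_funM => //; apply/measurable_EFinP;
        apply: measurable_funX; exact: measurable_section_x.
    + move=> x _; rewrite -!EFinM -EFinD lee_fin.
      have := sqr_ge0 (convx (k n) g (x, y) + g (x, y)).
      nra.
  rewrite ge0_integralD//; last 4 first.
  + by move=> x _; rewrite -EFinM lee_fin mulr_ge0// sqr_ge0.
  + apply: emeasurable_funM => //; apply/measurable_EFinP; apply: measurable_funX.
    exact: measurable_section_x (mc n).
  + by move=> x _; rewrite -EFinM lee_fin mulr_ge0// sqr_ge0.
  + apply: emeasurable_funM => //; apply/measurable_EFinP; apply: measurable_funX.
    exact: measurable_section_x.
  rewrite !sq_integralZ//; [|exact: measurable_section_x|exact: measurable_section_x (mc n)].
  have -> : (4%:E * G y = 2%:E * G y + 2%:E * G y)%E.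
    by rewrite -ge0_muleDl// -EFinD; congr (_%:E * _)%E; ring.
  rewrite leeD2r// lee_pmul2l//.
  exact: (@conv_young R (k n) (fun s => g (s, y)) (Mk n) (measurable_section_x y mg)).
- move=> _ _; rewrite integral0 => H.
  rewrite (_ : (fun n => _) = (fun n =>
    \int[mu]_y \int[mu]_x ((convx (k n) g (x, y) - g (x, y)) ^+ 2)%:E)%E); first exact: H.
  by apply/funext => n; rewrite (sq_tonelli2 (md n)).
Qed.

Lemma convy_L2_le k g : mollifier k -> measurable_fun [set: plane R] g ->
  (\int[leb2 R]_p (convy k g p ^+ 2)%:E <= \int[leb2 R]_p (g p ^+ 2)%:E)%E.
Proof.
move=> Mk mg; have [mk _ _ _ _] := Mk.
have ms := measurable_swap mg.
have mc := measurable_convx mk ms.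
have := convx_L2_le Mk ms.
rewrite -(@ge0_integral_swap (fun p => convx k (swap g) p ^+ 2)); last 2 first.
- exact: measurable_funX.
- by move=> p; exact: sqr_ge0.
rewrite -(@ge0_integral_swap (fun p => g p ^+ 2)) //.
- exact: measurable_funX.
- by move=> p; exact: sqr_ge0.
Qed.

Lemma convy_L2_cvg (k : nat -> R -> R) g : approx_identity k ->
  measurable_fun [set: plane R] g -> (\int[leb2 R]_p (g p ^+ 2)%:E < +oo)%E ->
  (\int[leb2 R]_p ((convy (k n) g p - g p) ^+ 2)%:E)%E @[n --> \oo] --> 0%E.
Proof.
move=> ak mg ig; have [r [C [Mk _ _ _ _]]] := ak.
have ms := measurable_swap mg.
have mg2 : measurable_fun [set: plane R] (fun p => g p ^+ 2) by exact: measurable_funX.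
have isw : (\int[leb2 R]_p (swap g p ^+ 2)%:E < +oo)%E.
  by have := ge0_integral_swap mg2 (fun p => sqr_ge0 _) => ->.
have H := convx_L2_cvg ak ms isw.
rewrite (_ : (fun n => _) = (fun n =>
  \int[leb2 R]_p ((convx (k n) (swap g) p - swap g p) ^+ 2)%:E)%E); first exact: H.
apply/funext => n.
rewrite -(@ge0_integral_swap (fun p => (convx (k n) (swap g) p - swap g p) ^+ 2)).
- by apply: eq_integral => -[x y] _.
- apply: measurable_funX; apply: measurable_funB => //.
  by apply: measurable_convx => //; have [] := Mk n.
- by move=> p; exact: sqr_ge0.
Qed.

End plane_convolution.

(** * A smooth kernel with compact support *)

Section kernel.
Context {R : realType}.
Notation mu := (@lebesgue_measure R).
Implicit Types (r s t : R).

Definition expi t : R := expinv 1 t.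

Lemma expi_ge0 t : 0 <= expi t.
Proof.
by rewrite /expi /expinv; case: ifP => // _; rewrite hornerC mul1r expR_ge0.
Qed.

Lemma expi_le1 t : expi t <= 1.
Proof.
rewrite /expi /expinv; case: ifP => // t0.
by rewrite hornerC mul1r -expR0 ler_expR oppr_le0 invr_ge0 ltW.
Qed.

Lemma expi_npos t : t <= 0 -> expi t = 0.
Proof. by rewrite /expi /expinv leNgt => /negbTE ->. Qed.

Lemma expi_half t : 2^-1 <= t -> expR (- 2) <= expi t.
Proof.
move=> t2; have t0 : 0 < t by apply: lt_le_trans t2; rewrite invr_gt0.
rewrite /expi /expinv t0 hornerC mul1r ler_expR lerN2 -[leRHS]invrK.
by rewrite lef_pV2// posrE invr_gt0.
Qed.

(** The factor [expi (1 + s / r)] vanishes for [s <= -r] and the other one for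
[s >= r]. *)
Definition bump r s : R := expi (1 + s / r) * expi (1 - s / r).

Lemma bump_ge0 r s : 0 <= bump r s.
Proof. by rewrite mulr_ge0// expi_ge0. Qed.

Lemma bump_le1 r s : bump r s <= 1.
Proof. by rewrite mulr_ile1 ?expi_ge0 ?expi_le1. Qed.

Lemma bumpN r s : bump r (- s) = bump r s.
Proof. by rewrite /bump mulNr opprK mulrC. Qed.

Lemma bump_out r s : 0 < r -> r <= `|s| -> bump r s = 0.
Proof.
move=> r0; rewrite ler_normr /bump => /orP[rs|rs].
  rewrite [X in _ * X]expi_npos ?mulr0// subr_le0 ler_pdivlMr// mul1r//.
have sr : s / r <= - 1 by rewrite ler_pdivrMr//; lra.
by rewrite (@expi_npos (1 + s / r)) ?mul0r//; lra.
Qed.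

Lemma smooth_bump r k : smooth k (bump r).
Proof.
apply: (@smoothM _ k (fun s => expi (1 + s / r)) (fun s => expi (1 - s / r))).
  have := @smooth_affine R k r^-1 1 _ (smooth_expinv k 1).
  by congr smooth; apply/funext => s; rewrite addrC mulrC.
have := @smooth_affine R k (- r^-1) 1 _ (smooth_expinv k 1).
by congr smooth; apply/funext => s; rewrite addrC mulNr mulrC.
Qed.

Lemma measurable_bump r : measurable_fun [set: R] (bump r).
Proof. by apply: continuous_measurable_fun; exact: (smooth_continuous (smooth_bump r 0)). Qed.

Definition bump_mass r : R := \int[mu]_s bump r s.

Lemma bump_integrable r : 0 < r -> mu.-integrable setT (EFin \o bump r).
Proof.
move=> r0; have mi : measurable (`[- r, r]%classic : set (measurableTypeR R)).
  exact: measurable_itv.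
apply: (@le_integrable_EFin _ (measurableTypeR R) R mu setT _ (\1_`[- r, r])) => //.
- exact: measurable_bump.
- move=> s _; rewrite ger0_norm ?bump_ge0// indicE.
  have [sr|sr] := boolP (s \in `[- r, r]%classic); first exact: bump_le1.
  rewrite bump_out// leNgt; apply: contra sr => sr.
  by rewrite inE/= in_itv/=; move: sr; rewrite ltr_norml => /andP[/ltW -> /ltW ->].
- apply: ge0_integrable_EFin => //.
  have -> : (\int[mu]_x (\1_(`[- r, r]%classic : set R) x)%:E = mu (`[(- r)%R, r]%classic : set R))%E.
    by rewrite (@integral_indic _ (measurableTypeR R) R mu setT)// setIT.
  rewrite lebesgue_measure_itv/=.
  by case: ifP => // _; rewrite -EFinB ltry.
Qed.

(** On the interval [[-r/2, r/2]] both factors are at least [exp(-2)].  This lower bound,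
linear in [r], gives the bound [C / r] on the normalized kernel. *)
Lemma bump_mass_ge r : 0 < r -> expR (- 2) ^+ 2 * r <= bump_mass r.
Proof.
move=> r0; pose I : set (measurableTypeR R) := `[- (r / 2), r / 2]%classic.
have mi : measurable I by exact: measurable_itv.
rewrite -lee_fin (EFin_Rintegral _ (bump_integrable r0))//.
apply: (@le_trans _ _ (\int[mu]_(s in I) (expR (- 2) ^+ 2)%:E)%E).
  have mI : mu I = r%:E.
    rewrite /I lebesgue_measure_itv/= lte_fin ifT; last by lra.
    by rewrite -EFinB; congr (_%:E); field.
  have -> : (\int[mu]_(s in I) (expR (- 2) ^+ 2)%:E = (expR (- 2) ^+ 2)%:E * mu I)%E.
    exact: integral_cst.
  by rewrite mI.
apply: (@le_trans _ _ (\int[mu]_(s in I) (bump r s)%:E)%E).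
  apply: ge0_le_integral => //.
  - by apply/measurable_EFinP; apply: measurable_funTS; exact: measurable_bump.
  - move=> s; rewrite /I/= in_itv/= => /andP[s1 s2]; rewrite lee_fin expr2.
    have r2 : r / 2 / r = 2^-1 by field; rewrite gt_eqF.
    have s3 : s / r <= 2^-1 by rewrite -r2 ler_pM2r// invr_gt0.
    have s4 : - 2^-1 <= s / r by rewrite -r2 -mulNr ler_pM2r// invr_gt0.
    by apply: ler_pM; rewrite ?expR_ge0//; apply: expi_half; lra.
apply: ge0_subset_integral => //.
- by apply/measurable_EFinP; exact: measurable_bump.
- by move=> s _; rewrite lee_fin bump_ge0.
Qed.

Lemma bump_mass_gt0 r : 0 < r -> 0 < bump_mass r.
Proof.
move=> r0; apply: lt_le_trans (bump_mass_ge r0).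
by rewrite mulr_gt0// exprn_gt0// expR_gt0.
Qed.

Definition kern r s : R := bump r s / bump_mass r.

Lemma smooth_kern r k : smooth k (kern r).
Proof.
exact: (@smoothM _ k (bump r) (fun=> (bump_mass r)^-1) (smooth_bump r k) (smooth_cst _ _)).
Qed.

Lemma kern_out r s : 0 < r -> r <= `|s| -> kern r s = 0.
Proof. by move=> r0 rs; rewrite /kern bump_out// mul0r. Qed.

Lemma kern_mollifier r : 0 < r -> mollifier (kern r).
Proof.
move=> r0; have m0 := bump_mass_gt0 r0; have mn0 : bump_mass r != 0 by rewrite gt_eqF.
split.
- by apply: continuous_measurable_fun; exact: (smooth_continuous (smooth_kern r 0)).
- by move=> s; rewrite divr_ge0 ?bump_ge0// ltW.
- by move=> s; rewrite /kern bumpN.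
- by exists (bump_mass r)^-1 => s; rewrite ler_pdivrMr// mulVf// bump_le1.
- rewrite -EFin_Rintegral//.
    rewrite (_ : \int[mu]_x kern r x = \int[mu]_x (bump r x * (bump_mass r)^-1))//.
    by rewrite RintegralZr ?bump_integrable// -/(bump_mass r) divff.
  have := @integrableZ_EFin _ (measurableTypeR R) R mu setT (bump_mass r)^-1 _ measurableT (bump_integrable r0).
  by congr integrable; apply/funext => s /=; rewrite mulrC.
Qed.

Definition kern_seq (n : nat) : R -> R := kern (n.+1%:R^-1).

Lemma kern_approx_identity : approx_identity kern_seq.
Proof.
exists (fun n => n.+1%:R^-1), (expR (- 2) ^- 2).
have r0 (n : nat) : 0 < n.+1%:R^-1 :> R by rewrite invr_gt0.
split => //.
- by move=> n; exact: kern_mollifier.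
- exact: cvg_harmonic.
- by move=> n s; exact: kern_out.
- move=> n s; rewrite /kern_seq /kern -invfM.
  apply: (@le_trans _ _ (bump_mass n.+1%:R^-1)^-1).
    by rewrite ler_piMl ?bump_le1// invr_ge0 ltW// bump_mass_gt0.
  rewrite lef_pV2 ?posrE ?bump_mass_gt0 ?mulr_gt0// ?exprn_gt0 ?expR_gt0//.
  exact: bump_mass_ge.
Qed.

End kernel.

(** * Mollification in both variables and its derivatives *)

Section tame.
Context {R : realType}.
Implicit Types (k : R -> R).

(** Bounded and Lipschitz with a common constant: what is used of a kernel to
convolve it with an integrable function and keep continuity. *)
Definition tame k : Prop := exists2 B : R, forall s, `|k s| <= B &
  forall s t, `|k s - k t| <= B * `|s - t|.

Lemma is_derive_continuous k k' : (forall x : R, is_derive x 1 k (k' x)) -> continuous k.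
Proof.
move=> dk x; apply: differentiable_continuous; apply/derivable1_diffP.
by have [] := dk x.
Qed.

Lemma lipschitz_of_derive k k' (B : R) : (forall x : R, is_derive x 1 k (k' x)) ->
  (forall x, `|k' x| <= B) -> forall s t, `|k s - k t| <= B * `|s - t|.
Proof.
move=> dk kB s t; wlog ts : s t / t <= s.
  move=> H; have [/H//|/ltW/H] := leP t s.
  by rewrite distrC (distrC s).
have [c _ ->] := @MVT_segment R k k' t s ts (fun x _ => dk x)
  (continuous_subspaceT (is_derive_continuous dk)).
by rewrite normrM ler_wpM2r.
Qed.

Lemma compact_support_bounded k (r : R) : continuous k -> 0 <= r ->
  (forall s, r <= `|s| -> k s = 0) -> exists B : R, forall s, `|k s| <= B.
Proof.
move=> ck r0 kr.
have rr : - r <= r by lra.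
have [c _ H] := @EVT_max R (fun s => `|k s|) (- r) r rr
  (continuous_subspaceT (fun x => continuous_comp (ck x) (@norm_continuous _ _ _))).
exists `|k c| => s; have [rs|rs] := leP r `|s|; first by rewrite (kr _ rs) normr0.
by apply: H; rewrite in_itv/=; move: rs; rewrite ltr_norml => /andP[/ltW -> /ltW ->].
Qed.

Lemma derive1_out k (r : R) : (forall s, r <= `|s| -> k s = 0) ->
  forall s, r < `|s| -> derive1 k s = 0.
Proof.
move=> kr s rs; rewrite derive1E.
rewrite (_ : 'D_1 k s = 'D_1 (fun=> 0 : R) s); first exact: derive_cst.
apply: near_eq_derive.
near=> t; rewrite kr// ltW//; near: t.
by apply: (@cvgr_gt _ _ _ _ (fun t => `|t|) `|s|) => //; exact: norm_continuous.
Unshelve. all: by end_near. Qed.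

Lemma smooth_is_derive n k : smooth n.+1 k -> forall x : R, is_derive x 1 k (derive1 k x).
Proof. by move=> [_ [dk _]] x; rewrite derive1E; exact/derivableP. Qed.

Lemma smooth_tame k (r : R) : smooth 1 k -> 0 <= r ->
  (forall s, r <= `|s| -> k s = 0) -> tame k.
Proof.
move=> sk r0 kr; have [ck [dk sk1]] := sk.
have [B1 kB1] := compact_support_bounded ck r0 kr.
have r1 : 0 <= r + 1 by lra.
have kr1 s : r + 1 <= `|s| -> derive1 k s = 0.
  by move=> rs; apply: (derive1_out kr); apply: lt_le_trans rs; lra.
have [B2 kB2] := compact_support_bounded sk1.1 r1 kr1.
exists (Num.max B1 B2) => [s|s t]; first by rewrite le_max kB1.
apply: lipschitz_of_derive (smooth_is_derive sk) _ _ _ => x.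
by rewrite le_max kB2 orbT.
Qed.

Lemma tame_continuous k : tame k -> continuous k.
Proof.
move=> [B kB kL] x; apply/cvgrPdist_le => e e0.
have B0 : 0 <= B by apply: le_trans (kB 0).
near=> t; rewrite (le_trans (kL _ _))//.
rewrite (@le_trans _ _ ((B + 1) * `|x - t|))// ?ler_wpM2r// ?lerDl//.
rewrite mulrC -ler_pdivlMr ?ltr_wpDl//.
by near: t; apply: cvgr_dist_le => //; rewrite divr_gt0// ltr_wpDl.
Unshelve. all: by end_near. Qed.

Lemma tame_measurable k : tame k -> measurable_fun [set: R] k.
Proof. by move=> /tame_continuous; exact: continuous_measurable_fun. Qed.

Lemma kern_tame (r : R) : 0 < r -> tame (kern r).
Proof.
by move=> r0; apply: (@smooth_tame _ r (smooth_kern r 1)); [exact: ltW|move=> s; exact: kern_out].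
Qed.

Lemma derive_kern_out (r : R) : 0 < r -> forall s, 2 * r <= `|s| -> derive1 (kern r) s = 0.
Proof.
move=> r0 s rs; apply: (derive1_out (fun s => @kern_out _ r s r0)).
by apply: lt_le_trans rs; lra.
Qed.

Lemma derive_kern_tame (r : R) : 0 < r -> tame (derive1 (kern r)).
Proof.
move=> r0; have [_ [_ sk]] := smooth_kern r 2.
by apply: (@smooth_tame _ (2 * r) sk); [lra|exact: derive_kern_out].
Qed.
End tame.

(** [B * |g|] dominates the derivatives for all values of the parameter. *)
Lemma is_derive_under_integral d (T : measurableType d) (R : realType)
    (mu : {measure set T -> \bar R}) (g : T -> R) (phi phi' : R -> T -> R) (B a : R) :
  mu.-integrable setT (EFin \o g) ->
  (forall t, measurable_fun setT (phi t)) ->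
  (forall t q, `|phi t q| <= B) -> (forall t q, `|phi' t q| <= B) ->
  (forall (t : R) q, is_derive t 1 (phi ^~ q) (phi' t q)) ->
  is_derive a 1 (fun t => \int[mu]_q (g q * phi t q)) (\int[mu]_q (g q * phi' a q)).
Proof.
move=> ig mphi bphi bphi' dphi.
have mg : measurable_fun setT g by apply/measurable_EFinP; exact: measurable_int ig.
have ign : mu.-integrable setT (EFin \o (fun q => B * `|g q|)).
  by apply: integrableZ_EFin => //; exact: integrable_norm ig.
have Ia : `]a - 1, a + 1[%classic a by rewrite /= in_itv/=; apply/andP; split; lra.
have If t : `]a - 1, a + 1[%classic t -> mu.-integrable setT (EFin \o (fun q => g q * phi t q)).
  move=> _; apply: (le_integrable_EFin (g := fun q => B * `|g q|)) => //.
    exact: measurable_funM.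
  by move=> q _; rewrite normrM mulrC ler_wpM2r.
have dg (t : R) q : is_derive t 1 (fun t => g q * phi t q) (g q * phi' t q).
  by apply: (is_derive_eq (is_deriveZ (g q) (dphi t q))).
have d1 t q : partial1of2 (fun t q => g q * phi t q) t q = g q * phi' t q.
  by rewrite partial1of2E; exact: (@derive_val _ _ _ _ _ _ _ (dg t q)).
have B0 q : 0 <= B * `|g q|.
  by rewrite mulr_ge0// (le_trans _ (bphi 0 q)).
have Hb t q : `]a - 1, a + 1[%classic t -> setT q ->
    `|partial1of2 (fun t q => g q * phi t q) t q| <= B * `|g q|.
  by move=> _ _; rewrite d1 normrM mulrC ler_wpM2r.
have Hd (t : R) q : `]a - 1, a + 1[%classic t -> setT q -> derivable (fun t => g q * phi t q) t 1.
  by move=> _ _; case: (dg t q).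
apply: DeriveDef.
  exact: (@derivable_under_integral R d T mu _ setT measurableT a (a - 1) (a + 1) Ia If Hd _ B0 ign Hb).
rewrite -derive1E.
rewrite (@differentiation_under_integral R d T mu _ setT measurableT a (a - 1) (a + 1) Ia If Hd _ B0 ign Hb).
by apply: eq_Rintegral => q _; exact: d1.
Qed.

(** The integral of a function that is not integrable is zero by convention, for
[f] and [c * f] alike; this avoids integrability conditions on sections. *)
Lemma RintegralZ_all d (T : measurableType d) (R : realType)
    (mu : {measure set T -> \bar R}) (c : R) (f : T -> R) :
  measurable_fun setT f -> \int[mu]_x (c * f x) = c * \int[mu]_x f x.
Proof.
move=> mf; have [->|c0] := eqVneq c 0.
  rewrite mul0r (_ : (fun x => 0 * f x) = fun=> 0); last by apply/funext => x; rewrite mul0r.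
  by rewrite /Rintegral integral0.
have nonint (h : T -> R) : measurable_fun setT h -> ~ mu.-integrable setT (EFin \o h) ->
    \int[mu]_x h x = 0.
  move=> mh ni; apply/eqP/negPn/negP => i0; apply: ni.
  have mhE : measurable_fun setT (EFin \o h) by exact/measurable_EFinP.
  have : (\int[mu]_x (EFin \o h) x)%E \is a fin_num.
    move: i0; rewrite /Rintegral -/(EFin \o h) /comp.
    by case: (integral _ _ _) => //=; rewrite eqxx.
  rewrite integralE fin_numB => /andP[fp fn].
  apply/integrableP; split => //.
  rewrite (_ : (fun x => `|(EFin \o h) x|)%E = (fun x => (EFin \o h)^\+ x + (EFin \o h)^\- x)%E); last first.
    by rewrite -fune_abse.
  rewrite ge0_integralD//; [|exact: measurable_funepos|exact: measurable_funeneg].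
  by apply: lte_add_pinfty; rewrite ltey_eq ?fp ?fn.
have [If|If] := pselect (mu.-integrable setT (EFin \o f)); first by rewrite RintegralZl.
rewrite (nonint f)// mulr0 nonint//; first exact: measurable_funM.
apply: contra_not If => If.
have := integrableZ_EFin c^-1 measurableT If.
by congr integrable; apply/funext => x /=; rewrite mulrA mulVf// mul1r.
Qed.

Section pconv.
Context {R : realType}.
Notation mu := (@lebesgue_measure R).
Implicit Types (k l : R -> R) (g : plane R -> R).

Definition pconv k l g (p : R * R) : R :=
  \int[leb2 R]_q (g q * (k (p.1 - q.1) * l (p.2 - q.2))).

Lemma measurable_ktensor k l (p : R * R) : tame k -> tame l ->
  measurable_fun [set: plane R] (fun q => k (p.1 - q.1) * l (p.2 - q.2)).
Proof.
move=> tk tl; apply: measurable_funM.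
  apply: (measurableT_comp (tame_measurable tk)).
  by apply: measurable_funB => //; exact: measurable_fst.
apply: (measurableT_comp (tame_measurable tl)).
by apply: measurable_funB => //; exact: measurable_snd.
Qed.

Lemma pconv_integrable k l g p : tame k -> tame l ->
  (leb2 R).-integrable setT (EFin \o g) ->
  (leb2 R).-integrable setT (EFin \o (fun q => g q * (k (p.1 - q.1) * l (p.2 - q.2)))).
Proof.
move=> tk tl Ig; have [B kB _] := tk; have [C lC _] := tl.
have mg : measurable_fun setT g by apply/measurable_EFinP; exact: measurable_int Ig.
apply: (@le_integrable_EFin _ (plane R) R (leb2 R) setT _ (fun q => (B * C) * `|g q|)) => //.
- by apply: measurable_funM => //; exact: measurable_ktensor.
- move=> q _; rewrite normrM mulrC ler_wpM2r// normrM.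
  by apply: ler_pM.
- by apply: integrableZ_EFin => //; exact: integrable_norm Ig.
Qed.

(** Fubini: mollifying in both variables is mollifying vertically, then
horizontally, which gives access to the one-variable convergence results. *)
Lemma pconvE k l g : tame k -> tame l ->
  (leb2 R).-integrable setT (EFin \o g) -> pconv k l g = convx k (convy l g).
Proof.
move=> tk tl Ig; apply/funext => -[x y].
have mg : measurable_fun setT g by apply/measurable_EFinP; exact: measurable_int Ig.
have mk := tame_measurable tk; have ml := tame_measurable tl.
have I := pconv_integrable (x, y) tk tl Ig.
rewrite /pconv /convx /convy /conv /=.
congr fine.
have <- := integral12_prod_meas1 I.
apply: (@ae_eq_integral _ (measurableTypeR R) R mu setT) => //.
- exact: (measurable_fubini_F I).
- apply/measurable_EFinP; apply: measurable_funM.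
    apply: (@measurable_Rintegral_r _ _ (measurableTypeR R) (measurableTypeR R) R mu
      (fun q => g q * l (y - q.2))).
    apply: measurable_funM => //; apply: (measurableT_comp ml).
    by apply: measurable_funB => //; exact: measurable_snd.
  by apply: (measurableT_comp mk); exact: measurable_subl.
- apply: ae_sub (ae_integrable1 I) => s Is _ /=.
  rewrite /fubini_F /=.
  rewrite -(@EFin_Rintegral _ (measurableTypeR R) R mu setT)//.
  congr (_%:E).
  rewrite mulrC -RintegralZ_all.
    by apply: eq_Rintegral => t _; rewrite mulrCA.
  apply: measurable_funM; first exact: measurable_section_y.
  by apply: (measurableT_comp ml); exact: measurable_subl.
Qed.

(** The difference of the values at two points is bounded by their distance times the
integral of [|g|], since the kernels are Lipschitz. *)
Lemma pconv_continuous k l g : tame k -> tame l ->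
  (leb2 R).-integrable setT (EFin \o g) -> continuous (pconv k l g : R * R -> R).
Proof.
move=> tk tl Ig p.
have [B kB kL] := tk; have [C lC lL] := tl.
have B0 : 0 <= B by apply: le_trans (kB 0).
have C0 : 0 <= C by apply: le_trans (lC 0).
set N := \int[leb2 R]_q `|g q|.
have mg : measurable_fun setT g by apply/measurable_EFinP; exact: measurable_int Ig.
have N0 : 0 <= N by apply: Rintegral_ge0.
have Ign : (leb2 R).-integrable setT (EFin \o (fun q => `|g q|)) by exact: integrable_norm Ig.
have key (p' : R * R) : `|pconv k l g p - pconv k l g p'| <=
    (B * C) * (`|p.1 - p'.1| + `|p.2 - p'.2|) * N.
  have I1 := pconv_integrable p tk tl Ig; have I2 := pconv_integrable p' tk tl Ig.
  rewrite /pconv -RintegralB//.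
  have I3 := integrableB_EFin measurableT I1 I2.
  apply: le_trans; first exact: le_normr_Rintegral.
  rewrite -RintegralZl//.
  apply: le_Rintegral => //; first exact: integrable_norm I3.
    exact: integrableZ_EFin.
  move=> q _; rewrite -mulrBr normrM mulrC ler_wpM2r//.
  have -> : k (p.1 - q.1) * l (p.2 - q.2) - k (p'.1 - q.1) * l (p'.2 - q.2) =
    (k (p.1 - q.1) - k (p'.1 - q.1)) * l (p.2 - q.2) +
    k (p'.1 - q.1) * (l (p.2 - q.2) - l (p'.2 - q.2)) by ring.
  apply: le_trans (ler_normD _ _) _; rewrite [leRHS]mulrDr; apply: lerD; rewrite normrM.
    rewrite [leRHS]mulrAC; apply: ler_pM => //.
    by rewrite (le_trans (kL _ _))// opprB addrA subrK.
  rewrite -[leRHS]mulrA; apply: ler_pM => //.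
  by rewrite (le_trans (lL _ _))// opprB addrA subrK.
apply/cvgrPdist_le => e e0.
set K := (B * C) * N + 1.
have K0 : 0 < K by rewrite ltr_wpDl// mulr_ge0// mulr_ge0.
have /cvgrPdist_le c1 : q.1 @[q --> p] --> p.1 by exact: cvg_fst.
have /cvgrPdist_le c2 : q.2 @[q --> p] --> p.2 by exact: cvg_snd.
near=> q.
rewrite (le_trans (key q))//.
have h1 : `|p.1 - q.1| <= e / (2 * K).
  by near: q; apply: c1; rewrite divr_gt0// mulr_gt0.
have h2 : `|p.2 - q.2| <= e / (2 * K).
  by near: q; apply: c2; rewrite divr_gt0// mulr_gt0.
rewrite mulrAC (@le_trans _ _ (K * (e / (2 * K) + e / (2 * K))))//.
  apply: ler_pM; rewrite ?mulr_ge0 ?addr_ge0//; last exact: lerD.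
  by rewrite lerDl.
rewrite le_eqVlt; apply/orP; left; apply/eqP; field.
by rewrite gt_eqF.
Unshelve. all: by end_near. Qed.

Lemma pconv_is_derivex k k' l g (p : R * R) : tame k -> tame k' -> tame l ->
  (forall x : R, is_derive x 1 k (k' x)) ->
  (leb2 R).-integrable setT (EFin \o g) ->
  is_derive p.1 1 (fun x => pconv k l g (x, p.2)) (pconv k' l g p).
Proof.
move=> tk tk' tl dk Ig.
have [B kB _] := tk; have [B' kB' _] := tk'; have [C lC _] := tl.
have C0 : 0 <= C by apply: le_trans (lC 0).
apply: (@is_derive_under_integral _ (plane R) R (leb2 R) g
  (fun x q => k (x - q.1) * l (p.2 - q.2)) (fun x q => k' (x - q.1) * l (p.2 - q.2))
  (Num.max B B' * C)) => //.
- by move=> t; exact: (measurable_ktensor (t, p.2) tk tl).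
- by move=> t q; rewrite normrM ler_pM// le_max kB.
- by move=> t q; rewrite normrM ler_pM// le_max kB' orbT.
- move=> t q.
  have d1 : is_derive t 1 (fun x => x - q.1) 1.
    by apply: is_derive_eq; rewrite subr0.
  have d2 := @is_derive1_comp _ k (fun x => x - q.1) t _ _ (dk _) d1.
  have d3 : is_derive t 1 (fun _ : R => l (p.2 - q.2)) 0 by exact: is_derive_cst.
  apply: (is_derive_eq (is_derive_mulr d2 d3)).
  by rewrite mulr0 add0r mulr1.
Qed.

Lemma pconv_is_derivey k l l' g (p : R * R) : tame k -> tame l -> tame l' ->
  (forall x : R, is_derive x 1 l (l' x)) ->
  (leb2 R).-integrable setT (EFin \o g) ->
  is_derive p.2 1 (fun y => pconv k l g (p.1, y)) (pconv k l' g p).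
Proof.
move=> tk tl tl' dl Ig.
have [B kB _] := tk; have [C' lC' _] := tl'; have [C lC _] := tl.
have B0 : 0 <= B by apply: le_trans (kB 0).
apply: (@is_derive_under_integral _ (plane R) R (leb2 R) g
  (fun y q => k (p.1 - q.1) * l (y - q.2)) (fun y q => k (p.1 - q.1) * l' (y - q.2))
  (B * Num.max C C')) => //.
- by move=> t; exact: (measurable_ktensor (p.1, t) tk tl).
- by move=> t q; rewrite normrM ler_pM// le_max lC.
- by move=> t q; rewrite normrM ler_pM// le_max lC' orbT.
- move=> t q.
  have d1 : is_derive t 1 (fun x => x - q.2) 1.
    by apply: is_derive_eq; rewrite subr0.
  have d2 := @is_derive1_comp _ l (fun x => x - q.2) t _ _ (dl _) d1.
  have d3 : is_derive t 1 (fun _ : R => k (p.1 - q.1)) 0 by exact: is_derive_cst.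
  apply: (is_derive_eq (is_derive_mulr d3 d2)).
  by rewrite mul0r addr0 mulr1.
Qed.

End pconv.

(** * Rectangles, and weak derivatives of mollifications *)

Definition rect (R : realType) (a b c d : R) : set (plane R) := `[a, b] `*` `[c, d].

Lemma measurable_rect (R : realType) (a b c d : R) : measurable (rect a b c d).
Proof. by apply: measurableX; exact: measurable_itv. Qed.

Lemma leb2_rect_lty (R : realType) (a b c d : R) : (leb2 R (rect a b c d) < +oo)%E.
Proof.
have fin (u v : R) : @lebesgue_measure R `[u, v]%classic \is a fin_num.
  by rewrite lebesgue_measure_itv /=; case: ifP.
have -> : (leb2 R (rect a b c d) = @lebesgue_measure R `[a, b]%classic * @lebesgue_measure R `[c, d]%classic)%E.
  by apply: product_measure1E; exact: measurable_itv.
by rewrite ltey_eq fin_numM// ?fin.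
Qed.

Lemma rect_compact (R : realType) (a b c d : R) : compact (rect a b c d : set (R * R)).
Proof. by apply: compact_setX; exact: segment_compact. Qed.

Lemma Lp2_measurable (R : realType) (D : set (R * R)) (v : R * R -> R) :
  in_Lp D 2%:E v -> measurable_fun [set: plane R] (v \_ D).
Proof. by move=> /sub_Lfun_mfun; rewrite inE. Qed.

Lemma Lp2_sq_lty (R : realType) (D : set (R * R)) (v : R * R -> R) :
  in_Lp D 2%:E v -> (\int[leb2 R]_p ((v \_ D) p ^+ 2)%:E < +oo)%E.
Proof.
move=> /Lfun2_integrable_sqr H.
exact: (integrable_EFin_lty measurableT H).
Qed.

Lemma bounded_in_box (R : realType) (Omega : set (R * R)) : bounded_set Omega ->
  exists2 L : R, 0 < L & forall p, Omega p -> `|p.1| <= L /\ `|p.2| <= L.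
Proof.
move=> [M [_ HM]]; exists (Num.max 0 M + 1); first by rewrite ltr_wpDl// le_max lexx.
move=> p Op; have := HM (Num.max 0 M + 1).
rewrite ltr_pwDr ?le_max ?lexx ?orbT// => /(_ isT p Op).
by rewrite /= prod_normE ge_max => /andP[].
Qed.

(** A square integrable function with bounded support is integrable, because
[|t| <= t^2 + 1]. *)
Lemma sq_integrable_box (R : realType) (g : plane R -> R) (L : R) :
  measurable_fun setT g -> (\int[leb2 R]_p (g p ^+ 2)%:E < +oo)%E ->
  (forall p, g p != 0 -> `|p.1| <= L /\ `|p.2| <= L) ->
  (leb2 R).-integrable setT (EFin \o g).
Proof.
move=> mg ig gL.
have mQ := measurable_rect (- L) L (- L) L.
apply: (@le_integrable_EFin _ (plane R) R (leb2 R) setT _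
  (fun p => g p ^+ 2 + \1_(rect (- L) L (- L) L) p)) => //.
- move=> p _; have [->|gp] := eqVneq (g p) 0.
    by rewrite normr0 expr0n/= add0r.
  have [p1 p2] := gL p gp.
  rewrite indicE mem_set ?normr_le_sqr1// /rect /= !in_itv/=.
  by move: p1 p2; rewrite !ler_norml.
- apply: integrableD_EFin => //.
    by apply: ge0_integrable_EFin => // [|p _]; [exact: measurable_funX|exact: sqr_ge0].
  apply: ge0_integrable_EFin => //.
  by rewrite integral_indic// setIT; exact: leb2_rect_lty.
Qed.

Lemma Rintegral_patch_mulr (R : realType) (D : set (R * R)) (v w : R * R -> R) :
  \int[leb2 R]_(q in D) (v q * w q) = \int[leb2 R]_q ((v \_ D) q * w q).
Proof.
rewrite Rintegral_mkcond; congr Rintegral; apply/funext => q.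
by rewrite /patch; case: ifP => // _; rewrite mul0r.
Qed.

Section weak_pconv.
Context {R : realType}.
Variables (f : R -> R) (Omega : set (R * R)) (u ux uy : R * R -> R).
Hypothesis Wu : Wf12 f Omega u ux uy.
Variables (r e : R) (p : R * R).
Hypotheses (r0 : 0 < r) (e0 : 0 < e).
Hypothesis boxO : forall q : R * R, `|p.1 - q.1| <= r -> `|p.2 - q.2| <= e -> Omega q.

Let h (q : R * R) : R := kern r (p.1 - q.1) * kern e (p.2 - q.2).

Lemma kern_test_function : test_function Omega h.
Proof.
have sm (x s : R) k : smooth k (fun y => kern s (x - y)).
  have := @smooth_affine R k (-1) x _ (smooth_kern s k).
  by congr smooth; apply/funext => y; congr (kern s _); ring.
pose K : set (R * R) := rect (p.1 - r) (p.1 + r) (p.2 - e) (p.2 + e).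
have hK : [set q | h q != 0] `<=` K.
  move=> q /= hq; rewrite /K /rect /= !in_itv/=.
  have q1 : `|p.1 - q.1| < r.
    by rewrite ltNge; apply: contra hq => ?; rewrite /h kern_out// mul0r.
  have q2 : `|p.2 - q.2| < e.
    by rewrite ltNge; apply: contra hq => ?; rewrite /h [X in _ * X]kern_out// mulr0.
  move: q1 q2; rewrite !ltr_norml => /andP[? ?] /andP[? ?].
  by split; apply/andP; split; lra.
have cK : compact K by exact: rect_compact.
have clK : closed K by apply: compact_closed => //; exact: Rhausdorff2.
have hcl : closure [set q | h q != 0] `<=` K.
  by move=> q /(closure_subset hK); rewrite -(closure_id K).1.
split.
  move=> k; exact: (@Ck_tensor R k (fun s => kern r (p.1 - s)) (fun t => kern e (p.2 - t))
    (sm _ _ _) (sm _ _ _)).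
split; first exact: (subclosed_compact (@closed_closure _ _) cK hcl).
move=> q /hcl; rewrite /K /rect /= !in_itv/= => -[/andP[? ?] /andP[? ?]].
by apply: boxO; rewrite ler_norml; apply/andP; split; lra.
Qed.

Lemma is_derive_kern_subl (x s t : R) :
  is_derive t 1 (fun y => kern s (x - y)) (- derive1 (kern s) (x - t)).
Proof.
have d1 : is_derive t 1 (fun y => x - y) (-1).
  by rewrite -(sub0r (1 : R)); exact: (is_deriveB (is_derive_cst x t 1) (is_derive_id t 1)).
have := @is_derive1_comp _ (kern s) (fun y => x - y) t _ _
  (smooth_is_derive (smooth_kern s 1) _) d1.
by rewrite mulrN1.
Qed.

Variable L : R.
Hypothesis OL : forall q, Omega q -> `|q.1| <= L /\ `|q.2| <= L.

Lemma Lp2_integrable (v : R * R -> R) : in_Lp Omega 2%:E v ->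
  (leb2 R).-integrable setT (EFin \o (v \_ Omega)).
Proof.
move=> Lv; apply: (@sq_integrable_box R (v \_ Omega) L (Lp2_measurable Lv) (Lp2_sq_lty Lv)).
move=> q; rewrite /patch; case: ifPn; last by rewrite eqxx.
by rewrite inE => Oq _; exact: OL.
Qed.

(** The definition of the weak derivative, tested with the kernel centered at [p]: the
sign of the integration by parts is that of differentiating [kern r (p.1 - x)]. *)
Lemma weak_pconv_x :
  pconv (derive1 (kern r)) (kern e) (u \_ Omega) p = pconv (kern r) (kern e) (ux \_ Omega) p.
Proof.
have [Lu Lx Ly H] := Wu; have [H1 _] := H h kern_test_function.
rewrite (Rintegral_patch_mulr _ ux) (Rintegral_patch_mulr _ u) in H1; move: H1.
have Iu := pconv_integrable p (derive_kern_tame r0) (kern_tame e0) (Lp2_integrable Lu).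
rewrite -/(pconv (kern r) (kern e) (ux \_ Omega) p).
rewrite (_ : (fun q => (u \_ Omega) q * dx h q) = (fun q => -1 * ((u \_ Omega) q *
  (derive1 (kern r) (p.1 - q.1) * kern e (p.2 - q.2))))).
  rewrite RintegralZ_all; last by apply/measurable_EFinP; exact: measurable_int Iu.
  by rewrite mulN1r => /oppr_inj.
apply/funext => q; rewrite dxE derive1E /h /=.
have d := is_derive_mulr (@is_derive_kern_subl p.1 r q.1) (is_derive_cst (kern e (p.2 - q.2)) q.1 1).
by rewrite (@derive_val _ _ _ _ _ _ _ d) /= mulN1r -mulrN mulr0 add0r mulNr.
Qed.

(** The weak derivative in [y] is that of [f(x) u]; as [f] depends on [x] only, it is
the function [f u], here [fu], that is mollified. *)
Lemma weak_pconv_y (fu : plane R -> R) : fu = (fun q => f q.1 * (u \_ Omega) q) ->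
  (leb2 R).-integrable setT (EFin \o fu) ->
  pconv (kern r) (derive1 (kern e)) fu p = pconv (kern r) (kern e) (uy \_ Omega) p.
Proof.
move=> fuE Ifu.
have [Lu Lx Ly H] := Wu; have [_ H1] := H h kern_test_function.
rewrite (Rintegral_patch_mulr _ uy) (Rintegral_patch_mulr _ u (fun q => f q.1 * dy h q)) in H1; move: H1.
have Iu := pconv_integrable p (kern_tame r0) (derive_kern_tame e0) Ifu.
rewrite -/(pconv (kern r) (kern e) (uy \_ Omega) p).
rewrite (_ : (fun q => (u \_ Omega) q * (f q.1 * dy h q)) = (fun q => -1 * (fu q *
  (kern r (p.1 - q.1) * derive1 (kern e) (p.2 - q.2))))).
  rewrite RintegralZ_all; last by apply/measurable_EFinP; exact: measurable_int Iu.
  by rewrite mulN1r => /oppr_inj.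
apply/funext => q; rewrite fuE dyE derive1E /h /=.
have d := is_derive_mulr (is_derive_cst (kern r (p.1 - q.1)) q.2 1) (@is_derive_kern_subl p.2 e q.2).
by rewrite (@derive_val _ _ _ _ _ _ _ d) /= mul0r addr0 mulN1r -!mulrN -[RHS]mulrA mulrCA.
Qed.
End weak_pconv.

(** * Approximation by smooth functions in the energy norm *)

Lemma ereal_cvg0_le (R : realType) (a : nat -> \bar R) (e : R) : 0 < e ->
  a n @[n --> \oo] --> 0%E -> \forall n \near \oo, (a n <= e%:E)%E.
Proof.
move=> e0 /fine_cvgP[afin /cvgrPdist_le /(_ e e0) H].
near=> n.
have an : a n \is a fin_num by near: n.
rewrite -(fineK an) lee_fin.
have : `|0 - fine (a n)| <= e by near: n.
by rewrite sub0r normrN; apply: le_trans; exact: ler_norm.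
Unshelve. all: by end_near. Qed.

Lemma integral_sq_sum_le d (T : measurableType d) (R : realType)
    (mu : {measure set T -> \bar R}) (n : nat) (c : nat -> R) (g : nat -> T -> R) (e : R) :
  (forall i, 0 <= c i) -> (forall i, measurable_fun setT (g i)) ->
  (forall i, (i < n)%N -> (\int[mu]_p (g i p ^+ 2)%:E <= e%:E)%E) ->
  (\int[mu]_p (\sum_(i < n) c i * g i p ^+ 2)%:E <= ((\sum_(i < n) c i) * e)%:E)%E.
Proof.
move=> c0 mg ge; elim: n ge => [|n IH] ge.
  under eq_integral do rewrite big_ord0.
  by rewrite integral0 big_ord0 mul0r.
under eq_integral do rewrite big_ord_recr /= EFinD.
rewrite ge0_integralD//.
- rewrite big_ord_recr /= mulrDl EFinD leeD//.
    by apply: IH => i ni; apply: ge; rewrite ltnS ltnW.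
  rewrite (_ : (fun p => _) = (fun p => (c n)%:E * (g n p ^+ 2)%:E)%E)//.
  by rewrite sq_integralZ// EFinM lee_wpmul2l// ?lee_fin// ge.
- by move=> p _; rewrite lee_fin sumr_ge0// => i _; rewrite mulr_ge0// sqr_ge0.
- apply/measurable_EFinP; apply: measurable_sum => i.
  by apply: measurable_funM => //; exact: measurable_funX.
- by move=> p _; rewrite lee_fin mulr_ge0// sqr_ge0.
- by apply/measurable_EFinP; apply: measurable_funM => //; exact: measurable_funX.
Qed.

(** The density of the squared distance from [(u, nabla_f u)] to [(v, nabla_f v)]. *)
Definition approx_error (R : realType) (f : R -> R) (u ux uy v vx vy : R * R -> R)
    (p : R * R) : R :=
  (v p - u p) ^+ 2 + (vx p - ux p) ^+ 2 + (f p.1 * vy p - uy p) ^+ 2.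

Section smooth_approximation.
Context {R : realType}.
Implicit Types (k l : R -> R) (g : plane R -> R).

Lemma interval_dist (x p q r : R) : x - r <= p -> p <= x + r -> `|p - q| <= r ->
  `|x - q| <= 2 * r.
Proof. by rewrite !ler_norml => ? ? /andP[? ?]; apply/andP; split; lra. Qed.

(** Triangle inequality for the three components.  The last one goes from
[t * a3] to [d4] through [t * b3], [a4] and [b4]: in the application [a3] and [b3]
are mollifications of the [y]-derivative, [t] is the value of [f], and [a4] and [b4]
are mollifications of the weak derivative [f u_y]. *)
Lemma approx_error_le (F t a1 b1 d1 a2 b2 d2 a3 b3 a4 b4 d4 : R) : t ^+ 2 <= F ^+ 2 ->
  (a1 - d1) ^+ 2 + (a2 - d2) ^+ 2 + (t * a3 - d4) ^+ 2 <=
  2 * (a1 - b1) ^+ 2 + 2 * (b1 - d1) ^+ 2 + 2 * (a2 - b2) ^+ 2 + 2 * (b2 - d2) ^+ 2 +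
  4 * F ^+ 2 * (a3 - b3) ^+ 2 + 4 * (a4 - t * b3) ^+ 2 + 4 * (a4 - b4) ^+ 2 + 4 * (b4 - d4) ^+ 2.
Proof.
move=> tF.
have sq2 (a b d : R) : (a - d) ^+ 2 <= 2 * (a - b) ^+ 2 + 2 * (b - d) ^+ 2.
  rewrite -subr_ge0 (_ : _ - _ = (a - b - (b - d)) ^+ 2); last by ring.
  exact: sqr_ge0.
have sq4 (a b d e : R) : (a + b + d + e) ^+ 2 <= 4 * a ^+ 2 + 4 * b ^+ 2 + 4 * d ^+ 2 + 4 * e ^+ 2.
  rewrite -subr_ge0 (_ : _ - _ = (a - b) ^+ 2 + (a - d) ^+ 2 + (a - e) ^+ 2 + (b - d) ^+ 2 +
    (b - e) ^+ 2 + (d - e) ^+ 2); last by ring.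
  by rewrite !addr_ge0// sqr_ge0.
have H1 := sq2 a1 b1 d1; have H2 := sq2 a2 b2 d2.
have := sq4 (t * (a3 - b3)) (- (a4 - t * b3)) (a4 - b4) (b4 - d4).
rewrite (_ : t * (a3 - b3) + - (a4 - t * b3) + (a4 - b4) + (b4 - d4) = t * a3 - d4); last by ring.
have H4 : (t * (a3 - b3)) ^+ 2 <= F ^+ 2 * (a3 - b3) ^+ 2.
  by rewrite exprMn ler_wpM2r// sqr_ge0.
rewrite sqrrN => H3.
move: H1 H2 H3 H4; move: ((a1 - d1) ^+ 2) ((a2 - d2) ^+ 2) ((t * a3 - d4) ^+ 2) ((t * (a3 - b3)) ^+ 2)
  => X1 X2 X3 X4.
rewrite -!mulrA; move: (F ^+ 2 * (a3 - b3) ^+ 2) => X5.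
move: ((a1 - b1) ^+ 2) ((b1 - d1) ^+ 2) ((a2 - b2) ^+ 2) ((b2 - d2) ^+ 2)
  ((a4 - t * b3) ^+ 2) ((a4 - b4) ^+ 2) ((b4 - d4) ^+ 2) => *; lra.
Qed.

(** A factor that depends on [x] only commutes with vertical mollification; this is
why mollification is done vertically first. *)
Lemma convy_scale k (c : R -> R) g (p : plane R) :
  measurable_fun [set: R] k -> measurable_fun setT g ->
  convy k (fun q => c q.1 * g q) p = c p.1 * convy k g p.
Proof.
move=> mk mg; rewrite /convy /conv -RintegralZ_all.
  by apply: eq_Rintegral => t _ /=; rewrite mulrA.
apply: measurable_funM; first exact: measurable_section_y.
by apply: (measurableT_comp mk); exact: measurable_subl.
Qed.

(** On the support of [l] the kernel of twice the radius is bounded below, so that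
bounds on convolution with mollifiers extend to kernels without sign, such as
derivatives of mollifiers. *)
Lemma kern_dominates l (r : R) : tame l -> 0 < r -> (forall s, r <= `|s| -> l s = 0) ->
  exists2 C : R, 0 < C & forall s, `|l s| <= C * kern (2 * r) s.
Proof.
move=> [B lB _] r0 lr; have r20 : 0 < 2 * r by rewrite mulr_gt0.
have m0 := bump_mass_gt0 r20.
have B0 : 0 <= B by apply: le_trans (lB 0).
have c0 : 0 < expR (- 2) ^+ 2 :> R by rewrite exprn_gt0// expR_gt0.
exists ((B + 1) * bump_mass (2 * r) / expR (- 2) ^+ 2).
  by rewrite divr_gt0// mulr_gt0// ltr_wpDl.
move=> s; rewrite /kern.
have -> : (B + 1) * bump_mass (2 * r) / expR (- 2) ^+ 2 * (bump (2 * r) s / bump_mass (2 * r)) =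
  (B + 1) * (bump (2 * r) s / expR (- 2) ^+ 2).
  by field; rewrite !gt_eqF// ?expR_gt0.
have [rs|rs] := leP r `|s|.
  by rewrite lr// normr0 mulr_ge0 ?divr_ge0 ?bump_ge0 ?(ltW c0)// addr_ge0.
apply: (@le_trans _ _ (B + 1)); first by rewrite (le_trans (lB s))// lerDl.
rewrite ler_peMr ?addr_ge0// ler_pdivlMr// mul1r expr2.
move: rs; rewrite ltr_norml => /andP[rs1 rs2].
have s3 : s / (2 * r) <= 2^-1.
  by rewrite ler_pdivrMr// mulrA mulVf// mul1r ltW.
have s4 : - 2^-1 <= s / (2 * r).
  by rewrite ler_pdivlMr// mulNr mulrA mulVf// mul1r ltW.
by apply: ler_pM; rewrite ?expR_ge0//; apply: expi_half; lra.
Qed.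

Lemma conv_tame_young l (r : R) : tame l -> 0 < r -> (forall s, r <= `|s| -> l s = 0) ->
  exists2 C : R, 0 < C & forall h : R -> R, measurable_fun [set: R] h ->
  (\int[@lebesgue_measure R]_x (conv l h x ^+ 2)%:E <=
   C%:E * \int[@lebesgue_measure R]_x (h x ^+ 2)%:E)%E.
Proof.
move=> tl r0 lr; have [C C0 lC] := kern_dominates tl r0 lr.
have r20 : 0 < 2 * r by rewrite mulr_gt0.
exists (C ^+ 2); first by rewrite exprn_gt0.
move=> h mh; have ml := tame_measurable tl.
have Mk := kern_mollifier r20; have [mk k0 _ _ _] := Mk.
have [ih|] := ltP (\int[@lebesgue_measure R]_s (h s ^+ 2)%:E)%E +oo%E; last first.
  by rewrite leye_eq => /eqP ->; rewrite gt0_muley ?leey// lte_fin exprn_gt0.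
have mah : measurable_fun [set: R] (fun s => `|h s|) by exact: measurableT_comp.
have iah : (\int[@lebesgue_measure R]_s (`|h s| ^+ 2)%:E < +oo)%E.
  by under eq_integral do rewrite real_normK ?num_real//.
apply: (@le_trans _ _ (\int[@lebesgue_measure R]_x ((C ^+ 2)%:E * (conv (kern (2 * r)) (fun s => `|h s|) x ^+ 2)%:E))%E).
  apply: ge0_le_integral => //.
  - by move=> x _; rewrite lee_fin sqr_ge0.
  - by apply/measurable_EFinP; apply: measurable_funX; exact: measurable_conv.
  - by apply: emeasurable_funM => //; apply/measurable_EFinP; apply: measurable_funX; exact: measurable_conv.
  - move=> x _; rewrite -EFinM lee_fin -exprMn -[leLHS]real_normK ?num_real//.
    have I := mul_mollifier_integrable x Mk mah iah.
    have mI : measurable_fun [set: measurableTypeR R] (fun s => h s * l (x - s)).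
      apply: measurable_funM => //; apply: (measurableT_comp ml); exact: measurable_subl.
    have bI s : `|h s * l (x - s)| <= C * (`|h s| * kern (2 * r) (x - s)).
      by rewrite normrM mulrCA ler_wpM2l.
    have IC := @integrableZ_EFin _ (measurableTypeR R) R (@lebesgue_measure R) setT C _ measurableT I.
    have I2 := @le_integrable_EFin _ (measurableTypeR R) R (@lebesgue_measure R) setT _ _
      measurableT mI (fun s _ => bI s) IC.
    have key : `|conv l h x| <= C * conv (kern (2 * r)) (fun s => `|h s|) x.
      rewrite /conv; apply: le_trans; first exact: le_normr_Rintegral.
      rewrite -RintegralZl//; apply: le_Rintegral => //.
      exact: (integrable_norm I2).
    by rewrite ler_pXn2r// nnegrE// (le_trans _ key).
rewrite sq_integralZ ?sqr_ge0//; last exact: measurable_conv.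
rewrite lee_wpmul2l ?lee_fin ?sqr_ge0//.
apply: (le_trans (conv_young Mk mah)).
by under eq_integral do rewrite real_normK ?num_real//.
Qed.

Lemma tame_conv_sq_lty l g : tame l -> (exists2 r : R, 0 < r & forall s, r <= `|s| -> l s = 0) ->
  measurable_fun setT g -> (\int[leb2 R]_p (g p ^+ 2)%:E < +oo)%E ->
  (\int[leb2 R]_p (convy l g p ^+ 2)%:E < +oo)%E.
Proof.
move=> tl [r r0 lr] mg ig; have ml := tame_measurable tl.
have [C C0 HC] := conv_tame_young tl r0 lr.
have ms := measurable_swap mg; have mc := measurable_convx ml ms.
have -> : (\int[leb2 R]_p (convy l g p ^+ 2)%:E = \int[leb2 R]_p (convx l (swap g) p ^+ 2)%:E)%E.
  rewrite -(@ge0_integral_swap R (fun p => convx l (swap g) p ^+ 2))//; first exact: measurable_funX.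
  by move=> p; exact: sqr_ge0.
have isg : (\int[leb2 R]_p (swap g p ^+ 2)%:E < +oo)%E.
  have := @ge0_integral_swap R (fun p => g p ^+ 2) (measurable_funX 2%N mg) (fun p => sqr_ge0 _).
  by move=> ->.
rewrite sq_tonelli2//.
apply: (@le_lt_trans _ _ (C%:E * \int[leb2 R]_p (swap g p ^+ 2)%:E)%E); last first.
  by rewrite lte_mul_pinfty// lee_fin ltW.
rewrite sq_tonelli2// -ge0_integralZl//; last 3 first.
- exact: measurable_sq_section.
- by move=> y _; apply: integral_ge0 => x _; rewrite lee_fin sqr_ge0.
- by rewrite lee_fin ltW.
apply: ge0_le_integral => //.
- by move=> y _; apply: integral_ge0 => x _; rewrite lee_fin sqr_ge0.
- exact: measurable_sq_section.
- by apply: emeasurable_funM => //; exact: measurable_sq_section.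
- move=> y _; exact: (HC (fun s => swap g (s, y)) (measurable_section_x y ms)).
Qed.

(** Multiplication by [f] commutes with vertical mollification but not with the horizontal
one, and [f] is only continuous.  The vertical scale [n] is therefore fixed
first: [convy kn u] then has a vertical derivative in L^2, and the horizontal
scale [m], chosen afterwards, makes the horizontal mollifications of this derivative
and of its product with [f] close to the functions themselves. *)
Lemma smooth_approximation (f : R -> R) (Omega : set (R * R)) (u ux uy : R * R -> R)
    (x0 y0 rho eta : R) :
  Wf12 f Omega u ux uy -> bounded_set Omega -> continuous f -> 0 < rho ->
  (forall q : R * R, `|x0 - q.1| <= 2 * rho -> `|y0 - q.2| <= 2 * rho -> Omega q) ->
  0 < eta ->
  exists v vx vy : R * R -> R,
  [/\ [/\ continuous v, continuous vx & continuous vy],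
      [/\ measurable_fun [set: plane R] v, measurable_fun [set: plane R] vx &
          measurable_fun [set: plane R] vy],
      (forall p : R * R, is_derive p.1 1 (fun x => v (x, p.2)) (vx p)) /\
      (forall p : R * R, is_derive p.2 1 (fun y => v (p.1, y)) (vy p)) &
      (\int[leb2 R]_(p in rect (x0 - rho) (x0 + rho) (y0 - rho) (y0 + rho))
         (approx_error f (u \_ Omega) (ux \_ Omega) (uy \_ Omega) v vx vy p)%:E <= eta%:E)%E].
Proof.
move=> Wu bO cf rho0 boxO eta0.
have [L L0 OL] := bounded_in_box bO.
have [Lu Lx Ly _] := Wu.
set u0 := u \_ Omega; set ux0 := ux \_ Omega; set uy0 := uy \_ Omega.
have mu0 : measurable_fun [set: plane R] u0 := Lp2_measurable Lu.
have mux0 : measurable_fun [set: plane R] ux0 := Lp2_measurable Lx.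
have muy0 : measurable_fun [set: plane R] uy0 := Lp2_measurable Ly.
have su0 := Lp2_sq_lty Lu; have sux0 := Lp2_sq_lty Lx; have suy0 := Lp2_sq_lty Ly.
have Iu0 := Lp2_integrable OL Lu.
have Iux0 := Lp2_integrable OL Lx.
have Iuy0 := Lp2_integrable OL Ly.
rewrite -/u0 -/ux0 -/uy0 in su0 sux0 suy0 Iu0 Iux0 Iuy0.
(* [fL] is [f] cut off outside an interval that contains the projection of the domain. *)
have [F F0 [fL [mfL fLF fLE]]] : exists2 F : R, 0 <= F & exists fL : R -> R,
    [/\ measurable_fun setT fL, forall x, `|fL x| <= F & forall x, `|x| <= L -> fL x = f x].
  have LL : - L <= L by lra.
  have [c _ H] := @EVT_max R (fun s => `|f s|) (- L) L LL
    (continuous_subspaceT (fun x => continuous_comp (cf x) (@norm_continuous _ _ _))).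
  exists `|f c| => //; exists (f \_ `[- L, L]); split.
  - apply/(measurable_restrictT _ (measurable_itv _)); apply: measurable_funTS.
    exact: continuous_measurable_fun.
  - move=> x; rewrite /patch; case: ifPn => [|_]; last by rewrite normr0.
    by rewrite inE => /H.
  - by move=> x; rewrite ler_norml /patch => xL; rewrite mem_set//= in_itv.
pose fu (q : plane R) : R := fL q.1 * u0 q.
have fuE : fu = (fun q => f q.1 * u0 q).
  apply/funext => q; rewrite /fu /u0 /patch; case: ifPn => [|_]; last by rewrite !mulr0.
  by rewrite inE => /OL[qL _]; rewrite fLE.
have mfL1 : measurable_fun [set: plane R] (fun q : plane R => fL q.1).
  by apply: (measurableT_comp mfL); exact: measurable_fst.
have mfu : measurable_fun setT fu by exact: measurable_funM.
have Ifu : (leb2 R).-integrable setT (EFin \o fu).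
  apply: (@le_integrable_EFin _ (plane R) R (leb2 R) setT _ (fun q => F * `|u0 q|)) => //.
    by move=> q _; rewrite normrM ler_wpM2r.
  by apply: integrableZ_EFin => //; exact: integrable_norm Iu0.
(* Eight errors will be made smaller than [e1]; the weights [c i] below, which come
   from [approx_error_le], add up to [20 + 4 F^2]. *)
pose e1 := eta / (20 + 4 * F ^+ 2).
have den0 : 0 < 20 + 4 * F ^+ 2 by rewrite ltr_wpDr// mulr_ge0// sqr_ge0.
have e10 : 0 < e1 by rewrite divr_gt0.
have ak := @kern_approx_identity R.
have r0 (n : nat) : 0 < n.+1%:R^-1 :> R by rewrite invr_gt0.
have Mk n : mollifier (kern_seq n : R -> R) by exact: kern_mollifier.
have tk n : tame (kern_seq n : R -> R) by exact: kern_tame.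
have tk' n : tame (derive1 (kern_seq n : R -> R)) by exact: derive_kern_tame.
have small : \forall n \near \oo, n.+1%:R^-1 <= rho.
  have /cvgrPdist_le /(_ rho rho0) := @cvg_harmonic R.
  by apply: filterS => n; rewrite sub0r normrN; exact: le_trans (ler_norm _).
(* The vertical scale comes first. *)
have [n [n1 nu nux nuy]] : exists n : nat, [/\ n.+1%:R^-1 <= rho,
    (\int[leb2 R]_p ((convy (kern_seq n) u0 p - u0 p) ^+ 2)%:E <= e1%:E)%E,
    (\int[leb2 R]_p ((convy (kern_seq n) ux0 p - ux0 p) ^+ 2)%:E <= e1%:E)%E &
    (\int[leb2 R]_p ((convy (kern_seq n) uy0 p - uy0 p) ^+ 2)%:E <= e1%:E)%E].
  have N1 := ereal_cvg0_le e10 (convy_L2_cvg ak mu0 su0).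
  have N2 := ereal_cvg0_le e10 (convy_L2_cvg ak mux0 sux0).
  have N3 := ereal_cvg0_le e10 (convy_L2_cvg ak muy0 suy0).
  have [n [h0 [h1 [h2 h3]]]] := filter_ex (filterI small (filterI N1 (filterI N2 N3))).
  by exists n; split; [exact: h0|exact: h1|exact: h2|exact: h3].
set kn : R -> R := kern_seq n; set kn' := derive1 kn.
pose W1 := convy kn u0; pose W2 := convy kn ux0; pose W3 := convy kn uy0.
pose G1 := convy kn' u0; pose G2 := convy kn' fu.
have mkn : measurable_fun setT kn := tame_measurable (tk n).
have mkn' : measurable_fun setT kn' := tame_measurable (tk' n).
have mW1 : measurable_fun setT W1 by exact: measurable_convy.
have mW2 : measurable_fun setT W2 by exact: measurable_convy.
have mW3 : measurable_fun setT W3 by exact: measurable_convy.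
have mG1 : measurable_fun setT G1 by exact: measurable_convy.
have mG2 : measurable_fun setT G2 by exact: measurable_convy.
have sW1 : (\int[leb2 R]_p (W1 p ^+ 2)%:E < +oo)%E. exact: le_lt_trans (convy_L2_le (Mk n) mu0) su0.
have sW2 : (\int[leb2 R]_p (W2 p ^+ 2)%:E < +oo)%E. exact: le_lt_trans (convy_L2_le (Mk n) mux0) sux0.
have sW3 : (\int[leb2 R]_p (W3 p ^+ 2)%:E < +oo)%E. exact: le_lt_trans (convy_L2_le (Mk n) muy0) suy0.
have out' : exists2 r : R, 0 < r & forall s, r <= `|s| -> kn' s = 0.
  by exists (2 * n.+1%:R^-1); [rewrite mulr_gt0|exact: derive_kern_out].
have sfu : (\int[leb2 R]_p (fu p ^+ 2)%:E < +oo)%E.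
  apply: (@le_lt_trans _ _ (\int[leb2 R]_p ((F ^+ 2)%:E * (u0 p ^+ 2)%:E))%E).
    apply: ge0_le_integral => //.
    - by move=> p _; rewrite lee_fin sqr_ge0.
    - by apply/measurable_EFinP; exact: measurable_funX.
    - by apply: emeasurable_funM => //; apply/measurable_EFinP; exact: measurable_funX.
    - move=> p _; rewrite -EFinM lee_fin /fu exprMn ler_wpM2r ?sqr_ge0//.
      by rewrite -[fL _ ^+ 2]real_normK ?num_real// ler_pXn2r// nnegrE.
  by rewrite sq_integralZ ?sqr_ge0// lte_mul_pinfty// lee_fin sqr_ge0.
have sG1 : (\int[leb2 R]_p (G1 p ^+ 2)%:E < +oo)%E by apply: (tame_conv_sq_lty (tk' n)).
have sG2 : (\int[leb2 R]_p (G2 p ^+ 2)%:E < +oo)%E by apply: (tame_conv_sq_lty (tk' n)).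
(* The horizontal scale is chosen for the functions already mollified vertically,
   in particular for the vertical derivatives [G1] and [G2]. *)
have [m [m1 mW1' mW2' mW3' [mG1' mG2']]] : exists m : nat, [/\ m.+1%:R^-1 <= rho,
    (\int[leb2 R]_p ((convx (kern_seq m) W1 p - W1 p) ^+ 2)%:E <= e1%:E)%E,
    (\int[leb2 R]_p ((convx (kern_seq m) W2 p - W2 p) ^+ 2)%:E <= e1%:E)%E,
    (\int[leb2 R]_p ((convx (kern_seq m) W3 p - W3 p) ^+ 2)%:E <= e1%:E)%E &
    (\int[leb2 R]_p ((convx (kern_seq m) G1 p - G1 p) ^+ 2)%:E <= e1%:E)%E /\
    (\int[leb2 R]_p ((convx (kern_seq m) G2 p - G2 p) ^+ 2)%:E <= e1%:E)%E].
  have N1 := ereal_cvg0_le e10 (convx_L2_cvg ak mW1 sW1).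
  have N2 := ereal_cvg0_le e10 (convx_L2_cvg ak mW2 sW2).
  have N3 := ereal_cvg0_le e10 (convx_L2_cvg ak mW3 sW3).
  have N4 := ereal_cvg0_le e10 (convx_L2_cvg ak mG1 sG1).
  have N5 := ereal_cvg0_le e10 (convx_L2_cvg ak mG2 sG2).
  have [m [h0 [h1 [h2 [h3 [h4 h5]]]]]] :=
    filter_ex (filterI small (filterI N1 (filterI N2 (filterI N3 (filterI N4 N5))))).
  by exists m; split; [exact: h0|exact: h1|exact: h2|exact: h3|split; [exact: h4|exact: h5]].
set km : R -> R := kern_seq m; set km' := derive1 km.
have mkm : measurable_fun setT km := tame_measurable (tk m).
have cW1 : pconv km kn u0 = convx km W1 by apply: pconvE; [exact: tk|exact: tk|].
have cW2 : pconv km kn ux0 = convx km W2 by apply: pconvE; [exact: tk|exact: tk|].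
have cW3 : pconv km kn uy0 = convx km W3 by apply: pconvE; [exact: tk|exact: tk|].
have cG1 : pconv km kn' u0 = convx km G1 by apply: pconvE; [exact: tk|exact: tk'|].
have cG2 : pconv km kn' fu = convx km G2 by apply: pconvE; [exact: tk|exact: tk'|].
have dkm : forall x : R, is_derive x 1 km (km' x) := smooth_is_derive (smooth_kern _ 1).
have dkn : forall x : R, is_derive x 1 kn (kn' x) := smooth_is_derive (smooth_kern _ 1).
have mv : measurable_fun [set: plane R] (pconv km kn u0) by rewrite cW1; exact: (measurable_convx mkm mW1).
have mvx : measurable_fun [set: plane R] (pconv km' kn u0).
  rewrite pconvE; [|exact: tk'|exact: tk|by []].
  exact: (measurable_convx (tame_measurable (tk' m)) mW1).
have mvy : measurable_fun [set: plane R] (pconv km kn' u0) by rewrite cG1; exact: (measurable_convx mkm mG1).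
exists (pconv km kn u0), (pconv km' kn u0), (pconv km kn' u0); split.
- split.
  + exact: (pconv_continuous (tk m) (tk n) Iu0).
  + exact: (pconv_continuous (tk' m) (tk n) Iu0).
  + exact: (pconv_continuous (tk m) (tk' n) Iu0).
- by split; [exact: mv|exact: mvx|exact: mvy].
- split => p.
  + exact: (pconv_is_derivex p (tk m) (tk' m) (tk n) dkm Iu0).
  + exact: (pconv_is_derivey p (tk m) (tk n) (tk' n) dkn Iu0).
pose c i : R := nth 0 [:: 2; 2; 2; 2; 4 * F ^+ 2; 4; 4; 4] i.
pose G (i : nat) : plane R -> R := nth (fun=> 0) [:: (fun p => convx km W1 p - W1 p);
  (fun p => W1 p - u0 p); (fun p => convx km W2 p - W2 p); (fun p => W2 p - ux0 p);
  (fun p => convx km G1 p - G1 p); (fun p => convx km G2 p - G2 p);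
  (fun p => convx km W3 p - W3 p); (fun p => W3 p - uy0 p)] i.
have c0 i : 0 <= c i.
  have F2 : 0 <= 4 * F ^+ 2 by rewrite mulr_ge0// sqr_ge0.
  by rewrite /c; case: i => [|[|[|[|[|[|[|[|i]]]]]]]]//=; rewrite nth_nil.
have mG i : measurable_fun setT (G i).
  have mcB (W : plane R -> R) : measurable_fun setT W ->
      measurable_fun setT (fun p => convx km W p - W p).
    by move=> mW; exact: (measurable_funB (measurable_convx mkm mW) mW).
  rewrite /G; case: i => [|[|[|[|[|[|[|[|i]]]]]]]]/=.
  - exact: (mcB _ mW1).
  - exact: (measurable_funB mW1 mu0).
  - exact: (mcB _ mW2).
  - exact: (measurable_funB mW2 mux0).
  - exact: (mcB _ mG1).
  - exact: (mcB _ mG2).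
  - exact: (mcB _ mW3).
  - exact: (measurable_funB mW3 muy0).
  - by rewrite nth_nil; exact: measurable_cst.
have Ge i : (i < 8)%N -> (\int[leb2 R]_p (G i p ^+ 2)%:E <= e1%:E)%E.
  rewrite /G; case: i => [|[|[|[|[|[|[|[|i]]]]]]]]/= i8.
  - exact: mW1'.
  - exact: nu.
  - exact: mW2'.
  - exact: nux.
  - exact: mG1'.
  - exact: mG2'.
  - exact: mW3'.
  - exact: nuy.
  - by [].
have mQ := measurable_rect (x0 - rho) (x0 + rho) (y0 - rho) (y0 + rho).
set Q := rect _ _ _ _ in mQ *.
have key p : Q p -> approx_error f u0 ux0 uy0 (pconv km kn u0) (pconv km' kn u0) (pconv km kn' u0) p
    <= \sum_(i < 8) c i * G i p ^+ 2.
  rewrite /Q /rect /= !in_itv /= => -[/andP[p1 p2] /andP[p3 p4]].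
  have box' (q : R * R) : `|p.1 - q.1| <= m.+1%:R^-1 -> `|p.2 - q.2| <= n.+1%:R^-1 -> Omega q.
    move=> /le_trans /(_ m1) q1 /le_trans /(_ n1) q2.
    by apply: boxO; [exact: (interval_dist p1 p2 q1)|exact: (interval_dist p3 p4 q2)].
  have Op : Omega p by apply: box'; rewrite subrr normr0 ltW.
  have [pL _] := OL p Op.
  have E1 := @weak_pconv_x R f Omega u ux uy Wu _ _ p (r0 m) (r0 n) box' L OL.
  have E2 := @weak_pconv_y R f Omega u ux uy Wu _ _ p (r0 m) (r0 n) box' fu fuE Ifu.
  rewrite /approx_error E1 -/u0 -/ux0 -/uy0 -/km -/kn cW1 cW2 cG1.
  (* The weak derivative: mollifying [f u] with the derived kernel is mollifying [uy]. *)
  have E3 : convx km G2 p = convx km W3 p by rewrite -cG2 -cW3.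
  have E4 : G2 p = fL p.1 * G1 p by exact: (convy_scale fL p mkn' mu0).
  rewrite !big_ord_recr big_ord0 /= add0r /c /G /=.
  rewrite E3 E4 -(fLE _ pL).
  have : fL p.1 ^+ 2 <= F ^+ 2.
    by rewrite -[fL _ ^+ 2]real_normK ?num_real// ler_pXn2r// nnegrE.
  exact: approx_error_le.
apply: (@le_trans _ _ (\int[leb2 R]_p (\sum_(i < 8) c i * G i p ^+ 2)%:E)%E).
  have ms : measurable_fun [set: plane R] (fun p => (\sum_(i < 8) c i * G i p ^+ 2)%:E).
    apply/measurable_EFinP; apply: measurable_sum => i.
    by apply: measurable_funM => //; exact: measurable_funX.
  apply: (@le_trans _ _ (\int[leb2 R]_(p in Q) (\sum_(i < 8) c i * G i p ^+ 2)%:E)%E).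
    apply: ge0_le_integral => //.
    - by move=> p _; rewrite lee_fin !addr_ge0// sqr_ge0.
    - apply/measurable_EFinP; apply: measurable_funTS.
      apply: measurable_funD; first apply: measurable_funD.
      + exact: (measurable_funX 2%N (measurable_funB mv mu0)).
      + exact: (measurable_funX 2%N (measurable_funB mvx mux0)).
      + have mf1 : measurable_fun [set: plane R] (fun p : plane R => f p.1).
          by apply: (measurableT_comp (continuous_measurable_fun cf)); exact: measurable_fst.
        exact: (measurable_funX 2%N (measurable_funB (measurable_funM mf1 mvy) muy0)).
    - exact: measurable_funTS.
  apply: ge0_subset_integral => //.
  by move=> p _; rewrite lee_fin sumr_ge0// => i _; rewrite mulr_ge0// sqr_ge0.
apply: le_trans (integral_sq_sum_le c0 mG Ge) _.
rewrite lee_fin !big_ord_recr big_ord0 /= add0r /c /= /e1.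
rewrite le_eqVlt; apply/orP; left; apply/eqP; field.
by rewrite gt_eqF.
Qed.
End smooth_approximation.

(** * Borel sets of the plane *)

Section plane_borel.
Context {R : realType}.

(** An open set is the union of the countably many rectangles with rational centers and
radii [1/(n+1)] that it contains; hence the Borel sets of the product topology
belong to the product sigma-algebra. *)
Lemma open_plane_measurable (U : set (R * R)) : open U -> measurable (U : set (plane R)).
Proof.
move=> oU.
pose B (i : rat * rat * nat) : set (plane R) := rect
  (ratr i.1.1 - i.2.+1%:R^-1) (ratr i.1.1 + i.2.+1%:R^-1)
  (ratr i.1.2 - i.2.+1%:R^-1) (ratr i.1.2 + i.2.+1%:R^-1).
have -> : U = \bigcup_(i in [set: rat * rat * nat]) (if `[< B i `<=` U >] then B i else set0).
  apply/seteqP; split => [p Up|p [i _]]; last first.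
    by case: asboolP => [BU|_] //; exact: BU.
  have [e e0 eU] : exists2 e : R, 0 < e & forall q : R * R, `|p.1 - q.1| < e -> `|p.2 - q.2| < e -> U q.
    move: (open_nbhs_nbhs (conj oU Up)) => /nbhs_ballP[e e0 eU]; exists e => // q h1 h2.
    by apply: eU; split.
  have [n ne] : exists n : nat, n.+1%:R^-1 < e / 2.
    have e20 : 0 < e / 2 by rewrite divr_gt0.
    have /cvgrPdist_lt /(_ _ e20)/filter_ex[n] := @cvg_harmonic R.
    by rewrite sub0r normrN ger0_norm ?invr_ge0//; exists n.
  have [z zE] : exists z : R, z = n.+1%:R^-1 by exists n.+1%:R^-1.
  (* [z] stands for [1/(n+1)], so that linear arithmetic treats it as an atom. *)
  have rn : 0 < z by rewrite zE invr_gt0.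
  rewrite -zE in ne.
  have near_rat (x : R) : exists q : rat, `|x - ratr q| < z.
    have : x - z < x + z by lra.
    move=> /rat_in_itvoo[q]; rewrite in_itv/= => /andP[? ?]; exists q.
    by rewrite ltr_norml; apply/andP; split; lra.
  have [q1 hq1] := near_rat p.1; have [q2 hq2] := near_rat p.2.
  exists (q1, q2, n) => //; rewrite ifT; last first.
    apply/asboolP => q; rewrite /B /rect /= -zE !in_itv/= => -[/andP[? ?] /andP[? ?]].
    by move: hq1 hq2; rewrite !ltr_norml => /andP[? ?] /andP[? ?]; apply: eU; rewrite ltr_norml;
      apply/andP; split; lra.
  rewrite /B /rect /= -zE !in_itv/=.
  by move: hq1 hq2; rewrite !ltr_norml => /andP[? ?] /andP[? ?]; split; apply/andP; split; lra.
apply: countable_bigcupT_measurable => // i.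
by case: ifP => // _; exact: measurable_rect.
Qed.

Lemma continuous_plane_measurable (g : R * R -> R) : continuous g ->
  measurable_fun [set: plane R] g.
Proof.
move=> cg mD; apply: (measurability _ (RGenOInfty.measurableE R)) => //.
move=> _ [_ [x ->] <-]; rewrite setTI.
apply: open_plane_measurable; apply: open_comp => // p _; exact: cg.
Qed.
End plane_borel.

(** * The truncation *)

Section truncation.
Context {R : realType}.
Implicit Types (t M : R).

(** The derivative of [expi], in the form given by [is_derive_expinv]. *)
Definition dexpi t : R := expinv ('X^2 * (1 - 1^`())%R) t.

Lemma is_derive_expi t : is_derive t 1 (@expi R) (dexpi t).
Proof. exact: is_derive_expinv. Qed.

Lemma dexpiE t : 0 < t -> dexpi t = t^-1 ^+ 2 * expR (- t^-1).
Proof.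
by move=> t0; rewrite /dexpi /expinv t0 derivC subr0 mulr1 hornerXn.
Qed.

Lemma dexpi_npos t : t <= 0 -> dexpi t = 0.
Proof. by rewrite /dexpi /expinv leNgt => /negbTE ->. Qed.

Lemma dexpi_ge0 t : 0 <= dexpi t.
Proof.
have [t0|t0] := ltP 0 t; last by rewrite dexpi_npos.
by rewrite dexpiE// mulr_ge0 ?expR_ge0// sqr_ge0.
Qed.

Lemma dexpi_le2 t : dexpi t <= 2.
Proof.
have [t0|t0] := ltP 0 t; last by rewrite dexpi_npos.
rewrite dexpiE// expRN ler_pdivrMr ?expR_gt0//.
have t1 : 0 <= t^-1 by rewrite invr_ge0 ltW.
have := expR_ge1Dxn 1 t1; rewrite (_ : 2`!%:R = 2 :> R)// => H.
by lra.
Qed.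

Lemma dexpi_continuous : continuous dexpi.
Proof. exact: (is_derive_continuous (@is_derive_expinv R _)). Qed.

(** Odd, with values in [[-1, 1]], and zero exactly on [[-M, M]]. *)
Definition cut M t : R := expi (t - M) - expi (- t - M).
Definition dcut M t : R := dexpi (t - M) + dexpi (- t - M).

Lemma is_derive_cut M t : is_derive t 1 (cut M) (dcut M t).
Proof.
have d1 : is_derive t 1 (fun t => t - M) 1.
  by rewrite -[X in is_derive _ _ _ X](subr0 (1 : R)); exact: (is_deriveB (is_derive_id t 1) (is_derive_cst M t 1)).
have d2 : is_derive t 1 (fun t => - t - M) (-1).
  rewrite -[X in is_derive _ _ _ X](subr0 (-1 : R)).
  exact: (is_deriveB (is_deriveN (is_derive_id t 1)) (is_derive_cst M t 1)).
have e1 := is_derive1_comp (is_derive_expi _) d1.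
have e2 := is_derive1_comp (is_derive_expi _) d2.
apply: (is_derive_eq (is_deriveB e1 e2)).
by rewrite /dcut mulr1 mulrN1 opprK.
Qed.

Lemma cut_norm_le1 M t : `|cut M t| <= 1.
Proof.
rewrite /cut ler_norml; have := expi_ge0 (t - M); have := expi_le1 (t - M).
have := expi_ge0 (- t - M); have := expi_le1 (- t - M).
by move=> ? ? ? ?; apply/andP; split; lra.
Qed.

Lemma cut_eq0 M t : `|t| <= M -> cut M t = 0.
Proof.
rewrite ler_norml => /andP[? ?]; rewrite /cut !expi_npos ?subrr//; lra.
Qed.

Lemma expi_gt0 t : 0 < t -> 0 < expi t.
Proof. by move=> t0; rewrite /expi /expinv t0 hornerC mul1r expR_gt0. Qed.

Lemma cut_eq0_le M t : 0 <= M -> cut M t = 0 -> `|t| <= M.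
Proof.
move=> M0; rewrite /cut => tM; rewrite leNgt; apply/negP; rewrite ltr_normr => /orP[h|h].
  have : 0 < expi (t - M) by apply: expi_gt0; lra.
  by have := @expi_npos R (- t - M); move: tM => /subr0_eq ->; move=> -> ; lra.
have : 0 < expi (- t - M) by apply: expi_gt0; lra.
by have := @expi_npos R (t - M); move: tM => /subr0_eq <-; move=> -> ; lra.
Qed.

Lemma dcut_ge0 M t : 0 <= dcut M t.
Proof. by rewrite addr_ge0// dexpi_ge0. Qed.

Lemma dcut_le M t : dcut M t <= 4.
Proof. by have := dexpi_le2 (t - M); have := dexpi_le2 (- t - M); rewrite /dcut; lra. Qed.

Lemma cut_continuous M : continuous (cut M).
Proof. exact: (is_derive_continuous (is_derive_cut M)). Qed.

Lemma dcut_continuous M : continuous (dcut M).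
Proof.
move=> t; rewrite /dcut.
have c1 : {for t, continuous (fun t : R => dexpi (t - M))}.
  apply: (@continuous_comp _ _ _ (fun t : R => t - M)); last exact: dexpi_continuous.
  by apply: (@cvgB _ R^o); [exact: cvg_id|exact: cvg_cst].
have c2 : {for t, continuous (fun t : R => dexpi (- t - M))}.
  apply: (@continuous_comp _ _ _ (fun t : R => - t - M)); last exact: dexpi_continuous.
  by apply: (@cvgB _ R^o); [apply: (@cvgN _ R^o); exact: cvg_id|exact: cvg_cst].
exact: (continuousD c1 c2).
Qed.

Lemma measurable_cut M (w : plane R -> R) : measurable_fun setT w ->
  measurable_fun setT (fun p => cut M (w p)).
Proof.
by apply: measurableT_comp; apply: continuous_measurable_fun; exact: cut_continuous.
Qed.

Lemma measurable_dcut M (w : plane R -> R) : measurable_fun setT w ->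
  measurable_fun setT (fun p => dcut M (w p)).
Proof.
by apply: measurableT_comp; apply: continuous_measurable_fun; exact: dcut_continuous.
Qed.

End truncation.

(** * Functions supported on a rectangle *)

Section rectangle.
Context {R : realType}.
Notation mu := (@lebesgue_measure R).
Implicit Types (g G : R * R -> R) (Omega : set (R * R)).

Lemma rect_bounded g (a b c d : R) : a <= b -> c <= d -> continuous g ->
  exists2 B : R, 0 <= B & forall p, rect a b c d p -> `|g p| <= B.
Proof.
move=> ab cd cg.
have Q0 : (rect a b c d : set (R * R)) !=set0.
  by exists (a, c); rewrite /rect /= !in_itv/= !lexx ab cd.
have cng : continuous (fun p => `|g p|).
  by move=> p; apply: continuous_comp; [exact: cg|exact: norm_continuous].
have [p _ H] := compact_EVT_max Q0 (@rect_compact R a b c d) (continuous_subspaceT cng).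
by exists `|g p| => // q Qq; apply: H; rewrite inE.
Qed.

Lemma in_Lp2_intro Omega g : measurable_fun [set: plane R] (g \_ Omega) ->
  (\int[leb2 R]_p ((g \_ Omega) p ^+ 2)%:E < +oo)%E -> in_Lp Omega 2%:E g.
Proof.
move=> mg ig; rewrite /in_Lp inE; apply/andP; split; rewrite inE //=.
rewrite /finite_norm unlock /=; apply: poweR_lty.
rewrite (_ : (\int[leb2 R]_x _)%E = (\int[leb2 R]_p ((g \_ Omega) p ^+ 2)%:E)%E)//.
by apply: eq_integral => p _; rewrite /= powR_mulrn// real_normK ?num_real.
Qed.

Lemma rect_bounded_integrable g (a b c d B : R) :
  measurable_fun [set: plane R] g -> (forall p, `|g p| <= B) ->
  (forall p, ~ rect a b c d p -> g p = 0) ->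
  (leb2 R).-integrable setT (EFin \o g).
Proof.
move=> mg gB g0; have mQ := measurable_rect a b c d.
apply: (@le_integrable_EFin _ (plane R) R (leb2 R) setT _
  (fun p => B * \1_(rect a b c d) p)) => //.
  move=> p _; rewrite indicE; have [Qp|nQ] := pselect (rect a b c d p).
    by rewrite mem_set// mulr1.
  by rewrite g0// normr0 memNset// mulr0.
apply: integrableZ_EFin => //; apply: ge0_integrable_EFin => //.
by rewrite integral_indic// setIT; exact: leb2_rect_lty.
Qed.

Lemma measurable_patch_rect g (a b c d : R) : measurable_fun [set: plane R] g ->
  measurable_fun [set: plane R] (g \_ (rect a b c d)).
Proof.
move=> mg; apply/(measurable_restrictT _ (measurable_rect a b c d)).
exact: measurable_funTS.
Qed.

Lemma patch_rect_integrable g (a b c d : R) : a <= b -> c <= d -> continuous g ->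
  (leb2 R).-integrable setT (EFin \o (g \_ (rect a b c d))).
Proof.
move=> ab cd cg; have [B B0 gB] := rect_bounded ab cd cg.
apply: (@rect_bounded_integrable _ a b c d B).
- by apply: measurable_patch_rect; exact: continuous_plane_measurable.
- by move=> p; rewrite /patch; case: ifPn => [|_]; [rewrite inE => /gB|rewrite normr0].
- by move=> p; rewrite /patch => nQ; case: ifPn => //; rewrite inE.
Qed.

Lemma integral_derive_zero (F F' : R -> R) (a b : R) : a < b -> continuous F' ->
  (forall x : R, is_derive x 1 F (F' x)) -> F a = 0 -> F b = 0 ->
  (\int[mu]_(x in `[a, b]) (F' x)%:E = 0)%E.
Proof.
move=> ab cF' dF Fa Fb.
have cF := is_derive_continuous dF.
rewrite (continuous_FTC2 ab (continuous_subspaceT cF') (F := F)).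
- by rewrite Fa Fb subee.
- split; first by move=> x _; case: (dF x).
  + exact: (cvg_at_right_filter (cF a)).
  + exact: (cvg_at_left_filter (cF b)).
- by move=> x _; rewrite derive1E; exact: (@derive_val _ _ _ _ _ _ _ (dF x)).
Qed.

Lemma section_x_continuous g (y : R) : continuous g -> continuous (fun x => g (x, y)).
Proof.
move=> cg x; apply: (@continuous_comp _ _ _ (fun x => (x, y)) g); last exact: cg.
exact: (cvg_pair cvg_id (cvg_cst y)).
Qed.

Lemma section_y_continuous g (x : R) : continuous g -> continuous (fun y => g (x, y)).
Proof.
move=> cg y; apply: (@continuous_comp _ _ _ (fun y => (x, y)) g); last exact: cg.
exact: (cvg_pair (cvg_cst x) cvg_id).
Qed.

(** Fubini and the fundamental theorem of calculus on each horizontal line; with [G] a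
product that vanishes on the vertical edges it is integration by parts. *)
Lemma integral_rect_dx G Gx (a b c d : R) : a < b -> c <= d -> continuous Gx ->
  (forall p : R * R, is_derive p.1 1 (fun x => G (x, p.2)) (Gx p)) ->
  (forall y, c <= y <= d -> G (a, y) = 0 /\ G (b, y) = 0) ->
  \int[leb2 R]_p (Gx \_ (rect a b c d)) p = 0.
Proof.
move=> ab cd cG dG G0.
have I := patch_rect_integrable (ltW ab) cd cG.
rewrite /Rintegral -(integral21_prod_meas1 I) /fubini_G.
rewrite (_ : (fun y => _) = fun=> 0%E) ?integral0//.
apply/funext => y.
have [cyd|cyd] := boolP (c <= y <= d); last first.
  rewrite (_ : (fun x => _) = fun=> 0%E) ?integral0//; apply/funext => x /=.
  rewrite /patch ifF//; apply/negP; rewrite inE /rect /= !in_itv/= => -[_].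
  exact/negP.
have [Ga Gb] := G0 y cyd.
have Z := @integral_derive_zero (fun x => G (x, y)) (fun x => Gx (x, y)) a b ab
  (section_x_continuous (y := y) cG) (fun x => dG (x, y)) Ga Gb.
rewrite -[RHS]Z [RHS]integral_mkcond; apply: eq_integral => x _ /=.
rewrite /patch.
have -> : ((x, y) \in rect a b c d) = (x \in `[a, b]%classic).
  by apply/idP/idP; rewrite !inE /rect /= !in_itv/= cyd => // -[].
by case: ifP.
Qed.

Lemma integral_rect_dy G Gy (a b c d : R) : a <= b -> c < d -> continuous Gy ->
  (forall p : R * R, is_derive p.2 1 (fun y => G (p.1, y)) (Gy p)) ->
  (forall x, a <= x <= b -> G (x, c) = 0 /\ G (x, d) = 0) ->
  \int[leb2 R]_p (Gy \_ (rect a b c d)) p = 0.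
Proof.
move=> ab cd cG dG G0.
have I := patch_rect_integrable ab (ltW cd) cG.
rewrite /Rintegral -(integral12_prod_meas1 I) /fubini_F.
rewrite (_ : (fun x => _) = fun=> 0%E) ?integral0//.
apply/funext => x.
have [axb|axb] := boolP (a <= x <= b); last first.
  rewrite (_ : (fun y => _) = fun=> 0%E) ?integral0//; apply/funext => y /=.
  rewrite /patch ifF//; apply/negP; rewrite inE /rect /= !in_itv/= => -[+ _].
  exact/negP.
have [Ga Gb] := G0 x axb.
have Z := @integral_derive_zero (fun y => G (x, y)) (fun y => Gy (x, y)) c d cd
  (section_y_continuous (x := x) cG) (fun y => dG (x, y)) Ga Gb.
rewrite -[RHS]Z [RHS]integral_mkcond; apply: eq_integral => y _ /=.
rewrite /patch.
have -> : ((x, y) \in rect a b c d) = (y \in `[c, d]%classic).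
  by apply/idP/idP; rewrite !inE /rect /= !in_itv/= axb => // -[].
by case: ifP.
Qed.

End rectangle.

(** * The truncated test function *)

Section clamp.
Context {R : realType}.
Implicit Types (a b x y : R).

Definition clamp a b x : R := Num.max a (Num.min x b).

Lemma clamp_itv a b x : a <= b -> a <= clamp a b x <= b.
Proof. by move=> ab; rewrite /clamp le_max lexx /= ge_max ab ge_min lexx orbT. Qed.

Lemma clamp_id a b x : a <= x <= b -> clamp a b x = x.
Proof. by move=> /andP[ax xb]; rewrite /clamp min_l// max_r. Qed.

Lemma clamp_out a b x : a <= b -> ~~ (a <= x <= b) -> clamp a b x = a \/ clamp a b x = b.
Proof.
move=> ab; rewrite negb_and -!ltNge => /orP[xa|bx]; rewrite /clamp.
  by left; rewrite min_l ?max_l// ltW// (lt_le_trans xa).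
by right; rewrite min_r ?max_r// ltW.
Qed.

Lemma clamp_lipschitz a b x y : `|clamp a b x - clamp a b y| <= `|x - y|.
Proof.
wlog xy : x y / x <= y.
  by move=> H; have [/H//|/ltW/H] := leP x y; rewrite distrC (distrC x).
rewrite distrC (distrC x) [leRHS]ger0_norm ?subr_ge0//.
rewrite /clamp !maxEle !minEle ger0_norm.
  by repeat case: ifPn; rewrite -?ltNge => *; lra.
by repeat case: ifPn; rewrite -?ltNge => *; lra.
Qed.
End clamp.

Section cutoff.
Context {R : realType}.
Variables (f : R -> R) (Omega : set (R * R)) (v vx vy : R * R -> R) (a b c d M : R).
Hypothesis cf : continuous f.
Hypothesis cv : continuous v.
Hypothesis cvx : continuous vx.
Hypothesis cvy : continuous vy.
Hypothesis dvx : forall p : R * R, is_derive p.1 1 (fun x => v (x, p.2)) (vx p).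
Hypothesis dvy : forall p : R * R, is_derive p.2 1 (fun y => v (p.1, y)) (vy p).
Hypotheses (ab : a < b) (cd : c < d).
Let Q : set (R * R) := rect a b c d.
Hypothesis QO : Q `<=` Omega.
Hypothesis bndM : forall p : R * R, Q p -> p.1 = a \/ p.1 = b \/ p.2 = c \/ p.2 = d -> `|v p| <= M.

Let Z (p : R * R) : R := cut M (v p).
Let Zx (p : R * R) : R := dcut M (v p) * vx p.
Let Zy (p : R * R) : R := dcut M (v p) * vy p.

Let cfst (g : R -> R) : continuous g -> continuous (fun p : R * R => g p.1).
Proof. by move=> cg p; apply: continuous_comp; [exact: cvg_fst|exact: cg]. Qed.

Let cM (g h : R * R -> R) : continuous g -> continuous h -> continuous (fun p => g p * h p).
Proof. by move=> cg ch p; apply: cvgM; [exact: cg|exact: ch]. Qed.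

Let cD (g h : R * R -> R) : continuous g -> continuous h -> continuous (fun p => g p + h p).
Proof. by move=> cg ch p; apply: cvgD; [exact: cg|exact: ch]. Qed.

Let cZ : continuous Z.
Proof. by move=> p; apply: (@continuous_comp _ _ _ v (cut M)); [exact: cv|exact: cut_continuous]. Qed.

Let cdZ : continuous (fun p => dcut M (v p)).
Proof. by move=> p; apply: (@continuous_comp _ _ _ v (dcut M)); [exact: cv|exact: dcut_continuous]. Qed.

Let cZx : continuous Zx. Proof. exact: cM. Qed.
Let cZy : continuous Zy. Proof. exact: cM. Qed.
Let cfZy : continuous (fun p => f p.1 * Zy p). Proof. by apply: cM => //; exact: cfst. Qed.

Let dZx (p : R * R) : is_derive p.1 1 (fun x => Z (x, p.2)) (Zx p).
Proof.
case: p => x y.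
exact: (@is_derive1_comp _ (cut M) (fun x => v (x, y)) x _ _ (is_derive_cut M _) (dvx (x, y))).
Qed.

Let dZy (p : R * R) : is_derive p.2 1 (fun y => Z (p.1, y)) (Zy p).
Proof.
case: p => x y.
exact: (@is_derive1_comp _ (cut M) (fun y => v (x, y)) y _ _ (is_derive_cut M _) (dvy (x, y))).
Qed.

Let Zbnd (p : R * R) : Q p -> p.1 = a \/ p.1 = b \/ p.2 = c \/ p.2 = d -> Z p = 0.
Proof. by move=> Qp bp; apply: cut_eq0; exact: bndM. Qed.

Let cl (p : R * R) : R * R := (clamp a b p.1, clamp c d p.2).

Let Qcl p : Q (cl p).
Proof. by rewrite /Q /rect /= !in_itv/= !clamp_itv// ltW. Qed.

Let QE p : Q p = ((a <= p.1 <= b) && (c <= p.2 <= d)) :> Prop.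
Proof.
rewrite /Q /rect /= !in_itv/=; apply/propext.
by split => [[-> ->]//|/andP[]].
Qed.

Let patch_clamp p : (Z \_ Q) p = Z (cl p).
Proof.
rewrite /patch; case: ifPn => [|].
  by rewrite inE QE => /andP[p1 p2]; rewrite /cl !clamp_id//; case: p p1 p2.
move=> /negP nQ; rewrite Zbnd//=.
have [p1|p1] := boolP (a <= p.1 <= b).
  have [p2|p2] := boolP (c <= p.2 <= d).
    by exfalso; apply: nQ; rewrite inE QE p1.
  by have [->|->] := clamp_out (ltW cd) p2; tauto.
by have [->|->] := clamp_out (ltW ab) p1; tauto.
Qed.

(** As [Z] vanishes on the boundary of [Q], its extension by zero is [Z] composed with
the projection onto [Q], which is 1-Lipschitz. *)
Lemma cutoff_lipschitz : lipschitz (Z \_ Q).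
Proof.
have [B1 B10 HB1] := rect_bounded (ltW ab) (ltW cd) cZx.
have [B2 B20 HB2] := rect_bounded (ltW ab) (ltW cd) cZy.
have H1 x y y' : a <= x <= b -> c <= y <= d -> c <= y' <= d ->
    `|Z (x, y) - Z (x, y')| <= B2 * `|y - y'|.
  move=> hx; wlog yy : y y' / y' <= y.
    move=> H hy hy'; have [h|/ltW h] := leP y' y; first exact: H.
    by rewrite distrC (distrC y); exact: H.
  move=> hy hy'.
  have [e ey ->] := @MVT_segment R (fun t => Z (x, t)) (fun t => Zy (x, t)) y' y yy
    (fun t _ => dZy (x, t)) (continuous_subspaceT (section_y_continuous (x := x) cZ)).
  rewrite normrM ler_wpM2r// HB2// /rect /= !in_itv/= hx; split=> //.
  by move: ey hy hy'; rewrite in_itv/= => /andP[? ?] /andP[? ?] /andP[? ?]; apply/andP; split; lra.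
have H2 x x' y : a <= x <= b -> a <= x' <= b -> c <= y <= d ->
    `|Z (x, y) - Z (x', y)| <= B1 * `|x - x'|.
  wlog xx : x x' / x' <= x.
    move=> H hx hx' hy; have [h|/ltW h] := leP x' x; first exact: H.
    by rewrite distrC (distrC x); exact: H.
  move=> hx hx' hy.
  have [e ex ->] := @MVT_segment R (fun t => Z (t, y)) (fun t => Zx (t, y)) x' x xx
    (fun t _ => dZx (t, y)) (continuous_subspaceT (section_x_continuous (y := y) cZ)).
  rewrite normrM ler_wpM2r// HB1// /rect /= !in_itv/= hy; split=> //.
  by move: ex hx hx'; rewrite in_itv/= => /andP[? ?] /andP[? ?] /andP[? ?]; apply/andP; split; lra.
have PF : ProperFilter (globally ([set: R * R] `*` [set: R * R])).
  by apply: (@globally_properfilter _ _ ((a, c), (a, c))).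
apply: (@klipschitzW R (R * R)%type R (B1 + B2) _ _ PF) => -[p q] _ /=.
rewrite !patch_clamp.
have -> : Z (cl p) - Z (cl q) =
  (Z (clamp a b p.1, clamp c d p.2) - Z (clamp a b q.1, clamp c d p.2)) +
  (Z (clamp a b q.1, clamp c d p.2) - Z (clamp a b q.1, clamp c d q.2)).
  by rewrite /cl addrA subrK.
apply: le_trans (ler_normD _ _) _; rewrite mulrDl; apply: lerD.
  apply: le_trans (H2 _ _ _ (clamp_itv _ (ltW ab)) (clamp_itv _ (ltW ab)) (clamp_itv _ (ltW cd))) _.
  rewrite ler_wpM2l// (le_trans (clamp_lipschitz _ _ _ _))//.
  by rewrite prod_normE le_max lexx.
apply: le_trans (H1 _ _ _ (clamp_itv _ (ltW ab)) (clamp_itv _ (ltW cd)) (clamp_itv _ (ltW cd))) _.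
rewrite ler_wpM2l// (le_trans (clamp_lipschitz _ _ _ _))//.
by rewrite prod_normE le_max lexx orbT.
Qed.

Lemma cutoff_supported : compactly_supported_in Omega (Z \_ Q).
Proof.
have cK : compact Q by exact: rect_compact.
have clK : closed Q by apply: compact_closed => //; exact: Rhausdorff2.
have hK : [set p | (Z \_ Q) p != 0] `<=` Q.
  by move=> p /=; rewrite /patch; case: ifPn; rewrite ?eqxx// inE.
have hcl : closure [set p | (Z \_ Q) p != 0] `<=` Q.
  by move=> q /(closure_subset hK); rewrite -(closure_id Q).1.
split; first exact: (subclosed_compact (@closed_closure _ _) cK hcl).
exact: subset_trans hcl QO.
Qed.

Let patch_sub (g : R * R -> R) : (g \_ Q) \_ Omega = g \_ Q.
Proof.
apply/funext => p; rewrite /patch; case: ifPn => // nO; case: ifPn => //.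
by rewrite inE => /QO Op; move: nO; rewrite notin_setE.
Qed.

Lemma patch_rect_Lp2 (g : R * R -> R) : continuous g -> in_Lp Omega 2%:E (g \_ Q).
Proof.
move=> cg; apply: in_Lp2_intro; rewrite patch_sub.
  by apply: measurable_patch_rect; exact: continuous_plane_measurable.
have cg2 : continuous (fun p => g p * g p) by exact: cM.
have I := patch_rect_integrable (ltW ab) (ltW cd) cg2.
have := integrable_EFin_lty measurableT I.
congr (_ < _)%E; apply: eq_integral => p _; rewrite /patch; case: ifP => // _.
by rewrite expr0n.
Qed.

Lemma Rintegral_patch_sub (g h : R * R -> R) :
  \int[leb2 R]_(p in Omega) ((g \_ Q) p * h p) = \int[leb2 R]_p ((fun p => g p * h p) \_ Q) p.
Proof.
rewrite (Rintegral_patch_mulr Omega (g \_ Q) h) patch_sub.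
congr Rintegral; apply/funext => p.
by rewrite /patch; case: ifP => // _; rewrite mul0r.
Qed.

(** No boundary terms: [Z] vanishes on the edges of [Q]. *)
Lemma cutoff_Wf12 : Wf12 f Omega (Z \_ Q) (Zx \_ Q) ((fun p => f p.1 * Zy p) \_ Q).
Proof.
split; [exact: patch_rect_Lp2|exact: patch_rect_Lp2|exact: patch_rect_Lp2|].
move=> h [sh _].
have [ch [dhx dhy [cdx _] [cdy _]]] := sh 1%N.
have dhx' (p : R * R) : is_derive p.1 1 (fun x => h (x, p.2)) (dx h p).
  by apply: DeriveDef; [exact/derivable_dirx|rewrite dxE derive1E].
have dhy' (p : R * R) : is_derive p.2 1 (fun y => h (p.1, y)) (dy h p).
  by apply: DeriveDef; [exact/derivable_diry|rewrite dyE derive1E].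
have add0 (g1 g2 : R * R -> R) : continuous g1 -> continuous g2 ->
    \int[leb2 R]_p ((fun p => g1 p + g2 p) \_ Q) p = 0 ->
    \int[leb2 R]_p (g1 \_ Q) p = - (\int[leb2 R]_p (g2 \_ Q) p).
  move=> c1 c2; rewrite (_ : ((fun p => g1 p + g2 p) \_ Q) = (fun p => (g1 \_ Q) p + (g2 \_ Q) p)).
    rewrite RintegralD//; [|exact: (patch_rect_integrable (ltW ab) (ltW cd) c1)
      |exact: (patch_rect_integrable (ltW ab) (ltW cd) c2)].
    by move/eqP; rewrite addr_eq0 => /eqP.
  by apply/funext => p; rewrite /patch; case: ifP => // _; rewrite addr0.
have Qac y : c <= y <= d -> Q (a, y) by rewrite QE /= lexx (ltW ab).
have Qbc y : c <= y <= d -> Q (b, y) by rewrite QE /= lexx (ltW ab) => ->.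
have Qxc x : a <= x <= b -> Q (x, c) by rewrite QE /= lexx (ltW cd) => ->.
have Qxd x : a <= x <= b -> Q (x, d) by rewrite QE /= lexx (ltW cd) => ->.
split.
  rewrite !Rintegral_patch_sub; apply: add0; [exact: cM|exact: cM|].
  apply: (@integral_rect_dx _ (fun p => Z p * h p) _ a b c d ab (ltW cd)).
  - by apply: cD; exact: cM.
  - move=> [x y]; exact: (is_derive_mulr (dZx (x, y)) (dhx' (x, y))).
  - move=> y hy; rewrite !Zbnd/= ?mul0r//; try exact: Qac; try exact: Qbc; tauto.
have -> : \int[leb2 R]_(p in Omega) ((Z \_ Q) p * (f p.1 * dy h p)) =
    \int[leb2 R]_p ((fun p => f p.1 * (Z p * dy h p)) \_ Q) p.
  rewrite Rintegral_patch_sub; congr Rintegral; congr (_ \_ _).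
  by apply/funext => p; rewrite mulrCA.
have -> : \int[leb2 R]_(p in Omega) (((fun p => f p.1 * Zy p) \_ Q) p * h p) =
    \int[leb2 R]_p ((fun p => f p.1 * (Zy p * h p)) \_ Q) p.
  rewrite Rintegral_patch_sub; congr Rintegral; congr (_ \_ _).
  by apply/funext => p; rewrite mulrA.
apply: add0; [by apply: cM; [exact: cfst|exact: cM]|by apply: cM; [exact: cfst|exact: cM]|].
apply: (@integral_rect_dy _ (fun p => f p.1 * (Z p * h p)) _ a b c d (ltW ab) cd).
- by apply: cD; apply: cM; try exact: cfst; exact: cM.
- move=> [x y].
  have := is_derive_mulr (is_derive_cst (f x) y 1) (is_derive_mulr (dZy (x, y)) (dhy' (x, y))).
  by rewrite mul0r addr0 mulrDr.
- move=> x hx; rewrite !Zbnd/= ?mul0r ?mulr0//; try exact: Qxc; try exact: Qxd; tauto.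
Qed.

(** The function is itself Lipschitz with compact support, so it approximates itself. *)
Lemma cutoff_Wf12_0 : Wf12_0 f Omega (Z \_ Q) (Zx \_ Q) ((fun p => f p.1 * Zy p) \_ Q).
Proof.
split; first exact: cutoff_Wf12.
move=> e e0; exists (Z \_ Q), (Zx \_ Q), ((fun p => f p.1 * Zy p) \_ Q).
split; [exact: cutoff_lipschitz|exact: cutoff_supported|exact: cutoff_Wf12|].
rewrite /Wf12_norm (@eq_Rintegral _ _ _ (leb2 R) Omega (fun=> 0)).
  by rewrite /Rintegral integral0 sqrtr0.
by move=> p _ /=; rewrite !subrr expr0n /= !addr0.
Qed.

End cutoff.

(** * One-dimensional bounds and good lines *)

Section lines.
Context {R : realType}.
Notation mu := (@lebesgue_measure R).

Lemma continuous_itv_integrable (g : R -> R) (a b : R) : continuous g ->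
  mu.-integrable `[a, b] (EFin \o g).
Proof.
move=> cg; apply: continuous_compact_integrable; first exact: segment_compact.
exact: continuous_subspaceT.
Qed.

Lemma increment_le_integral (g g' : R -> R) (a b s t : R) :
  (forall x : R, is_derive x 1 g (g' x)) -> continuous g' ->
  a <= s <= b -> a <= t <= b ->
  `|g t - g s| <= \int[mu]_(x in `[a, b]) `|g' x|.
Proof.
move=> dg cg'; wlog st : s t / s <= t.
  move=> H hs ht; have [h|/ltW h] := leP s t; first exact: H.
  by rewrite distrC; exact: H.
move=> /andP[as_ _] /andP[_ tb].
have cn : continuous (fun x => `|g' x|).
  by move=> x; apply: continuous_comp; [exact: cg'|exact: norm_continuous].
have I1 := @continuous_itv_integrable _ s t cg'.
have I2 := @continuous_itv_integrable _ s t cn.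
have I3 := @continuous_itv_integrable _ a b cn.
have mst : measurable (`[s, t]%classic : set (measurableTypeR R)) by exact: measurable_itv.
have mab : measurable (`[a, b]%classic : set (measurableTypeR R)) by exact: measurable_itv.
have cg := is_derive_continuous dg.
have -> : g t - g s = \int[mu]_(x in `[s, t]) g' x.
  move: st; rewrite le_eqVlt => /orP[/eqP <-|st].
    by rewrite subrr set_itv1 Rintegral_set1.
  rewrite /Rintegral (continuous_FTC2 st (continuous_subspaceT cg') (F := g))//.
  - split; first by move=> x _; case: (dg x).
    + exact: (cvg_at_right_filter (cg s)).
    + exact: (cvg_at_left_filter (cg t)).
  - by move=> x _; rewrite derive1E; exact: (@derive_val _ _ _ _ _ _ _ (dg x)).
apply: le_trans; first exact: le_normr_Rintegral.
rewrite -lee_fin !EFin_Rintegral//.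
apply: ge0_subset_integral => //.
- by apply/measurable_EFinP; apply: measurable_funTS; exact: continuous_measurable_fun.
- by apply: subset_itv; rewrite bnd_simp.
Qed.

Lemma Rintegral_cst_itv (a b k : R) : a < b ->
  \int[mu]_(x in `[a, b]) k = k * (b - a).
Proof.
move=> ab; have mab : measurable (`[a, b]%classic : set (measurableTypeR R)) by exact: measurable_itv.
rewrite (Rintegral_cst mu mab); congr (_ * _).
by have /= -> := @lebesgue_measure_itv R `[a, b]; rewrite lte_fin ab.
Qed.

(** The average of [|g|] over the segment and the total variation of [g] on it are
both bounded by the integral of [g^2 + g'^2 + 1]. *)
Lemma sobolev_line (g g' : R -> R) (a b K : R) : a < b ->
  (forall x : R, is_derive x 1 g (g' x)) -> continuous g' ->
  (\int[mu]_(x in `[a, b]) (g x ^+ 2 + g' x ^+ 2)%:E <= K%:E)%E ->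
  forall x, a <= x <= b -> `|g x| <= (K + (b - a)) / (b - a) + (K + (b - a)).
Proof.
move=> ab dg cg' HK x hx.
have cg := is_derive_continuous dg.
have cn (h : R -> R) : continuous h -> continuous (fun x => `|h x|).
  by move=> ch y; apply: continuous_comp; [exact: ch|exact: norm_continuous].
have csq : continuous (fun x => g x ^+ 2 + g' x ^+ 2).
  move=> y; apply: cvgD; [apply: (cvgM (cg y) (cg y))|apply: (cvgM (cg' y) (cg' y))].
have mab : measurable (`[a, b]%classic : set (measurableTypeR R)) by exact: measurable_itv.
have I0 := @continuous_itv_integrable _ a b csq.
have cst1 : continuous (fun _ : R => 1 : R) by apply: (@smooth_continuous _ 0); exact: smooth_cst.
have I1 := @continuous_itv_integrable _ a b cst1.
have K' : \int[mu]_(x in `[a, b]) (g x ^+ 2 + g' x ^+ 2) <= K.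
  by rewrite -lee_fin EFin_Rintegral.
have one : \int[mu]_(x in `[a, b]) (1 : R) = b - a.
  by rewrite Rintegral_cst_itv// mul1r.
have bnd (h : R -> R) : continuous h -> (forall y, `|h y| <= g y ^+ 2 + g' y ^+ 2 + 1) ->
    \int[mu]_(y in `[a, b]) `|h y| <= K + (b - a).
  move=> ch hh.
  apply: (@le_trans _ _ (\int[mu]_(y in `[a, b]) (g y ^+ 2 + g' y ^+ 2 + 1))).
    have I2 := @continuous_itv_integrable _ a b (cn _ ch).
    have I3 := @integrableD_EFin _ (measurableTypeR R) _ _ _ _ _ mab I0 I1.
    by apply: (le_Rintegral mab I2 I3) => y _; exact: hh.
  by rewrite RintegralD// one lerD2r.
have B1 : \int[mu]_(y in `[a, b]) `|g' y| <= K + (b - a).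
  by apply: bnd => // y; rewrite (le_trans (normr_le_sqr1 _))// lerD2r lerDr sqr_ge0.
have B2 : \int[mu]_(y in `[a, b]) `|g y| <= K + (b - a).
  by apply: bnd => // y; rewrite (le_trans (normr_le_sqr1 _))// lerD2r lerDl sqr_ge0.
have L0 : 0 < b - a by rewrite subr_gt0.
rewrite -lerBlDr ler_pdivlMr//.
apply: le_trans B2.
have -> : (`|g x| - (K + (b - a))) * (b - a) = \int[mu]_(y in `[a, b]) (`|g x| - (K + (b - a))).
  by rewrite Rintegral_cst_itv.
have I2 : mu.-integrable `[a, b] (EFin \o (fun=> `|g x| - (K + (b - a)))).
  by apply: continuous_itv_integrable; apply: (@smooth_continuous _ 0); exact: smooth_cst.
have I3 := @continuous_itv_integrable _ a b (cn _ cg).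
apply: (le_Rintegral mab I2 I3) => y; rewrite /= in_itv/= => hy.
have H := le_trans (increment_le_integral dg cg' hy hx) B1.
have := ler_normD (g x - g y) (g y); rewrite subrK => H2.
by rewrite lerBlDr addrC (le_trans H2)// lerD2r.
Qed.

Lemma ae_exists_itv (P : R -> Prop) (a b : R) : a < b ->
  {ae mu, forall x, P x} -> exists2 x, a < x < b & P x.
Proof.
move=> ab [N [mN N0 subN]]; apply: contrapT => nex.
have : `]a, b[ `<=` N.
  by move=> x; rewrite /= in_itv/= => hx; apply: subN => /= Px; apply: nex; exists x.
move=> /(@le_measure _ _ _ mu `]a, b[%classic N); rewrite !inE => /(_ (measurable_itv _) mN).
have E : mu `]a, b[%classic = (b - a)%:E.
  by have /= -> := @lebesgue_measure_itv R `]a, b[; rewrite lte_fin ab.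
move=> H; have {H} : ((b - a)%:E <= 0 :> \bar R)%E by rewrite -E -N0; exact: H.
by rewrite lee_fin subr_le0 leNgt ab.
Qed.

Lemma ae_neq (z : R) : {ae mu, forall x, x != z}.
Proof.
exists [set z]; split; [exact: measurable_set1|exact: lebesgue_measure_set1|].
by move=> x /= /negP; rewrite negbK => /eqP.
Qed.

Section good_lines.
Variables (S : plane R -> \bar R) (a b c d : R).
Hypothesis mS : measurable_fun setT S.
Hypothesis S0 : forall p, (0 <= S p)%E.
Hypothesis iS : (\int[leb2 R]_(p in rect a b c d) S p < +oo)%E.

Let mSQ : measurable_fun setT (S \_ (rect a b c d)).
Proof.
by apply/(measurable_restrictT _ (measurable_rect a b c d)); exact: measurable_funTS.
Qed.

Let SQ0 p : (0 <= (S \_ (rect a b c d)) p)%E.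
Proof. by rewrite /patch; case: ifP. Qed.

(** Tonelli: a function that is not integrable on the sections over a set of positive measure
has infinite integral. *)
Lemma good_horizontal :
  {ae mu, forall y, c <= y <= d -> (\int[mu]_(x in `[a, b]) S (x, y) < +oo)%E}.
Proof.
have mG := measurable_fun_fubini_tonelli_G (m1 := mu) _ mSQ SQ0.
have iG : mu.-integrable setT (fubini_G mu (S \_ (rect a b c d))).
  apply/integrableP; split; first exact: mG.
  apply: le_lt_trans iS; rewrite [leRHS]integral_mkcond.
  rewrite [leRHS](@fubini_tonelli2 _ _ _ _ _ mu mu _ mSQ SQ0).
  rewrite le_eqVlt; apply/orP; left; apply/eqP; apply: eq_integral => y _.
  by rewrite gee0_abs//; apply: integral_ge0.
apply: ae_sub (integrable_ae measurableT iG) => y /(_ I) Gy cyd.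
have -> : (\int[mu]_(x in `[a, b]) S (x, y) = fubini_G mu (S \_ (rect a b c d)) y)%E.
  rewrite integral_mkcond; apply: eq_integral => x _; rewrite /patch.
  congr (if _ then _ else _).
  by apply/idP/idP; rewrite !inE /rect /= !in_itv/= cyd => // -[].
by rewrite ltey_eq Gy.
Qed.

Lemma good_vertical :
  {ae mu, forall x, a <= x <= b -> (\int[mu]_(y in `[c, d]) S (x, y) < +oo)%E}.
Proof.
have mF := measurable_fun_fubini_tonelli_F (m2 := mu) _ mSQ SQ0.
have iF : mu.-integrable setT (fubini_F mu (S \_ (rect a b c d))).
  apply/integrableP; split; first exact: mF.
  apply: le_lt_trans iS; rewrite [leRHS]integral_mkcond.
  rewrite [leRHS](@fubini_tonelli1 _ _ _ _ _ mu mu _ mSQ SQ0).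
  rewrite le_eqVlt; apply/orP; left; apply/eqP; apply: eq_integral => x _.
  by rewrite gee0_abs//; apply: integral_ge0.
apply: ae_sub (integrable_ae measurableT iF) => x /(_ I) Fx axb.
have -> : (\int[mu]_(y in `[c, d]) S (x, y) = fubini_F mu (S \_ (rect a b c d)) x)%E.
  rewrite integral_mkcond; apply: eq_integral => y _; rewrite /patch.
  congr (if _ then _ else _).
  by apply/idP/idP; rewrite !inE /rect /= !in_itv/= axb => // -[].
by rewrite ltey_eq Fx.
Qed.
End good_lines.
End lines.

(** * A dominated approximating sequence *)

Section approximating_sequence.
Context {R : realType}.

Lemma nneseries_term_le (u : nat -> \bar R) n : (forall k, 0 <= u k)%E ->
  (u n <= \sum_(0 <= k <oo) u k)%E.
Proof.
move=> u0; apply: le_trans (nneseries_lim_ge n.+1 _); last by move=> k _ _; exact: u0.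
by rewrite big_nat_recr//= leeDr// sume_ge0.
Qed.

Lemma nneseries_terms_cvg0 (e : nat -> R) : (forall k, 0 <= e k) ->
  (\sum_(0 <= k <oo) (e k)%:E < +oo)%E -> e n @[n --> \oo] --> 0.
Proof.
move=> e0 se.
have e0' k : (0 <= (e k)%:E)%E by rewrite lee_fin.
have T := @nneseries_tail_cvg R (fun k => (e k)%:E) xpredT se (fun k _ => e0' k).
apply/cvgrPdist_le => d d0; apply: filterS (ereal_cvg0_le d0 T) => n nd.
rewrite sub0r normrN ger0_norm// -lee_fin; apply: le_trans nd.
apply: le_trans (nneseries_lim_ge n.+1 _) => //.
by rewrite big_nat1.
Qed.

Definition approx_smooth (v vx vy : R * R -> R) : Prop :=
  [/\ [/\ continuous v, continuous vx & continuous vy],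
      [/\ measurable_fun [set: plane R] v, measurable_fun [set: plane R] vx &
          measurable_fun [set: plane R] vy] &
      (forall p : R * R, is_derive p.1 1 (fun x => v (x, p.2)) (vx p)) /\
      (forall p : R * R, is_derive p.2 1 (fun y => v (p.1, y)) (vy p))].

Lemma measurable_fun_fst (f : R -> R) : continuous f ->
  measurable_fun [set: plane R] (fun p : plane R => f p.1).
Proof.
by move=> cf; apply: (measurableT_comp (continuous_measurable_fun cf)); exact: measurable_fst.
Qed.

Lemma measurable_approx_error (f : R -> R) (u ux uy v vx vy : plane R -> R) :
  continuous f ->
  measurable_fun setT u -> measurable_fun setT ux -> measurable_fun setT uy ->
  measurable_fun setT v -> measurable_fun setT vx -> measurable_fun setT vy ->
  measurable_fun setT (approx_error f u ux uy v vx vy : plane R -> R).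
Proof.
move=> cf mu mux muy mv mvx mvy.
apply: measurable_funD; first apply: measurable_funD.
+ exact: (measurable_funX 2%N (measurable_funB mv mu)).
+ exact: (measurable_funX 2%N (measurable_funB mvx mux)).
+ have mf1 := measurable_fun_fst cf.
  exact: (measurable_funX 2%N (measurable_funB (measurable_funM mf1 mvy) muy)).
Qed.

Definition energy (u ux uy : plane R -> R) (p : plane R) : R := u p ^+ 2 + ux p ^+ 2 + uy p ^+ 2.

(** [S] is the energy density of [u] plus the series of the errors, chosen below the
terms of a geometric series.  It replaces the extraction of an almost everywhere
converging and dominated subsequence. *)
Lemma approximating_sequence (f : R -> R) (Omega : set (R * R)) (u ux uy : R * R -> R)
    (x0 y0 rho : R) :
  let u0 := u \_ Omega in let ux0 := ux \_ Omega in let uy0 := uy \_ Omega in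
  Wf12 f Omega u ux uy -> bounded_set Omega -> continuous f -> 0 < rho ->
  (forall q : R * R, `|x0 - q.1| <= 2 * rho -> `|y0 - q.2| <= 2 * rho -> Omega q) ->
  exists (v vx vy : nat -> R * R -> R) (S : plane R -> \bar R),
  [/\ forall n, approx_smooth (v n) (vx n) (vy n),
      measurable_fun setT S,
      (\int[leb2 R]_(p in rect (x0 - rho) (x0 + rho) (y0 - rho) (y0 + rho)) S p < +oo)%E,
      forall n p, ((energy u0 ux0 uy0 p +
        approx_error f u0 ux0 uy0 (v n) (vx n) (vy n) p)%:E <= S p)%E &
      forall p, (S p < +oo)%E ->
        approx_error f u0 ux0 uy0 (v n) (vx n) (vy n) p @[n --> \oo] --> 0].
Proof.
move=> u0 ux0 uy0 Wu bO cf rho0 boxO.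
have [Lu Lx Ly _] := Wu.
have mu0 : measurable_fun [set: plane R] u0 := Lp2_measurable Lu.
have mux0 : measurable_fun [set: plane R] ux0 := Lp2_measurable Lx.
have muy0 : measurable_fun [set: plane R] uy0 := Lp2_measurable Ly.
have su0 := Lp2_sq_lty Lu; have sux0 := Lp2_sq_lty Lx; have suy0 := Lp2_sq_lty Ly.
set Q := rect _ _ _ _.
have /choice[V HV] : forall n : nat, exists V : (R * R -> R) * (R * R -> R) * (R * R -> R),
    approx_smooth V.1.1 V.1.2 V.2 /\
    (\int[leb2 R]_(p in Q) (approx_error f u0 ux0 uy0 V.1.1 V.1.2 V.2 p)%:E
       <= (1 / (2 ^ n.+1)%:R)%:E)%E.
  move=> n; have eta0 : 0 < 1 / (2 ^ n.+1)%:R :> R by rewrite divr_gt0// ltr0n expn_gt0.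
  have [v [vx [vy [H1 H2 H3 H4]]]] := smooth_approximation Wu bO cf rho0 boxO eta0.
  by exists (v, vx, vy).
pose e n : plane R -> R := approx_error f u0 ux0 uy0 (V n).1.1 (V n).1.2 (V n).2.
have e0 n p : 0 <= e n p by rewrite !addr_ge0// sqr_ge0.
have H0 p : 0 <= energy u0 ux0 uy0 p by rewrite !addr_ge0// sqr_ge0.
have me n : measurable_fun setT (e n).
  have [[_ [m1 m2 m3] _] _] := HV n.
  exact: (measurable_approx_error cf mu0 mux0 muy0 m1 m2 m3).
have me' n : measurable_fun setT (fun p => (e n p)%:E) by exact/measurable_EFinP.
have e0' n p : (0 <= (e n p)%:E)%E by rewrite lee_fin.
have mH : measurable_fun setT (fun p => (energy u0 ux0 uy0 p)%:E).
  apply/measurable_EFinP; apply: measurable_funD; first apply: measurable_funD.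
  - exact: (measurable_funX 2%N mu0).
  - exact: (measurable_funX 2%N mux0).
  - exact: (measurable_funX 2%N muy0).
have mQ : measurable (Q : set (plane R)) by exact: measurable_rect.
have mse : measurable_fun setT (fun p => \sum_(0 <= n <oo) (e n p)%:E)%E.
  by apply: (ge0_emeasurable_sum (P := xpredT)) => // k x _ _; exact: e0'.
have se0 p : (0 <= \sum_(0 <= n <oo) (e n p)%:E)%E by apply: nneseries_ge0.
exists (fun n => (V n).1.1), (fun n => (V n).1.2), (fun n => (V n).2),
  (fun p => (energy u0 ux0 uy0 p)%:E + \sum_(0 <= n <oo) (e n p)%:E)%E.
split.
- by move=> n; have [] := HV n.
- exact: emeasurable_funD.
- rewrite ge0_integralD//; last 3 first.
  + by move=> p _; rewrite lee_fin.
  + exact: measurable_funTS.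
  + exact: measurable_funTS.
  apply: lte_add_pinfty.
    apply: (@le_lt_trans _ _ (\int[leb2 R]_p (energy u0 ux0 uy0 p)%:E)%E).
      by apply: ge0_subset_integral => // p _; rewrite lee_fin.
    under eq_integral do rewrite /energy 2!EFinD.
    have sq0 (h : plane R -> R) p : (0 <= (h p ^+ 2)%:E)%E by rewrite lee_fin sqr_ge0.
    have msq (h : plane R -> R) : measurable_fun setT h ->
        measurable_fun setT (fun p => (h p ^+ 2)%:E).
      by move=> mh; apply/measurable_EFinP; exact: (measurable_funX 2%N mh).
    rewrite ge0_integralD//; last 3 first.
    + by move=> p _; apply: adde_ge0.
    + by apply: emeasurable_funD; exact: msq.
    + exact: msq.
    rewrite ge0_integralD//; try exact: msq.
    by apply: lte_add_pinfty; [apply: lte_add_pinfty|].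
  rewrite (integral_nneseries _ mQ); last 2 first.
  + by move=> n; exact: measurable_funTS.
  + by move=> n p _; exact: e0'.
  apply: (@le_lt_trans _ _ (\sum_(0 <= n <oo) (1 / (2 ^ n.+1)%:R)%:E)%E).
    apply: lee_nneseries => [n _ _|n _]; last by have [] := HV n.
    by apply: integral_ge0 => p _; exact: e0'.
  by apply: (le_lt_trans (epsilon_trick0 xpredT ler01)); rewrite ltry.
- move=> n p; rewrite EFinD; apply: leeD => //.
  exact: (@nneseries_term_le (fun k => (e k p)%:E) n).
- move=> p Sp; apply: nneseries_terms_cvg0 => [k|]; first exact: (e0 k p).
  by apply: le_lt_trans Sp; rewrite leeDr// lee_fin.
Qed.

End approximating_sequence.

(** * Integrals of functions that agree almost everywhere *)

Lemma ae_sub2 d (T : measurableType d) (R : realType) (mu : {measure set T -> \bar R})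
    (P1 P2 P : T -> Prop) : {ae mu, forall x, P1 x} -> {ae mu, forall x, P2 x} ->
  (forall x, P1 x -> P2 x -> P x) -> {ae mu, forall x, P x}.
Proof. by move=> h1 h2 h; apply: filterS2 h1 h2. Qed.

Section integral_ae_eq.
Context d (T : measurableType d) (R : realType).
Variable mu : {measure set T -> \bar R}.
Implicit Types f g : T -> \bar R.
Import HBNNSimple.

(** The integral is a supremum over simple functions below [f], measurable or not;
making such a simple function zero on a null set does not change its integral but
puts it below [g]. *)
Lemma ge0_integral_ae_le f g : (forall x, 0 <= f x)%E -> (forall x, 0 <= g x)%E ->
  {ae mu, forall x, (f x <= g x)%E} -> (\int[mu]_x f x <= \int[mu]_x g x)%E.
Proof.
move=> f0 g0 [N [mN N0 fgN]].
rewrite !ge0_integralTE//; apply: ge_ereal_sup => _ [h /= hf <-].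
have mN' : measurable (~` N) by exact: measurableC.
apply: ereal_sup_ubound; exists (proj_nnsfun h mN').
  move=> x; rewrite -mrestrict /patch; case: ifPn => xN; last exact: g0.
  apply: le_trans (hf x) _; apply: contrapT => fg.
  by move: xN; rewrite inE; apply; exact: fgN.
rewrite -mrestrict -(integral_nnsfun mu mN').
have -> : sintegral mu h = (\int[mu]_(x in setT) (h x)%:E)%E.
  by rewrite (integral_nnsfun mu measurableT) patch_setT.
rewrite (@ge0_negligible_integral _ _ _ mu setT N)//; last 2 first.
- exact/measurable_EFinP.
- by move=> x _; rewrite lee_fin.
by rewrite setTD.
Qed.

Lemma ge0_integral_ae_eq f g : (forall x, 0 <= f x)%E -> (forall x, 0 <= g x)%E ->
  {ae mu, forall x, f x = g x} -> (\int[mu]_x f x = \int[mu]_x g x)%E.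
Proof.
move=> f0 g0 fg; apply/eqP; rewrite eq_le; apply/andP; split.
  by apply: ge0_integral_ae_le => //; apply: ae_sub fg => x ->.
by apply: ge0_integral_ae_le => //; apply: ae_sub fg => x ->.
Qed.

(** The coefficients composed with the solution agree only almost everywhere with Borel
functions, hence a statement that covers functions that are not Borel. *)
Lemma integral_ae_eq f g (D : set T) : {ae mu, forall x, D x -> f x = g x} ->
  (\int[mu]_(x in D) f x = \int[mu]_(x in D) g x)%E.
Proof.
move=> fg; rewrite integral_mkcond [RHS]integral_mkcond integralE [RHS]integralE.
have fg' : {ae mu, forall x, (f \_ D) x = (g \_ D) x}.
  by apply: ae_sub fg => x fgx; rewrite /patch; case: ifPn => //; rewrite inE.
congr (_ - _)%E; apply: ge0_integral_ae_eq => //; apply: ae_sub fg' => x fgx.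
  by rewrite !funeposE fgx.
by rewrite !funenegE fgx.
Qed.

End integral_ae_eq.

(** * The energy identity for the truncation *)

Section energy_identity.
Context {R : realType}.

Definition sym_form (a b d x0 x1 y0 y1 : R) : R :=
  a * (x0 * y0) + b * (x0 * y1 + x1 * y0) + d * (x1 * y1).

(** Polarization: four times the form at [(x, y)] is the difference of its values
at [x + y] and [x - y], both between [0] and [C] times the corresponding norms, to
which the parallelogram identity applies. *)
Lemma sym_form_le (a b d t c C x0 x1 y0 y1 : R) : 0 <= c ->
  (forall z0 z1, c * (z0 ^+ 2 + t ^+ 2 * z1 ^+ 2) <= sym_form a b d z0 z1 z0 z1
     <= C * (z0 ^+ 2 + t ^+ 2 * z1 ^+ 2)) ->
  `|sym_form a b d x0 x1 y0 y1| <=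
    C * ((x0 ^+ 2 + t ^+ 2 * x1 ^+ 2) + (y0 ^+ 2 + t ^+ 2 * y1 ^+ 2)).
Proof.
move=> c0 H.
have pol : 4 * sym_form a b d x0 x1 y0 y1 =
    sym_form a b d (x0 + y0) (x1 + y1) (x0 + y0) (x1 + y1) -
    sym_form a b d (x0 - y0) (x1 - y1) (x0 - y0) (x1 - y1) by rewrite /sym_form; ring.
have par : (x0 + y0) ^+ 2 + t ^+ 2 * (x1 + y1) ^+ 2 +
     ((x0 - y0) ^+ 2 + t ^+ 2 * (x1 - y1) ^+ 2) =
   2 * ((x0 ^+ 2 + t ^+ 2 * x1 ^+ 2) + (y0 ^+ 2 + t ^+ 2 * y1 ^+ 2)) by ring.
have N z0 z1 : 0 <= z0 ^+ 2 + t ^+ 2 * z1 ^+ 2.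
  by rewrite addr_ge0 ?sqr_ge0// -exprMn sqr_ge0.
have /andP[p1 p2] := H (x0 + y0) (x1 + y1).
have /andP[m1 m2] := H (x0 - y0) (x1 - y1).
have Cp := le_trans (mulr_ge0 c0 (N (x0 + y0) (x1 + y1))) (le_trans p1 p2).
have Cm := le_trans (mulr_ge0 c0 (N (x0 - y0) (x1 - y1))) (le_trans m1 m2).
have fp0 := le_trans (mulr_ge0 c0 (N (x0 + y0) (x1 + y1))) p1.
have fm0 := le_trans (mulr_ge0 c0 (N (x0 - y0) (x1 - y1))) m1.
have E : C * ((x0 + y0) ^+ 2 + t ^+ 2 * (x1 + y1) ^+ 2) +
     C * ((x0 - y0) ^+ 2 + t ^+ 2 * (x1 - y1) ^+ 2) =
   2 * (C * ((x0 ^+ 2 + t ^+ 2 * x1 ^+ 2) + (y0 ^+ 2 + t ^+ 2 * y1 ^+ 2))).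
  by rewrite -mulrDr par; ring.
by move: p2 m2 Cp Cm fp0 fm0 E pol; clear; rewrite ler_norml => *; apply/andP; split; lra.
Qed.

Lemma cvg_of_sqr_le (x e : nat -> R) (l : R) : (forall n, (x n - l) ^+ 2 <= e n) ->
  e n @[n --> \oo] --> 0 -> x n @[n --> \oo] --> l.
Proof.
move=> xe e0; apply/cvgrPdist_le => eps eps0.
have e2 : 0 < eps ^+ 2 by rewrite exprn_gt0.
move/cvgrPdist_le : e0 => /(_ _ e2); apply: filterS => n.
rewrite sub0r normrN distrC => en.
rewrite -(@ler_pXn2r _ 2)// ?nnegrE ?(ltW eps0)// real_normK ?num_real//.
by apply: le_trans (xe n) (le_trans (ler_norm _) en).
Qed.

(** Off the line [x = 0] the vertical derivative is recovered by dividing by [f]. *)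
Lemma cvg_of_approx_error (f : R -> R) (u ux uy : R * R -> R) (v vx vy : nat -> R * R -> R)
    (p : R * R) : f p.1 != 0 ->
  approx_error f u ux uy (v n) (vx n) (vy n) p @[n --> \oo] --> 0 ->
  [/\ v n p @[n --> \oo] --> u p, vx n p @[n --> \oo] --> ux p &
      vy n p @[n --> \oo] --> uy p / f p.1].
Proof.
move=> fp e0.
have cvg_sub0 (x : nat -> R) (l : R) : (forall n, (x n - l) ^+ 2 <=
    approx_error f u ux uy (v n) (vx n) (vy n) p) -> x n @[n --> \oo] --> l.
  by move=> xl; exact: (cvg_of_sqr_le xl e0).
have c1 : v n p @[n --> \oo] --> u p.
  by apply: cvg_sub0 => n; rewrite /approx_error -addrA lerDl addr_ge0// sqr_ge0.
have c2 : vx n p @[n --> \oo] --> ux p.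
  by apply: cvg_sub0 => n; rewrite /approx_error addrAC lerDr addr_ge0// sqr_ge0.
have c3 : f p.1 * vy n p @[n --> \oo] --> uy p.
  by apply: cvg_sub0 => n; rewrite /approx_error lerDr addr_ge0// sqr_ge0.
split=> //.
have -> : (fun n => vy n p) = (fun n => f p.1 * vy n p / f p.1).
  by apply/funext => n; rewrite mulrAC divff// mul1r.
exact: (cvgM c3 (cvg_cst _)).
Qed.

Lemma ae_fst_neq0 : {ae leb2 R, forall p : plane R, p.1 != 0}.
Proof.
have m0 : measurable ([set 0] : set (measurableTypeR R)) by exact: measurable_set1.
exists ([set 0] `*` setT); split; first exact: measurableX.
- transitivity (@lebesgue_measure R [set (0%R : R)] * @lebesgue_measure R setT)%E.
    exact: product_measure1E.
  by rewrite lebesgue_measure_set1 mul0e.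
- by move=> [x y] /= /negP; rewrite negbK => /eqP ->.
Qed.

Section limit.
Variables (f : R -> R) (a b c d : R) (B00 B01 B11 u ux uy : plane R -> R).
Variables (v vx vy : nat -> R * R -> R) (S : plane R -> \bar R) (M lam Lam : R).
Let Q : set (plane R) := rect a b c d.
Hypothesis cf : continuous f.
Hypothesis fpos : forall t, t != 0 -> 0 < f t.
Hypothesis f0 : forall t, 0 <= f t.
Hypothesis mB00 : measurable_fun setT B00.
Hypothesis mB01 : measurable_fun setT B01.
Hypothesis mB11 : measurable_fun setT B11.
Hypothesis mu : measurable_fun setT u.
Hypothesis mux : measurable_fun setT ux.
Hypothesis muy : measurable_fun setT uy.
Hypothesis smooth_v : forall n, approx_smooth (v n) (vx n) (vy n).
Hypothesis mS : measurable_fun setT S.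
Hypothesis iS : (\int[leb2 R]_(p in Q) S p < +oo)%E.
Hypothesis leS : forall n p,
  ((energy u ux uy p + approx_error f u ux uy (v n) (vx n) (vy n) p)%:E <= S p)%E.
Hypothesis cvgS : forall p, (S p < +oo)%E ->
  approx_error f u ux uy (v n) (vx n) (vy n) p @[n --> \oo] --> 0.
Hypothesis lam0 : 0 < lam.
Hypothesis lamLam : lam <= Lam.
Hypothesis elliptic : {ae leb2 R, forall p : plane R, Q p -> forall z0 z1,
  lam * (z0 ^+ 2 + f p.1 ^+ 2 * z1 ^+ 2) <= sym_form (B00 p) (B01 p) (B11 p) z0 z1 z0 z1
    <= Lam * (z0 ^+ 2 + f p.1 ^+ 2 * z1 ^+ 2)}.

Let form (p : plane R) := sym_form (B00 p) (B01 p) (B11 p).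

Let G n (p : plane R) := dcut M (v n p) * form p (vx n p) (vy n p) (ux p) (uy p / f p.1).
Let Goo (p : plane R) := dcut M (u p) * form p (ux p) (uy p / f p.1) (ux p) (uy p / f p.1).

Let mQ : measurable Q. Proof. exact: measurable_rect. Qed.

Let measurable_form (x0 x1 y0 y1 : plane R -> R) :
  measurable_fun setT x0 -> measurable_fun setT x1 ->
  measurable_fun setT y0 -> measurable_fun setT y1 ->
  measurable_fun setT (fun p => form p (x0 p) (x1 p) (y0 p) (y1 p)).
Proof.
move=> m1 m2 m3 m4.
have mA := measurable_funM mB00 (measurable_funM m1 m3).
have mB := measurable_funM mB01 (measurable_funD (measurable_funM m1 m4) (measurable_funM m2 m3)).
have mC := measurable_funM mB11 (measurable_funM m2 m4).
exact: (measurable_funD (measurable_funD mA mB) mC).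
Qed.

Let measurable_slope : measurable_fun setT (fun p : plane R => uy p / f p.1).
Proof.
apply: (measurable_funM muy).
have -> : (fun p : plane R => (f p.1)^-1) = (fun p => f p.1 `^ (-1)).
  by apply/funext => p; rewrite powR_inv1.
exact: (measurableT_comp (measurable_powR (-1)) (measurable_fun_fst cf)).
Qed.

Let mG n : measurable_fun setT (G n).
Proof.
have [_ [m1 m2 m3] _] := smooth_v n.
exact: (measurable_funM (measurable_dcut M m1) (measurable_form m2 m3 mux measurable_slope)).
Qed.

Let mGoo : measurable_fun setT Goo.
Proof.
exact: (measurable_funM (measurable_dcut M mu)
  (measurable_form mux measurable_slope mux measurable_slope)).
Qed.

Let dom_pointwise n p : f p.1 != 0 -> (forall z0 z1,
  lam * (z0 ^+ 2 + f p.1 ^+ 2 * z1 ^+ 2) <= form p z0 z1 z0 z1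
    <= Lam * (z0 ^+ 2 + f p.1 ^+ 2 * z1 ^+ 2)) ->
  `|G n p| <= 12 * Lam *
    (energy u ux uy p + approx_error f u ux uy (v n) (vx n) (vy n) p).
Proof.
move=> fp H.
have Lam0 : 0 <= Lam by apply: le_trans lamLam; exact: ltW.
have F := sym_form_le (vx n p) (vy n p) (ux p) (uy p / f p.1) (ltW lam0) H.
rewrite /G normrM (ger0_norm (dcut_ge0 _ _)).
apply: (@le_trans _ _ (4 * `|form p (vx n p) (vy n p) (ux p) (uy p / f p.1)|)).
  by apply: ler_wpM2r; [exact: normr_ge0|exact: dcut_le].
have -> : 12 * Lam * (energy u ux uy p + approx_error f u ux uy (v n) (vx n) (vy n) p) =
  4 * (Lam * (3 * (energy u ux uy p + approx_error f u ux uy (v n) (vx n) (vy n) p))) by ring.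
rewrite ler_wpM2l//; apply: le_trans F _; rewrite ler_wpM2l//.
have -> : f p.1 ^+ 2 * (uy p / f p.1) ^+ 2 = uy p ^+ 2.
  by rewrite -exprMn mulrCA divff// mulr1.
rewrite -exprMn /energy /approx_error -subr_ge0.
rewrite [X in 0 <= X](_ : _ = (vx n p - 2 * ux p) ^+ 2 + (f p.1 * vy n p - 2 * uy p) ^+ 2 +
  (vx n p - ux p) ^+ 2 + (f p.1 * vy n p - uy p) ^+ 2 + 3 * (u p) ^+ 2 +
   3 * (v n p - u p) ^+ 2); last by ring.
have sq (x : R) : 0 <= x ^+ 2 by exact: sqr_ge0.
have sq3 (x : R) : 0 <= 3 * x ^+ 2 by apply: mulr_ge0.
exact: (addr_ge0 (addr_ge0 (addr_ge0 (addr_ge0 (addr_ge0 (sq _) (sq _)) (sq _)) (sq _)) (sq3 _)) (sq3 _)).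
Qed.

(** [G n] is the integrand of the equation tested with the truncation of [v n], and
[Goo] that for [u] itself.  Dominated convergence gives [int Goo = 0], and
ellipticity [Goo >= dcut M (u) * lam * u_x^2 >= 0]. *)
Lemma energy_limit :
  (forall n, \int[leb2 R]_(p in Q) G n p = 0) ->
  {ae leb2 R, forall p : plane R, Q p -> dcut M (u p) * ux p = 0}.
Proof.
move=> HG.
(* The constant of [dom_pointwise]. *)
pose K : R := 12 * Lam.
have K0 : 0 <= K by rewrite mulr_ge0// (le_trans _ lamLam)// ltW.
have S0 p : (0 <= S p)%E.
  by apply: le_trans (leS 0 p); rewrite lee_fin !addr_ge0// sqr_ge0.
have ISQ : (leb2 R).-integrable Q S.
  apply/integrableP; split; first exact: measurable_funTS.
  by apply: le_lt_trans iS; rewrite le_eqVlt; apply/orP; left; apply/eqP;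
    apply: eq_integral => p _; rewrite gee0_abs.
have ISK : (leb2 R).-integrable Q (fun p => K%:E * S p)%E by exact: integrableZl.
have elliptic' : {ae leb2 R, forall p : plane R, Q p -> f p.1 != 0 /\
    forall z0 z1, lam * (z0 ^+ 2 + f p.1 ^+ 2 * z1 ^+ 2) <= form p z0 z1 z0 z1
    <= Lam * (z0 ^+ 2 + f p.1 ^+ 2 * z1 ^+ 2)}.
  by apply: (ae_sub2 ae_fst_neq0 elliptic) => p p0 H Qp; split;
    [rewrite gt_eqF// fpos|exact: H].
have dom : {ae leb2 R, forall p : plane R, forall n, Q p -> (`|(G n p)%:E| <= K%:E * S p)%E}.
  apply: ae_sub elliptic' => p H n Qp; have [fp {}H] := H Qp.
  apply: (@le_trans _ _ (K%:E * (energy u ux uy p +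
    approx_error f u ux uy (v n) (vx n) (vy n) p)%:E)%E); last first.
    by apply: lee_wpmul2l; [rewrite lee_fin|exact: leS].
  by rewrite -EFinM abse_EFin lee_fin; exact: dom_pointwise.
have cvgG : {ae leb2 R, forall p : plane R, Q p -> (G n p)%:E @[n --> \oo] --> (Goo p)%:E}.
  apply: (ae_sub2 elliptic' (integrable_ae mQ ISQ)) => p H Sfin Qp.
  have [fp _] := H Qp.
  have Soo : (S p < +oo)%E by rewrite ltey_eq Sfin.
  have [c1 c2 c3] := cvg_of_approx_error fp (cvgS Soo).
  have c4 : dcut M (v n p) @[n --> \oo] --> dcut M (u p).
    by apply: continuous_cvg c1; exact: dcut_continuous.
  have cs (w : R) : (w : R) @[n --> \oo] --> w by exact: cvg_cst.
  apply: cvg_EFin; first exact: nearW.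
  apply: (cvgM c4 (cvgD (cvgD (cvgM (cs _) (cvgM c2 (cs _)))
    (cvgM (cs _) (cvgD (cvgM c2 (cs _)) (cvgM c3 (cs _)))))
    (cvgM (cs _) (cvgM c3 (cs _))))).
have mGE n : measurable_fun Q (fun p => (G n p)%:E).
  by apply: measurable_funTS; apply/measurable_EFinP; exact: mG.
have mGooE : measurable_fun Q (fun p => (Goo p)%:E).
  by apply: measurable_funTS; apply/measurable_EFinP; exact: mGoo.
have [IGoo _ lim] := dominated_convergence mQ mGE mGooE cvgG ISK dom.
have IG n : (leb2 R).-integrable Q (EFin \o G n).
  apply/integrableP; split; first exact: mGE.
  have /integrableP[_] := ISK; apply: le_lt_trans.
  apply: ae_ge0_le_integral => //.
  - exact: (measurableT_comp (@abse_measurable R setT) (mGE n)).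
  - exact: (measurableT_comp (@abse_measurable R setT) (measurable_int _ ISK)).
  - apply: ae_sub dom => p /(_ n) H Qp; apply: le_trans (H Qp) _.
    by rewrite lee_abs.
have G0 n : (\int[leb2 R]_(p in Q) (G n p)%:E = 0)%E.
  by rewrite -EFin_Rintegral// HG.
have Goo0 : (\int[leb2 R]_(p in Q) (Goo p)%:E = 0)%E.
  move: lim; under eq_fun do rewrite G0; move=> lim.
  exact: (cvg_unique (@ereal_hausdorff R) lim (cvg_cst 0%E)).
have lower : {ae leb2 R, forall p : plane R, Q p ->
    dcut M (u p) * (lam * ux p ^+ 2) <= Goo p}.
  apply: ae_sub elliptic' => p H Qp; have [fp {}H] := H Qp.
  have /andP[H1 _] := H (ux p) (uy p / f p.1).
  apply: ler_wpM2l; first exact: dcut_ge0.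
  by apply: le_trans H1; rewrite ler_wpM2l ?(ltW lam0)// lerDl -exprMn sqr_ge0.
have Goo_ge0 : {ae leb2 R, forall p : plane R, Q p -> 0 <= Goo p}.
  apply: ae_sub lower => p H Qp; apply: le_trans (H Qp).
  by rewrite mulr_ge0 ?dcut_ge0// mulr_ge0 ?sqr_ge0// ltW.
have absGoo0 : (\int[leb2 R]_(p in Q) `|(Goo p)%:E| = 0)%E.
  rewrite -Goo0; apply: integral_ae_eq; apply: ae_sub Goo_ge0 => p H Qp.
  by rewrite gee0_abs// lee_fin; exact: H.
have Gz := (ae_eq_integral_abs _ mQ mGooE).1 absGoo0.
apply: (ae_sub2 lower Gz) => p H1 H2 Qp.
have := H1 Qp; have [->] : (Goo p)%:E = 0%:E by exact: H2.
have du := dcut_ge0 M (u p).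
move=> H; have : dcut M (u p) * (lam * ux p ^+ 2) = 0.
  by apply/eqP; rewrite eq_le H mulr_ge0// mulr_ge0 ?sqr_ge0// ltW.
move/eqP; rewrite mulf_eq0 => /orP[/eqP ->|]; first by rewrite mul0r.
rewrite mulf_eq0 (gt_eqF lam0)/= sqrf_eq0 => /eqP ->.
by rewrite mulr0.
Qed.

End limit.
End energy_identity.

(** * Vanishing of the truncation *)

Section maximum_principle.
Context {R : realType}.
Notation mu := (@lebesgue_measure R).

(** On each horizontal line [|h|] is at most the integral of [|h'|] over the segment, as [h]
vanishes at its left end; integrate over the rectangle. *)
Lemma poincare_rect (h h' : R * R -> R) (a b c d : R) : a < b ->
  continuous h -> continuous h' ->
  (forall p : R * R, is_derive p.1 1 (fun x => h (x, p.2)) (h' p)) ->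
  (forall y, c <= y <= d -> h (a, y) = 0) ->
  (\int[leb2 R]_(p in rect a b c d) `|h p|%:E <=
    (b - a)%:E * \int[leb2 R]_(p in rect a b c d) `|h' p|%:E)%E.
Proof.
move=> ab ch ch' dh ha.
set Q := rect a b c d.
have mQ : measurable (Q : set (plane R)) by exact: measurable_rect.
have mabs (g : R * R -> R) : continuous g ->
    measurable_fun [set: plane R] (fun p => `|g p|%:E).
  move=> cg; apply/measurable_EFinP.
  exact: (measurableT_comp (@normr_measurable R setT) (continuous_plane_measurable cg)).
have mpat (g : R * R -> R) : continuous g ->
    measurable_fun [set: plane R] ((fun p => `|g p|%:E) \_ Q).
  move=> cg; apply/(measurable_restrictT _ mQ); exact: measurable_funTS (mabs _ cg).
have pat0 (g : R * R -> R) (p : plane R) : (0 <= ((fun p => `|g p|%:E) \_ Q) p)%E.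
  by rewrite /patch; case: ifP.
rewrite integral_mkcond [X in (_ <= _ * X)%E]integral_mkcond.
rewrite (@fubini_tonelli2 _ _ _ _ _ mu mu _ (mpat _ ch) (pat0 h)).
rewrite (@fubini_tonelli2 _ _ _ _ _ mu mu _ (mpat _ ch') (pat0 h')).
set J := fubini_G _ ((fun p => `|h' p|%:E) \_ Q).
have mJ : measurable_fun setT J := measurable_fun_fubini_tonelli_G (m1 := mu) _ (mpat _ ch') (pat0 h').
have J0 y : (0 <= J y)%E by apply: integral_ge0 => x _; exact: pat0.
have mW : measurable_fun setT (fubini_G mu ((fun p => `|h p|%:E) \_ Q)) :=
  measurable_fun_fubini_tonelli_G (m1 := mu) _ (mpat _ ch) (pat0 h).
have ba0 : (0 <= (b - a)%:E)%E by rewrite lee_fin subr_ge0 ltW.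
rewrite -(ge0_integralZl mu measurableT mJ (fun y _ => J0 y) ba0).
apply: ge0_le_integral => //.
- by move=> y _; apply: integral_ge0 => x _; exact: pat0.
- exact: measurable_funeM.
move=> y _; rewrite /fubini_G.
have [cyd|cyd] := boolP (c <= y <= d); last first.
  rewrite integral0_eq; first exact: mule_ge0.
  move=> x _; rewrite /patch ifF//; apply/negP; rewrite inE /Q /rect /= => -[_].
  by rewrite in_itv/= (negbTE cyd).
have cHy := section_x_continuous (y := y) ch; have cHy' := section_x_continuous (y := y) ch'.
have dHy (x : R) : is_derive x 1 (fun x => h (x, y)) (h' (x, y)) by exact: (dh (x, y)).
have mab : measurable (`[a, b]%classic : set (measurableTypeR R)) by exact: measurable_itv.
have JE : J y = (\int[mu]_(x in `[a, b]) `|h' (x, y)|)%:E.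
  rewrite EFin_Rintegral//; last first.
    apply: continuous_itv_integrable => x.
    by apply: continuous_comp; [exact: cHy'|exact: norm_continuous].
  rewrite /J /fubini_G [RHS]integral_mkcond; apply: eq_integral => x _; rewrite /patch.
  congr (if _ then _ else _).
  by apply/idP/idP; rewrite !inE /Q /rect /= !in_itv/= cyd => // -[].
have -> : ((b - a)%:E * J y = \int[mu]_(x in `[a, b]) (J y))%E.
  rewrite (integral_cst mu mab) muleC; congr (_ * _)%E.
  by have /= -> := @lebesgue_measure_itv R `[a, b]; rewrite lte_fin ab.
rewrite [leRHS]integral_mkcond; apply: ge0_le_integral => //.
- exact: (measurableT_comp (mpat _ ch) (measurable_pair2 y)).
- by apply/(measurable_restrictT _ mab).
move=> x _; rewrite /patch.
case: ifPn => hQ; last by case: ifP.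
move: hQ; rewrite inE /Q /rect /= !in_itv/= => -[axb _].
rewrite ifT; last by rewrite inE/= in_itv/=.
rewrite JE lee_fin.
have -> : h (x, y) = h (x, y) - h (a, y) by rewrite (ha _ cyd) subr0.
by apply: (increment_le_integral dHy cHy' _ axb); rewrite lexx ltW.
Qed.

Section cut_vanish.
Variables (f : R -> R) (a b c d : R) (u ux uy : plane R -> R).
Variables (v vx vy : nat -> R * R -> R) (S : plane R -> \bar R) (M : R).
Let Q : set (plane R) := rect a b c d.
Hypothesis ab : a < b.
Hypothesis fpos : forall t, t != 0 -> 0 < f t.
Hypothesis mu0 : measurable_fun setT u.
Hypothesis mux : measurable_fun setT ux.
Hypothesis smooth_v : forall n, approx_smooth (v n) (vx n) (vy n).
Hypothesis mS : measurable_fun setT S.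
Hypothesis iS : (\int[leb2 R]_(p in Q) S p < +oo)%E.
Hypothesis leS : forall n p,
  ((energy u ux uy p + approx_error f u ux uy (v n) (vx n) (vy n) p)%:E <= S p)%E.
Hypothesis cvgS : forall p, (S p < +oo)%E ->
  approx_error f u ux uy (v n) (vx n) (vy n) p @[n --> \oo] --> 0.
Hypothesis M0 : 0 <= M.
Hypothesis edge : forall n y, c <= y <= d -> `|v n (a, y)| <= M.
Hypothesis flat : {ae leb2 R, forall p : plane R, Q p -> dcut M (u p) * ux p = 0}.

Let mQ : measurable Q. Proof. exact: measurable_rect. Qed.

Let L n (p : plane R) : \bar R := `|cut M (v n p)|%:E.
Let D n (p : plane R) : \bar R := `|dcut M (v n p) * vx n p|%:E.

Let measurable_norm_fun (g : plane R -> R) : measurable_fun setT g ->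
  measurable_fun Q (fun p => `|g p|%:E).
Proof.
move=> mg; apply: measurable_funTS; apply/measurable_EFinP.
exact: (measurableT_comp (@normr_measurable R setT) mg).
Qed.

Let increments n : (\int[leb2 R]_(p in Q) L n p <= (b - a)%:E * \int[leb2 R]_(p in Q) D n p)%E.
Proof.
have [[cv cvx _] _ [dv _]] := smooth_v n.
apply: (@poincare_rect (fun p => cut M (v n p)) (fun p => dcut M (v n p) * vx n p)) => //.
- by move=> p; apply: (@continuous_comp _ _ _ (v n) (cut M)); [exact: cv|exact: cut_continuous].
- move=> p; apply: cvgM; last exact: cvx.
  by apply: (@continuous_comp _ _ _ (v n) (dcut M)); [exact: cv|exact: dcut_continuous].
- move=> [x y]; have dvx := dv (x, y).
  exact: (@is_derive1_comp _ (cut M) (fun x => v n (x, y)) x _ _ (is_derive_cut M _) dvx).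
- by move=> y hy; apply: cut_eq0; exact: edge.
Qed.

Let dom_dcut n p : `|dcut M (v n p) * vx n p| <=
  8 * (energy u ux uy p + approx_error f u ux uy (v n) (vx n) (vy n) p) + 4.
Proof.
rewrite normrM (ger0_norm (dcut_ge0 _ _)).
apply: (@le_trans _ _ (4 * `|vx n p|)).
  by apply: ler_wpM2r; [exact: normr_ge0|exact: dcut_le].
have -> : 8 * (energy u ux uy p + approx_error f u ux uy (v n) (vx n) (vy n) p) + 4 =
   4 * (2 * (energy u ux uy p + approx_error f u ux uy (v n) (vx n) (vy n) p) + 1) by ring.
rewrite ler_wpM2l//; apply: le_trans (normr_le_sqr1 _) _; rewrite lerD2r.
rewrite /energy /approx_error -subr_ge0.
rewrite [X in 0 <= X](_ : _ = (vx n p - 2 * ux p) ^+ 2 + 2 * (u p) ^+ 2 + 2 * (uy p) ^+ 2 +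
   2 * (v n p - u p) ^+ 2 + 2 * (f p.1 * vy n p - uy p) ^+ 2); last by ring.
have sq (x : R) : 0 <= x ^+ 2 by exact: sqr_ge0.
have sq2 (x : R) : 0 <= 2 * x ^+ 2 by apply: mulr_ge0.
exact: (addr_ge0 (addr_ge0 (addr_ge0 (addr_ge0 (sq _) (sq2 _)) (sq2 _)) (sq2 _)) (sq2 _)).
Qed.

(** Both sides of [poincare_rect] for [cut M (v n)] converge by domination: the left one to
the integral of [|cut M u|] and the right one to zero, by the hypothesis [flat]. *)
Lemma cut_vanish : {ae leb2 R, forall p : plane R, Q p -> `|u p| <= M}.
Proof.
have S0 p : (0 <= S p)%E.
  by apply: le_trans (leS 0 p); rewrite lee_fin !addr_ge0// sqr_ge0.
have ISQ : (leb2 R).-integrable Q S.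
  apply/integrableP; split; first exact: measurable_funTS.
  by apply: le_lt_trans iS; rewrite le_eqVlt; apply/orP; left; apply/eqP;
    apply: eq_integral => p _; rewrite gee0_abs.
have Icst (k : R) : (leb2 R).-integrable Q (cst k%:E).
  apply/integrableP; split; first exact: measurable_cst.
  by rewrite integral_cst//= lte_mul_pinfty//; exact: leb2_rect_lty.
have ISK : (leb2 R).-integrable Q (fun p => 8%:E * S p + 4%:E)%E.
  by apply: integrableD => //; [exact: integrableZl|exact: Icst].
have cvgv : {ae leb2 R, forall p : plane R, Q p ->
    v n p @[n --> \oo] --> u p /\ vx n p @[n --> \oo] --> ux p}.
  apply: (ae_sub2 (ae_fst_neq0 (R := R)) (integrable_ae mQ ISQ)) => p p0 Sfin Qp.
  have Soo : (S p < +oo)%E by rewrite ltey_eq Sfin.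
  have fp : f p.1 != 0 by rewrite gt_eqF// fpos.
  by have [c1 c2 _] := cvg_of_approx_error fp (cvgS Soo).
have cvgL : {ae leb2 R, forall p : plane R, Q p -> L n p @[n --> \oo] --> `|cut M (u p)|%:E}.
  apply: ae_sub cvgv => p H Qp; have [c1 _] := H Qp.
  apply: cvg_EFin; first exact: nearW.
  apply: cvg_norm.
  by apply: continuous_cvg c1; exact: cut_continuous.
have cvgD : {ae leb2 R, forall p : plane R, Q p ->
    D n p @[n --> \oo] --> `|dcut M (u p) * ux p|%:E}.
  apply: ae_sub cvgv => p H Qp; have [c1 c2] := H Qp.
  apply: cvg_EFin; first exact: nearW.
  apply: cvg_norm; apply: cvgM c2.
  by apply: continuous_cvg c1; exact: dcut_continuous.
have mL n : measurable_fun Q (L n).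
  by have [_ [m1 m2 m3] _] := smooth_v n; exact: (measurable_norm_fun (measurable_cut M m1)).
have mD n : measurable_fun Q (D n).
  have [_ [m1 m2 m3] _] := smooth_v n.
  exact: (measurable_norm_fun (measurable_funM (measurable_dcut M m1) m2)).
have mLoo : measurable_fun Q (fun p => `|cut M (u p)|%:E).
  exact: (measurable_norm_fun (measurable_cut M mu0)).
have mDoo : measurable_fun Q (fun p => `|dcut M (u p) * ux p|%:E).
  exact: (measurable_norm_fun (measurable_funM (measurable_dcut M mu0) mux)).
have domL : {ae leb2 R, forall p : plane R, forall n, Q p -> (`|L n p| <= cst 1%:E p)%E}.
  apply: ae_sub (ae_fst_neq0 (R := R)) => p _ n _.
  by rewrite /L /= lee_fin normr_id; exact: cut_norm_le1.
have domD : {ae leb2 R, forall p : plane R, forall n, Q p -> (`|D n p| <= 8%:E * S p + 4%:E)%E}.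
  apply: ae_sub (ae_fst_neq0 (R := R)) => p _ n _.
  rewrite /D abse_EFin normr_id; apply: (@le_trans _ _ (8%:E * (energy u ux uy p +
    approx_error f u ux uy (v n) (vx n) (vy n) p)%:E + 4%:E)%E).
    by rewrite -EFinM -EFinD lee_fin; exact: dom_dcut.
  by apply: leeD => //; apply: lee_wpmul2l; [rewrite lee_fin|exact: leS].
have [_ _ limL] := dominated_convergence mQ mL mLoo cvgL (Icst 1) domL.
have [_ _ limD] := dominated_convergence mQ mD mDoo cvgD ISK domD.
have D0 : (\int[leb2 R]_(p in Q) `|dcut M (u p) * ux p|%:E = 0)%E.
  rewrite -(integral0 (leb2 R) Q); apply: integral_ae_eq; apply: ae_sub flat => p H Qp.
  by rewrite (H Qp) normr0.
rewrite D0 in limD.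
have limD' : ((b - a)%:E * \int[leb2 R]_(p in Q) D n p)%E @[n --> \oo] --> 0%E.
  by rewrite -(mule0 (b - a)%:E); exact: (cvgeZl _ limD).
have L0 : (\int[leb2 R]_(p in Q) `|cut M (u p)|%:E <= 0)%E.
  rewrite -(cvg_lim (@ereal_hausdorff R) limL) -(cvg_lim (@ereal_hausdorff R) limD').
  apply: lee_lim.
  - by apply/cvg_ex; eexists; exact: limL.
  - by apply/cvg_ex; eexists; exact: limD'.
  - by apply: nearW => n; exact: increments.
have L1 : (\int[leb2 R]_(p in Q) abse (`|cut M (u p)|%:E) = 0)%E.
  apply/eqP; rewrite eq_le; apply/andP; split; last by apply: integral_ge0.
  by apply: le_trans L0; rewrite le_eqVlt; apply/orP; left; apply/eqP;
    apply: eq_integral => p _; rewrite gee0_abs.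
have := (ae_eq_integral_abs _ mQ mLoo).1 L1.
apply: ae_sub => p H Qp; have [/eqP] : `|cut M (u p)|%:E = 0%:E := H Qp.
by rewrite normr_eq0 => /eqP; exact: cut_eq0_le.
Qed.

End cut_vanish.
End maximum_principle.

(** * Boundedness near a point *)

Section local_bound.
Context {R : realType}.
Notation mu := (@lebesgue_measure R).

Lemma bilinear_col2 (A : 'M[R]_2) (x y : 'cV[R]_2) :
  (x^T *m A *m y) 0 0 = A 0 0 * (x 0 0 * y 0 0) + A 0 1 * (x 0 0 * y 1 0) +
    A 1 0 * (x 1 0 * y 0 0) + A 1 1 * (x 1 0 * y 1 0).
Proof.
rewrite !mxE !big_ord_recl big_ord0 !mxE !big_ord_recl !big_ord0 !mxE.
have -> : lift (ord0 : 'I_2) (ord0 : 'I_1) = 1 by apply/val_inj.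
by rewrite (_ : ord0 = 0)//; ring.
Qed.

Lemma sym_bilinear_col2 (A : 'M[R]_2) (x y : 'cV[R]_2) : A^T = A ->
  (x^T *m A *m y) 0 0 = sym_form (A 0 0) (A 0 1) (A 1 1) (x 0 0) (x 1 0) (y 0 0) (y 1 0).
Proof.
move=> sA; rewrite bilinear_col2 /sym_form.
have -> : A 1 0 = A 0 1 by rewrite -[in LHS]sA mxE.
ring.
Qed.

Lemma qform_Dmx (f : R -> R) (x : R) (xi : 'cV[R]_2) :
  qform (Dmx f x) xi = xi 0 0 ^+ 2 + f x ^+ 2 * xi 1 0 ^+ 2.
Proof. by rewrite /qform bilinear_col2 !mxE/=; ring. Qed.

Definition col2 (z0 z1 : R) : 'cV[R]_2 := \col_i (if i == 0 then z0 else z1).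

(** What an integrable bound on the energy and the error along a line gives for the
restriction of [v] to this line and its derivative. *)
Lemma energy_ge_line (f : R -> R) (u ux uy v vx vy : R * R -> R) (p : R * R) :
  v p ^+ 2 + vx p ^+ 2 <= 2 * (energy u ux uy p + approx_error f u ux uy v vx vy p) /\
  v p ^+ 2 + f p.1 ^+ 2 * vy p ^+ 2 <=
    2 * (energy u ux uy p + approx_error f u ux uy v vx vy p).
Proof.
have sq (x : R) : 0 <= x ^+ 2 by exact: sqr_ge0.
have sq2 (x : R) : 0 <= 2 * x ^+ 2 by apply: mulr_ge0.
rewrite /energy /approx_error; split; rewrite -subr_ge0.
  rewrite [X in 0 <= X](_ : _ = (v p - 2 * u p) ^+ 2 + (vx p - 2 * ux p) ^+ 2 +
    2 * uy p ^+ 2 + 2 * (f p.1 * vy p - uy p) ^+ 2); last by ring.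
  exact: (addr_ge0 (addr_ge0 (addr_ge0 (sq _) (sq _)) (sq2 _)) (sq2 _)).
rewrite [X in 0 <= X](_ : _ = (v p - 2 * u p) ^+ 2 + (f p.1 * vy p - 2 * uy p) ^+ 2 +
  2 * ux p ^+ 2 + 2 * (vx p - ux p) ^+ 2); last by ring.
exact: (addr_ge0 (addr_ge0 (addr_ge0 (sq _) (sq _)) (sq2 _)) (sq2 _)).
Qed.

(** This replaces the integrand of the weak formulation, which may fail to be Borel, by a
function [G] on [Q] that is Borel in the application. *)
Lemma weak_solution_tested (Omega : set (R * R)) (f : R -> R) (A : R -> R -> R -> 'M[R]_2)
    (u ux uy wx wy : R * R -> R) (B00 B01 B11 : plane R -> R) (G : plane R -> R)
    (Q : set (plane R)) :
  (forall x y z, Omega (x, y) -> (A x y z)^T = A x y z) ->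
  {ae leb2 R, forall p : plane R, Omega p -> [/\ B00 p = A p.1 p.2 (u p) 0 0,
     B01 p = A p.1 p.2 (u p) 0 1 & B11 p = A p.1 p.2 (u p) 1 1]} ->
  Q `<=` Omega ->
  (forall p : plane R, Q p -> p.1 != 0 ->
    G p = sym_form (B00 p) (B01 p) (B11 p) (wx p) (wy p / f p.1) (ux p) (uy p / f p.1)) ->
  (forall p : plane R, ~ Q p -> wx p = 0 /\ wy p = 0) ->
  \int[leb2 R]_(p in Omega)
    ((grad_of f wx wy p)^T *m A p.1 p.2 (u p) *m grad_of f ux uy p) 0 0 =
  \int[leb2 R]_(p in Q) G p.
Proof.
move=> sA BA QO GQ w0; rewrite Rintegral_mkcond [RHS]Rintegral_mkcond /Rintegral.
congr fine; apply: integral_ae_eq.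
apply: (ae_sub2 (ae_fst_neq0 (R := R)) BA) => p p0 BAp _; congr EFin.
rewrite /patch (_ : point = 0 :> R)//; case: ifPn => [/set_mem Op|nO].
  have [E0 E1 E2] := BAp Op.
  have sAp : (A p.1 p.2 (u p))^T = A p.1 p.2 (u p) by apply: sA; case: (p) Op.
  rewrite sym_bilinear_col2// -E0 -E1 -E2 /grad_of !mxE/=.
  case: ifPn => [/set_mem Qp|nQ]; first by rewrite GQ.
  have [-> ->] : wx p = 0 /\ wy p = 0 by apply: w0 => Qp; rewrite mem_set in nQ.
  by rewrite /sym_form !(mul0r, mulr0, addr0).
by case: ifPn => // /set_mem /QO Op; rewrite mem_set in nO.
Qed.

(** The constant of [sobolev_line] depends only on the integral of [s], hence not on
[n]. *)
Lemma line_bound (g g' : nat -> R -> R) (s : R -> \bar R) (a b k : R) : a < b -> 0 <= k ->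
  (forall n (x : R), is_derive x 1 (g n) (g' n x)) -> (forall n, continuous (g' n)) ->
  measurable_fun [set: measurableTypeR R] s ->
  (forall n x, ((g n x ^+ 2 + g' n x ^+ 2)%:E <= k%:E * s x)%E) -> (forall x, 0 <= s x)%E ->
  (\int[mu]_(x in `[a, b]) s x < +oo)%E ->
  exists2 K : R, 0 <= K & forall n x, a <= x <= b -> `|g n x| <= K.
Proof.
move=> ab k0 dg cg' ms gs s0 is_.
have mab : measurable (`[a, b]%classic : set (measurableTypeR R)) by exact: measurable_itv.
have is0 : (0 <= \int[mu]_(x in `[a, b]) s x)%E by exact: integral_ge0.
pose I := fine (\int[mu]_(x in `[a, b]) s x).
have IE : I%:E = (\int[mu]_(x in `[a, b]) s x)%E by rewrite fineK// ge0_fin_numE.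
have B n x : a <= x <= b -> `|g n x| <= (k * I + (b - a)) / (b - a) + (k * I + (b - a)).
  apply: (sobolev_line ab (dg n) (cg' n)).
  rewrite EFinM IE -(ge0_integralZl mu mab (measurable_funTS ms) (fun x _ => s0 x)); last first.
    by rewrite lee_fin.
  have cg := is_derive_continuous (dg n).
  apply: ge0_le_integral => //.
  - by move=> y _; rewrite lee_fin addr_ge0// sqr_ge0.
  - apply: measurable_funTS; apply/measurable_EFinP; apply: measurable_funD.
    + exact: (measurable_funX 2%N (continuous_measurable_fun cg)).
    + exact: (measurable_funX 2%N (continuous_measurable_fun (cg' n))).
  - by apply: measurable_funeM; exact: measurable_funTS.
exists ((k * I + (b - a)) / (b - a) + (k * I + (b - a))) => //.
by apply: le_trans (B 0%N a _); rewrite ?lexx ?(ltW ab).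
Qed.

Lemma open_contains_box (Omega : set (R * R)) (p0 : R * R) : open Omega -> Omega p0 ->
  exists2 rho : R, 0 < rho &
    forall q : R * R, `|p0.1 - q.1| <= 2 * rho -> `|p0.2 - q.2| <= 2 * rho -> Omega q.
Proof.
move=> oO Op0; have /nbhs_ballP[e /= e0 eO] : nbhs p0 Omega by exact: open_nbhs_nbhs.
exists (e / 4); first by rewrite divr_gt0.
have h : 2 * (e / 4) < e by move: e0; clear; lra.
move=> q q1 q2; apply: eO; split; rewrite -ball_normE /ball_ /=; exact: le_lt_trans h.
Qed.

(** The four edges lie on good lines; the vertical ones avoid [x = 0], where the
energy does not control the derivative along the line. *)
Lemma local_bound (Omega : set (R * R)) (f : R -> R) (A : R -> R -> R -> 'M[R]_2)
    (u : R * R -> R) (p0 : R * R) :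
  open Omega -> bounded_set Omega -> continuous f -> (forall t, 0 <= f t) ->
  (forall t, t != 0 -> 0 < f t) ->
  (forall x y z, Omega (x, y) -> (A x y z)^T = A x y z) ->
  equiv_Dmx f Omega A ->
  (forall i j, completed_measurable_fun (leb2 R) Omega
     (fun p : R * R => A p.1 p.2 (u p) i j)) ->
  weak_solution f Omega A (fun=> 0) u -> Omega p0 ->
  exists a b c d M, [/\ a < p0.1 < b, c < p0.2 < d &
    {ae leb2 R, forall p : plane R, rect a b c d p -> `|(u \_ Omega) p| <= M}].
Proof.
move=> oO bO cf f0 fpos sA [lam [Lam [lam0 lamLam ell]]] mA [ux [uy [Wu weak]]] Op0.
have [rho rho0 boxO] := open_contains_box oO Op0.
have [v [vx [vy [S [smv mS iS leS cvgS]]]]] := approximating_sequence Wu bO cf rho0 boxO.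
set u0 := u \_ Omega in leS cvgS *; set ux0 := ux \_ Omega in leS cvgS;
set uy0 := uy \_ Omega in leS cvgS.
set x0 := p0.1 in boxO iS *; set y0 := p0.2 in boxO iS *.
have e0 n p : 0 <= approx_error f u0 ux0 uy0 (v n) (vx n) (vy n) p by rewrite !addr_ge0// sqr_ge0.
have S0 p : (0 <= S p)%E.
  by apply: le_trans (leS 0%N p); rewrite lee_fin !addr_ge0// sqr_ge0.
have lx : x0 - rho < x0 by rewrite gtrBl.
have rx : x0 < x0 + rho by rewrite ltrDl.
have ly : y0 - rho < y0 by rewrite gtrBl.
have ry : y0 < y0 + rho by rewrite ltrDl.
have gH := good_horizontal mS S0 iS.
(* A good vertical line also has to avoid the zero of [f]. *)
have gV : {ae mu, forall x, x != 0 /\ (x0 - rho <= x <= x0 + rho ->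
    (\int[mu]_(y in `[(y0 - rho)%R, (y0 + rho)%R]) S (x, y) < +oo)%E)}.
  by apply: (ae_sub2 (ae_neq 0) (good_vertical mS S0 iS)).
have [a /andP[a1 a2] [az aV]] := ae_exists_itv lx gV.
have [b /andP[b1 b2] [bz bV]] := ae_exists_itv rx gV.
have [c /andP[c1 c2] cH] := ae_exists_itv ly gH.
have [d /andP[d1 d2] dH] := ae_exists_itv ry gH.
have [lxr lyr] : x0 - rho < x0 + rho /\ y0 - rho < y0 + rho.
  by split; [exact: lt_trans rx|exact: lt_trans ry].
have horiz y : (\int[mu]_(x in `[(x0 - rho)%R, (x0 + rho)%R]) S (x, y) < +oo)%E ->
    exists2 K : R, 0 <= K & forall n x, x0 - rho <= x <= x0 + rho -> `|v n (x, y)| <= K.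
  move=> Sy; apply: (@line_bound (fun n x => v n (x, y)) (fun n x => vx n (x, y)) (fun x => S (x, y))
    _ _ 2 lxr _ _ _ _ _ _ Sy) => //.
  - by move=> n x; have [_ _ [dv _]] := smv n; exact: (dv (x, y)).
  - by move=> n; have [[_ cvx _] _ _] := smv n; exact: (section_x_continuous (y := y) cvx).
  - exact: (measurableT_comp mS (measurable_pair2 y)).
  - move=> n x; apply: (@le_trans _ _ (2%:E * (energy u0 ux0 uy0 (x, y) +
      approx_error f u0 ux0 uy0 (v n) (vx n) (vy n) (x, y))%:E)%E).
      by rewrite -EFinM lee_fin; exact: (energy_ge_line f u0 ux0 uy0 (v n) (vx n) (vy n) (x, y)).1.
    by apply: lee_wpmul2l; [rewrite lee_fin|exact: leS].
have vert x : x != 0 ->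
    (\int[mu]_(y in `[(y0 - rho)%R, (y0 + rho)%R]) S (x, y) < +oo)%E ->
    exists2 K : R, 0 <= K & forall n y, y0 - rho <= y <= y0 + rho -> `|v n (x, y)| <= K.
  move=> xz Sx.
  have f2 : 0 < f x ^+ 2 by rewrite exprn_gt0// fpos.
  have k0 : 0 <= 2 + 2 / f x ^+ 2 by rewrite addr_ge0// divr_ge0// ltW.
  apply: (@line_bound (fun n y => v n (x, y)) (fun n y => vy n (x, y)) (fun y => S (x, y))
    _ _ (2 + 2 / f x ^+ 2) lyr k0 _ _ _ _ _ Sx) => //.
  - by move=> n y; have [_ _ [_ dv]] := smv n; exact: (dv (x, y)).
  - by move=> n; have [[_ _ cvy] _ _] := smv n; exact: (section_y_continuous (x := x) cvy).
  - exact: (measurableT_comp mS (measurable_pair1 x)).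
  - move=> n y; apply: (@le_trans _ _ ((2 + 2 / f x ^+ 2)%:E * (energy u0 ux0 uy0 (x, y) +
      approx_error f u0 ux0 uy0 (v n) (vx n) (vy n) (x, y))%:E)%E); last first.
      by apply: lee_wpmul2l; [rewrite lee_fin|exact: leS].
    rewrite -EFinM lee_fin.
    have [_ /=] := energy_ge_line f u0 ux0 uy0 (v n) (vx n) (vy n) (x, y).
    set E := energy _ _ _ _ + _ => H.
    rewrite mulrDl; apply: lerD.
      by apply: le_trans H; rewrite lerDl mulr_ge0 ?sqr_ge0.
    rewrite mulrAC ler_pdivlMr// mulrC; apply: le_trans H.
    by rewrite lerDr sqr_ge0.
have inx t : x0 - rho < t -> t < x0 + rho -> x0 - rho <= t <= x0 + rho.
  by move=> *; rewrite !ltW.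
have iny t : y0 - rho < t -> t < y0 + rho -> y0 - rho <= t <= y0 + rho.
  by move=> *; rewrite !ltW.
have [Ka Ka0 HKa] := vert a az (aV (inx _ a1 (lt_trans a2 rx))).
have [Kb Kb0 HKb] := vert b bz (bV (inx _ (lt_trans lx b1) b2)).
have [Kc Kc0 HKc] := horiz c (cH (iny _ c1 (lt_trans c2 ry))).
have [Kd Kd0 HKd] := horiz d (dH (iny _ (lt_trans ly d1) d2)).
pose M := Ka + Kb + (Kc + Kd).
have M0 : 0 <= M by rewrite !addr_ge0.
have [KaM KbM KcM KdM] : [/\ Ka <= M, Kb <= M, Kc <= M & Kd <= M].
  by move: Ka0 Kb0 Kc0 Kd0; rewrite /M; clear; split; lra.
have ab := lt_trans a2 b1; have cd := lt_trans c2 d1.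
have QQ0 : rect a b c d `<=` rect (x0 - rho) (x0 + rho) (y0 - rho) (y0 + rho).
  move=> [x y]; rewrite /rect /= !in_itv/= => -[/andP[h1 h2] /andP[h3 h4]].
  by split; apply/andP; split; apply: ltW;
    [exact: lt_le_trans a1 h1|exact: le_lt_trans h2 b2|
     exact: lt_le_trans c1 h3|exact: le_lt_trans h4 d2].
have QO : rect a b c d `<=` Omega.
  move=> p /QQ0; rewrite /rect /= !in_itv/= => -[/andP[h1 h2] /andP[h3 h4]].
  by apply: boxO; rewrite ler_norml; move: rho0 h1 h2 h3 h4; clear;
    move=> *; apply/andP; split; lra.
have bnd n (p : R * R) : rect a b c d p -> p.1 = a \/ p.1 = b \/ p.2 = c \/ p.2 = d ->
    `|v n p| <= M.
  case: p => x y /QQ0; rewrite /rect /= !in_itv/= => -[hx hy].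
  case=> [->|[->|[->|->]]].
  - exact: le_trans (HKa n y hy) KaM.
  - exact: le_trans (HKb n y hy) KbM.
  - exact: le_trans (HKc n x hx) KcM.
  - exact: le_trans (HKd n x hx) KdM.
exists a, b, c, d, M; split; [by rewrite a2|by rewrite c2|].
have mO := open_plane_measurable oO.
have mQ : measurable (rect a b c d : set (plane R)) by exact: measurable_rect.
have iSQ : (\int[leb2 R]_(p in rect a b c d) S p < +oo)%E.
  apply: le_lt_trans iS; apply: ge0_subset_integral => //.
  - exact: measurable_rect.
  - exact: measurable_funTS.
have [Lu Lx Ly _] := Wu.
have mu0 : measurable_fun [set: plane R] u0 := Lp2_measurable Lu.
have mux0 : measurable_fun [set: plane R] ux0 := Lp2_measurable Lx.
have muy0 : measurable_fun [set: plane R] uy0 := Lp2_measurable Ly.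
have patchm (g : plane R -> R) : measurable_fun Omega g -> measurable_fun setT (g \_ Omega).
  by move=> mg; apply/(measurable_restrictT _ mO).
have [g00 /patchm m00 ae00] := mA 0 0.
have [g01 /patchm m01 ae01] := mA 0 1.
have [g11 /patchm m11 ae11] := mA 1 1.
have BA : {ae leb2 R, forall p : plane R, Omega p ->
    [/\ (g00 \_ Omega) p = A p.1 p.2 (u p) 0 0, (g01 \_ Omega) p = A p.1 p.2 (u p) 0 1 &
     (g11 \_ Omega) p = A p.1 p.2 (u p) 1 1]}.
  apply: (ae_sub2 ae00 (ae_sub2 ae01 ae11 (fun p h1 h2 => conj h1 h2))) => p h0 [h1 h2] Op.
  by rewrite /patch mem_set//; split; [rewrite h0|rewrite h1|rewrite h2].
have ell' : {ae leb2 R, forall p : plane R, rect a b c d p -> forall z0 z1,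
    lam * (z0 ^+ 2 + f p.1 ^+ 2 * z1 ^+ 2) <=
      sym_form ((g00 \_ Omega) p) ((g01 \_ Omega) p) ((g11 \_ Omega) p) z0 z1 z0 z1 <=
    Lam * (z0 ^+ 2 + f p.1 ^+ 2 * z1 ^+ 2)}.
  apply: (ae_sub2 BA ell) => p h1 h2 Qp z0 z1.
  have Op := QO p Qp; have [-> -> ->] := h1 Op.
  have := h2 Op (u p) (col2 z0 z1); rewrite qform_Dmx /qform sym_bilinear_col2.
    by rewrite !mxE.
  by apply: sA; case: (p) Op.
have flat : {ae leb2 R, forall p : plane R, rect a b c d p -> dcut M (u0 p) * ux0 p = 0}.
  apply: (energy_limit cf fpos f0 m00 m01 m11 mu0 mux0 muy0 smv mS iSQ leS cvgS lam0 lamLam ell').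
  move=> n.
  have [[cv cvx cvy] _ [dvx dvy]] := smv n.
  have T := @cutoff_Wf12_0 R f Omega (v n) (vx n) (vy n) a b c d M cf cv cvx cvy dvx dvy ab cd QO
    (bnd n).
  have := weak _ _ _ T.
  have -> : \int[leb2 R]_(p in Omega)
      (0 * ((fun p : R * R => cut M (v n p)) \_ (rect a b c d)) p) = 0.
    by rewrite /Rintegral integral0_eq// => p _; rewrite mul0r.
  rewrite (weak_solution_tested (G := fun p => dcut M (v n p) * sym_form ((g00 \_ Omega) p)
    ((g01 \_ Omega) p) ((g11 \_ Omega) p) (vx n p) (vy n p) (ux0 p) (uy0 p / f p.1)) sA BA QO).
  - by move/eqP; rewrite oppr_eq0 => /eqP.
  - move=> p Qp pz; have fp : f p.1 != 0 by rewrite gt_eqF// fpos.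
    have Op := QO p Qp.
    rewrite /ux0 /uy0 /patch !mem_set// mulrAC divff// mul1r /sym_form; ring.
  - by move=> p nQ; rewrite /patch memNset.
apply: (cut_vanish ab fpos mu0 mux0 smv mS iSQ leS cvgS M0 _ flat) => n y hy.
by apply: bnd; [rewrite /rect /= !in_itv/= lexx (ltW ab)|left].
Qed.

End local_bound.

(** * Boundedness on compact subsets *)

Lemma in_Lp_infty_intro (R : realType) (D : set (R * R)) (v : R * R -> R) (M : R) :
  measurable_fun [set: plane R] (v \_ D) ->
  {ae leb2 R, forall p : plane R, `|(v \_ D) p| <= M} -> in_Lp D +oo%E v.
Proof.
move=> mv vM; rewrite /in_Lp inE; apply/andP; split; rewrite inE //=.
rewrite /finite_norm unlock /=; case: ifP => // _.
apply: (@le_lt_trans _ _ M%:E); last exact: ltry.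
by apply/ess_supP; apply: ae_sub vM => p; rewrite /= lee_fin.
Qed.

(** If [K] did not have the property, the sets whose complement in [K] has it would form a
proper filter without cluster point in [K]. *)
Lemma compact_induction (T : topologicalType) (K : set T) (P : set T -> Prop) :
  P set0 -> (forall A B, A `<=` B -> P B -> P A) -> (forall A B, P A -> P B -> P (A `|` B)) ->
  compact K -> (forall x, K x -> exists2 U, nbhs x U & P U) -> P K.
Proof.
move=> P0 Psub PU cK locP; apply: contrapT => nPK.
pose F : set (set T) := [set B | P (K `\` B)].
have FF : ProperFilter F.
  apply: Build_ProperFilter; first by rewrite /F /= setD0.
  split; first by rewrite /F /= setDT.
  - by move=> B C FB FC; rewrite /F /= setDIr; exact: PU.
  - by move=> B C BC; apply: Psub; exact: setDS.
have FK : F K by rewrite /F /= setDv.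
have [x [Kx clx]] := cK F FF FK.
have [U xU PU'] := locP x Kx.
have FU : F (~` U) by apply: Psub PU'; rewrite setDE setCK; exact: subIsetr.
by have [y []] := clx _ _ FU xU.
Qed.

Theorem mainTheorem3 (R : realType) (Omega : set (R * R)) (f : R -> R)
    (A : R -> R -> R -> 'M[R]_2) (u : R * R -> R) :
  bounded_domain Omega ->
  structured_geometry f ->
  bounded_measurable_coefficients Omega A ->
  equiv_Dmx f Omega A ->
  (forall i j, completed_measurable_fun (leb2 R) Omega
     (fun p : R * R => A p.1 p.2 (u p) i j)) ->
  weak_solution f Omega A (fun=> 0) u ->
  locally_bounded_in Omega u.
Proof.
move=> [oO _ _ bO] [_ cf f00 fpos _] [sA _ _ _] eqA mA wu D mD cD DO.
have f0 t : 0 <= f t.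
  by have [->|t0] := eqVneq t 0; [rewrite f00|exact: ltW (fpos _ t0)].
have subD : D `<=` Omega by apply: subset_trans DO; exact: subset_closure.
have [M HM] : exists M, {ae leb2 R, forall p : plane R, closure D p -> `|(u \_ Omega) p| <= M}.
  apply: (@compact_induction _ (closure D : set (R * R)) (fun E => exists M,
    {ae leb2 R, forall p : plane R, E p -> `|(u \_ Omega) p| <= M})) => //.
  - by exists 0; apply: ae_sub (ae_fst_neq0 (R := R)) => p _ [].
  - by move=> E E' EE' [M HM]; exists M; apply: ae_sub HM => p H /EE'.
  - move=> E E' [M HM] [M' HM']; exists (Num.max M M').
    by apply: (ae_sub2 HM HM') => p H H' [/H|/H']; rewrite le_max => ->; rewrite ?orbT.
  move=> p /DO Op.
  have [a [b [c [d [M [hx hy H]]]]]] := local_bound oO bO cf f0 fpos sA eqA mA wu Op.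
  exists (rect a b c d); last by exists M.
  exists (`]a, b[%classic, `]c, d[%classic).
    by split; apply: open_nbhs_nbhs; (split; first exact: interval_open);
      rewrite /= in_itv/=.
  by move=> [x y] [/= h1 h2]; split; exact: subset_itv_oo_cc.
have [ux [uy [[Lu _ _ _] _]]] := wu.
have mu0 : measurable_fun [set: plane R] (u \_ Omega) := Lp2_measurable Lu.
have uD : u \_ D = (u \_ Omega) \_ D.
  apply/funext => p; rewrite /patch; case: ifPn => // /set_mem Dp.
  by rewrite mem_set//; exact: subD.
apply: (@in_Lp_infty_intro _ _ _ (Num.max M 0)); rewrite uD.
  by apply/(measurable_restrictT _ mD); exact: measurable_funTS.
apply: ae_sub HM => p H; rewrite le_max /patch (_ : point = 0 :> R)//.
case: ifPn => [/set_mem Dp|_]; last by rewrite normr0 lexx orbT.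
apply/orP; left; move: H; rewrite /patch (_ : point = 0 :> R)//; apply.
exact: subset_closure.
Qed.
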